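(* Let $M$ be a connected triangulated surface with nonempty boundary, and let $B$ be the union of some or all of the components of the boundary $\partial M$, with $B$ nonempty. Then the group $\mathrm{Homeo}_{PL}(M,B)$ is left-orderable.
   Context: A group $G$ is left-orderable if there is a strict total ordering $<$ of its elements such that $g<h$ implies $fg<fh$ for all $f,g,h\in G$. For $M$ and $B$ as in the claim, $\mathrm{Homeo}(M,B)$ denotes the group, under composition, of homeomorphisms of $M$ to itself which are pointwise fixed on $B$, and $\mathrm{Homeo}_{PL}(M,B)$ denotes the subgroup of $\mathrm{Homeo}(M,B)$ consisting of the piecewise-linear homeomorphisms (with respect to the PL structure given by the triangulation of $M$). *)

(* Defs.v *)
From HB Require Import structures.
From mathcomp Require Import all_boot all_order all_algebra finmap.
From mathcomp Require Import all_classical all_reals topology normedtype.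
Import Order.TTheory GRing.Theory Num.Theory numFieldNormedType.Exports.

Set Implicit Arguments.
Unset Strict Implicit.
Unset Printing Implicit Defensive.

Local Open Scope classical_set_scope.
Local Open Scope ring_scope.

(* The subgroup [H] of [G] is left-orderable: only the values of [lt] on [H]
   matter. *)
Definition left_orderable (G : groupType) (H : set G) : Prop :=
  exists lt : G -> G -> Prop,
    [/\ forall g, H g -> ~ lt g g,
        forall f g h, H f -> H g -> H h -> lt f g -> lt g h -> lt f h,
        forall g h, H g -> H h -> [\/ lt g h, g = h | lt h g] &
        forall f g h, H f -> H g -> H h -> lt g h -> lt (f * g)%g (f * h)%g].

Section Homeo.
Variable M : topologicalType.

Record homeo : Type := Homeo {
  homeo_fun :> M -> M;
  homeo_inv : M -> M;
  homeo_funK : cancel homeo_fun homeo_inv;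
  homeo_invK : cancel homeo_inv homeo_fun;
  homeo_fun_cont : continuous homeo_fun;
  homeo_inv_cont : continuous homeo_inv }.

HB.instance Definition _ := gen_eqMixin homeo.
HB.instance Definition _ := gen_choiceMixin homeo.

Lemma homeoP (f g : homeo) : f =1 g -> f = g.
Proof.
case: f g => [f f' fK f'K cf cf'] [g g' gK g'K cg cg'] /= /funext fg.
subst g; have e : f' = g' by apply/funext => x; rewrite -{1}(g'K x) fK.
by subst g'; congr Homeo; exact: Prop_irrelevance.
Qed.

Lemma id_cont : continuous (@id M).
Proof. by move=> x; exact: cvg_id. Qed.

Definition homeo1 : homeo :=
  @Homeo id id (fun=> erefl) (fun=> erefl) id_cont id_cont.

Definition homeoV (f : homeo) : homeo :=
  Homeo (@homeo_invK f) (@homeo_funK f)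
        (@homeo_inv_cont f) (@homeo_fun_cont f).

Lemma homeo_comp_cont (f g : M -> M) :
  continuous f -> continuous g -> continuous (f \o g).
Proof. by move=> cf cg x; exact: continuous_comp (cg x) (cf _). Qed.

Definition homeoM (f g : homeo) : homeo :=
  Homeo (can_comp (@homeo_funK f) (@homeo_funK g))
        (can_comp (@homeo_invK g) (@homeo_invK f))
        (homeo_comp_cont (@homeo_fun_cont f) (@homeo_fun_cont g))
        (homeo_comp_cont (@homeo_inv_cont g) (@homeo_inv_cont f)).

Lemma homeoMA : associative homeoM.
Proof. by move=> f g h; exact: homeoP. Qed.

Lemma homeo1M : left_id homeo1 homeoM.
Proof. by move=> f; exact: homeoP. Qed.

Lemma homeoM1 : right_id homeo1 homeoM.
Proof. by move=> f; exact: homeoP. Qed.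

Lemma homeoVM : left_inverse homeo1 homeoV homeoM.
Proof. by move=> f; apply: homeoP => x; exact: homeo_funK. Qed.

Lemma homeoMV : right_inverse homeo1 homeoV homeoM.
Proof. by move=> f; apply: homeoP => x; exact: homeo_invK. Qed.

HB.instance Definition _ :=
  isGroup.Build homeo homeoMA homeo1M homeoM1 homeoVM homeoMV.

Definition Homeo_rel (B : set M) : set homeo :=
  [set h | forall x, B x -> h x = x].

End Homeo.

Definition homeomorphic_sets (S T : topologicalType) (A : set S) (B : set T)
  : Prop :=
  exists f : S -> T, exists g : T -> S,
    [/\ {within A, continuous f}, {within B, continuous g},
        (forall x, A x -> B (f x) /\ g (f x) = x) &
        (forall y, B y -> A (g y) /\ f (g y) = y)].

Definition half_plane (R : realType) : set (R * R) := [set z | 0 <= z.2].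
Arguments half_plane R : clear implicits.

Definition surface (R : realType) (M : topologicalType) : Prop :=
  [/\ hausdorff_space M, @second_countable M &
      forall p : M, exists U : set M, exists V : set (R * R),
        [/\ open_nbhs p U, open V & homeomorphic_sets U (V `&` half_plane R)]].

(* The interior is defined by charts onto open subsets of the plane and the
   boundary is its complement. *)
Definition surface_interior (R : realType) (M : topologicalType) : set M :=
  [set p | exists U : set M, exists V : set (R * R),
    [/\ open_nbhs p U, open V & homeomorphic_sets U V]].
Arguments surface_interior R M : clear implicits.

Definition surface_boundary (R : realType) (M : topologicalType) : set M :=
  ~` surface_interior R M.
Arguments surface_boundary R M : clear implicits.

Section Simplicial.
Variables (R : realType) (J : Type).
Local Notation E := (J -> R).

(* A simplex is represented by the finite set of its vertices. *)
Definition simplex_hull (s : {fset E}) : set E :=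
  [set x | exists l : E -> R,
    [/\ forall p, 0 <= l p, \sum_(p <- s) l p = 1 &
        x = \sum_(p <- s) l p *: p]].

Definition affinely_independent (s : {fset E}) : Prop :=
  forall l : E -> R, \sum_(p <- s) l p = 0 -> \sum_(p <- s) l p *: p = 0 ->
  forall p, p \in s -> l p = 0.

(* The complex need be neither finite nor locally finite.  The last condition
   says that two simplices meet in a common face or not at all, since the hull
   of the empty set is empty. *)
Definition simplicial_complex (K : set {fset E}) : Prop :=
  [/\ forall s, K s -> s != fset0 /\ affinely_independent s,
      forall s t, K s -> t != fset0 -> (t `<=` s)%fset -> K t &
      forall s t, K s -> K t ->
        simplex_hull s `&` simplex_hull t `<=` simplex_hull (s `&` t)%fset].

Definition polyhedron (K : set {fset E}) : set E :=
  \bigcup_(s in K) simplex_hull s.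

(* As in Munkres: each simplex of [K'] lies in a simplex of [K], and each
   simplex of [K] is a finite union of simplices of [K']. *)
Definition subdivision (K' K : set {fset E}) : Prop :=
  [/\ simplicial_complex K',
      forall s', K' s' -> exists2 s, K s & simplex_hull s' `<=` simplex_hull s &
      forall s, K s -> exists L : set {fset E},
        [/\ finite_set L, L `<=` K' & simplex_hull s = polyhedron L]].

Definition linear_on_simplex (s : {fset E}) (f : E -> E) : Prop :=
  forall l : E -> R, (forall p, 0 <= l p) -> \sum_(p <- s) l p = 1 ->
  f (\sum_(p <- s) l p *: p) = \sum_(p <- s) l p *: f p.

(* Only the values of [f] on the polyhedron of [K] matter. *)
Definition PL_map (K : set {fset E}) (f : E -> E) : Prop :=
  exists2 K', subdivision K' K &
    forall s', K' s' -> linear_on_simplex s' f /\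
      exists2 t, K t & f @` simplex_hull s' `<=` simplex_hull t.

(* [phi] is a homeomorphism from [M] onto the polyhedron of the complex [K] of
   dimension at most 2.  A polyhedron has the weak topology: a subset is closed
   iff it meets each simplex in a closed set.  On a single simplex, which lies
   in a finite-dimensional subspace, the product topology of R^J is the
   Euclidean one. *)
Definition triangulation (M : topologicalType) (K : set {fset E})
    (phi : M -> E) : Prop :=
  [/\ simplicial_complex K,
      forall s, K s -> (#|` s| <= 3)%N,
      set_bij [set: M] (polyhedron K) phi &
      forall C : set M, closed C <->
        forall s, K s ->
          closed ((phi @` C `&` simplex_hull s) : set {ptws J -> R})].

(* [phi \o h = f \o phi] says that [f] is [h] read on the polyhedron. *)
Definition Homeo_PL_rel (M : topologicalType) (K : set {fset E})
    (phi : M -> E) (B : set M) : set (homeo M) :=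
  Homeo_rel B `&`
  [set h | exists2 f : E -> E, PL_map K f & forall x, phi (h x) = f (phi x)].

End Simplicial.

(* Main.v *)
Require Import Defs.
From HB Require Import structures.
From mathcomp Require Import all_boot all_order all_algebra finmap.
From mathcomp Require Import all_classical all_reals topology normedtype.
From mathcomp Require Import derive realfun trigo.
From mathcomp Require Import ring lra.
Import Order.TTheory GRing.Theory Num.Theory numFieldNormedType.Exports.

Local Open Scope classical_set_scope.
Local Open Scope ring_scope.

Set Implicit Arguments.
Unset Strict Implicit.
Unset Printing Implicit Defensive.

(** A group is left-orderable as soon as, for every finite list of elements
    [g^-1 h] that are not all trivial, there are sets of positive and of null
    elements that are compatible with the product and classify the list, not all
    of it being null: recursion on the null part orders a finite list, and
    compactness orders the group ([left_orderable_of_signs]).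

    For piecewise-linear homeomorphisms the signs are read from germs. Consider a
    flat rectangle in the polyhedron with a distinguished edge, called a side
    ([side]). If [a] fixes the edge and maps the side to itself near a point [x]
    of the edge, it acts there by [x + s v + t w |-> x + (s + b t) v + d t w] with
    [d > 0]. These germs form a group of affine type, which is ordered by the
    comparison of [d] with 1, then of [b] with 0 ([germ_signs]). So the theorem
    follows if, given finitely many pairs [(g, h)] such that, at each side where
    all the [g^-1 h] have germs, these germs are trivial, all the pairs satisfy
    [g = h].

    To see this, let [C] be the set where [g] and [h] agree for all pairs. It
    contains [B], hence an edge of the boundary. Such an edge belongs to a single
    triangle, so at a generic point of it every [g^-1 h] has a germ on the only
    side; the germ is trivial, and [C] has a nonempty interior [W]
    ([start_edge], [start_somewhere]). Call a point tame if it has a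
    neighbourhood made of two sides with a common edge, or of one side at the
    boundary, on each of which all the [g] and [h] are affine. If a tame point is
    in the closure of [W], then [g] and [h] agree on an open part of one side,
    hence on all of it, in particular on the common edge. Every [g^-1 h] then
    fixes one side, so it maps the other one to itself, and has a germ there; it
    is trivial, and the point is in [W] ([cross_edge], [spread_tame]). The points
    that are not tame are finitely many in each simplex: vertices, and crossings
    of the finitely many lines along which the maps break ([not_tame_finite]).
    They form a closed discrete set, and a surface is not disconnected locally by
    a point ([no_local_cut]). So the closure of [W] is open, and is all of the
    connected surface ([spread_over], [coincidence_everywhere]).

    Two topological facts are needed about a triangulated surface. A point with a
    chart onto an open subset of the half plane that maps it to the boundary line
    has no chart onto an open subset of the plane ([boundary_not_interior]), and
    an edge belongs to one or two triangles ([edge_typeP]). The first fact, and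
    the bound in the second one, are proved with winding numbers of loops in the
    plane. *)

(** * Left orders from local signs *)

Definition mul_closed (G : groupType) (P : set G) : Prop :=
  forall g h, P g -> P h -> P (g * h)%g.

(** Signs on a subset of [G], with [null] in the role of the kernel of a homomorphism
    to an ordered group; only the elements of the list have to be classified. *)
Record sign_pair (G : groupType) (A : seq G) (pos null : set G) : Prop := {
  sign_pp : mul_closed pos;
  sign_pn : forall g h, pos g -> null h -> pos (g * h)%g;
  sign_np : forall g h, null g -> pos h -> pos (g * h)%g;
  sign_nn : mul_closed null;
  sign_nV : forall g, null g -> null (g^-1)%g;
  sign_p1 : ~ pos 1%g;
  sign_dec : forall a, a \in A -> [\/ pos a, pos (a^-1)%g | null a];
  sign_neq0 : exists2 a, a \in A & ~ null a }.

Definition locally_signed (G : groupType) (D : set G) : Prop :=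
  forall A : seq G, (forall a, a \in A -> D a) ->
    (exists2 a, a \in A & a != 1%g) ->
    exists pos null, sign_pair A pos null.

(** A lexicographic combination: the null elements of the list are fewer, and are
    ordered by induction with signs of their own. *)
Lemma finite_positive_cone (G : groupType) (D : set G) :
  locally_signed D ->
  forall A : seq G, (forall a, a \in A -> D a /\ a != 1%g) ->
  exists Q : set G, [/\ mul_closed Q, ~ Q 1%g &
    forall a, a \in A -> Q a \/ Q (a^-1)%g].
Proof.
move=> sD A; have [n] := ubnP (size A).
elim: n A => // n IH A sA AD.
case: A sA AD => [_ _|a0 A' sA AD]; first by exists set0; split.
set A := a0 :: A' in sA AD *.
have [|pos [null S]] := sD A (fun a aA => (AD a aA).1).
  by exists a0; [rewrite mem_head | have [] := AD a0 (mem_head _ _)].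
pose A0 := [seq a <- A | `[< null a >]].
have sA0 : (size A0 < n)%N.
  rewrite ltnS in sA; apply: leq_trans sA.
  rewrite size_filter -(count_predC (fun a => `[< null a >]) A) -addn1 leq_add2l.
  rewrite -has_count; apply/hasP; have [a aA na] := sign_neq0 S.
  by exists a => //=; apply/asboolPn.
have [|Q [Qm Q1 QA]] := IH A0 sA0.
  by move=> a; rewrite mem_filter => /andP[_ /AD].
exists [set g | pos g \/ (null g /\ Q g)]; split => [g h /=||a aA /=].
- move=> [pg|[ng Qg]] [ph|[nh Qh]].
  + by left; exact: (sign_pp S).
  + by left; by apply: (sign_pn S).
  + by left; by apply: (sign_np S).
  + by right; split; [exact: (sign_nn S) | exact: Qm].
- by move=> [|[_ //]]; exact: sign_p1 S.
- have [pa|pa|na] := sign_dec S aA; [by left; left|by right; left|].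
  have [|Qa|Qa] := QA a; rewrite ?mem_filter ?aA ?andbT; first exact/asboolP.
    by left; right.
  by right; right; split => //; exact: (sign_nV S).
Qed.

(** Compactness: an ultrafilter on finite lists that contains, for each [g], the
    lists through [g] glues the cones of the finite lists into one. *)
Lemma positive_cone (G : groupType) (D : set G) :
  locally_signed D ->
  exists P : set G, [/\ mul_closed P, ~ P 1%g &
    forall a, D a -> [\/ a = 1%g, P a | P (a^-1)%g]].
Proof.
move=> sD; pose r (A : seq G) := [seq a <- A | `[< D a /\ a != 1%g >]].
have rD A a : a \in r A -> D a /\ a != 1%g.
  by rewrite mem_filter => /andP[/asboolP].
have /choice[Q QP] A := finite_positive_cone sD (rD A).
pose F : set_system (seq G) :=
  [set X : set (seq G) | exists S : seq G, forall A : seq G, {subset S <= A} -> X A].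
have FF : ProperFilter F.
  split; first by move=> [S] /(_ S); exact.
  split.
  - by exists nil.
  - move=> X Y [S XS] [T YT]; exists (S ++ T) => A sub; split.
      by apply: XS => a aS; apply: sub; rewrite mem_cat aS.
    by apply: YT => a aS; apply: sub; rewrite mem_cat aS orbT.
  - by move=> X Y XY [S XS]; exists S => A /XS /XY.
have [U [UU FU]] := ultraFilterLemma FF.
have UP : ProperFilter U by exact: ultra_proper.
exists [set g | U [set A | Q A g]]; split => [g h /= Ug Uh||a Da /=].
- by apply: filterS2 Ug Uh => A; have [Qm _ _] := QP A; exact: Qm.
- move=> /=; suff -> : [set A | Q A 1%g] = set0 by exact: filter_not_empty.
  by rewrite predeqE => A; split => //; have [] := QP A.
- have [->|a1] := eqVneq a 1%g; first by constructor 1.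
  have Ua : U [set A | Q A a \/ Q A (a^-1)%g].
    apply: FU; exists [:: a] => A sub; have [_ _] := QP A; apply.
    by rewrite mem_filter sub ?mem_head// andbT; apply/asboolP.
  have [?|Una] := in_ultra_setVsetC [set A | Q A a] UU; first by constructor 2.
  constructor 3; apply: filterS2 Ua Una => A /= [//|//].
Qed.

Lemma left_orderable_of_signs (G : groupType) (H : set G) :
  locally_signed [set a | exists g h, [/\ H g, H h & a = (g^-1 * h)%g]] ->
  left_orderable H.
Proof.
move=> /positive_cone[P [Pm P1 PD]].
exists (fun g h => P (g^-1 * h)%g); split.
- by move=> g _; rewrite mulVg.
- move=> f g h _ _ _ fg gh; have := Pm _ _ fg gh.
  by rewrite mulgA -(mulgA _ g) mulgV mulg1.
- move=> g h Hg Hh; have [||gh|hg] := PD (g^-1 * h)%g; first by exists g, h.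
  + by move=> /(congr1 (fun x => g * x)%g); rewrite mulgA mulgV mul1g mulg1; constructor 2.
  + by constructor 1.
  + by constructor 3; move: hg; rewrite invgM invgK.
- by move=> f g h _ _ _; rewrite invgM mulgA -(mulgA _ _ f) mulVg mulg1.
Qed.

(** * Winding of loops in the plane *)

Section ContinuityRules.
Variables (R : realType) (T : topologicalType).
Implicit Types (f g : T -> R) (x : T).

Lemma cont_pair (U V : topologicalType) (f : T -> U) (g : T -> V) x :
  {for x, continuous f} -> {for x, continuous g} ->
  {for x, continuous (fun y => (f y, g y))}.
Proof. by move=> cf cg; exact: cvg_pair. Qed.

Lemma cont_fst (U V : topologicalType) (f : T -> U * V) x :
  {for x, continuous f} -> {for x, continuous (fun y => (f y).1)}.
Proof. by move=> cf; apply: (@continuous_comp _ _ _ f fst) => //; exact: cvg_fst. Qed.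

Lemma cont_snd (U V : topologicalType) (f : T -> U * V) x :
  {for x, continuous f} -> {for x, continuous (fun y => (f y).2)}.
Proof. by move=> cf; apply: (@continuous_comp _ _ _ f snd) => //; exact: cvg_snd. Qed.

Lemma contD f g x : {for x, continuous f} -> {for x, continuous g} ->
  {for x, continuous (fun y => f y + g y)}.
Proof. by move=> cf cg; exact: cvgD. Qed.

Lemma contB f g x : {for x, continuous f} -> {for x, continuous g} ->
  {for x, continuous (fun y => f y - g y)}.
Proof. by move=> cf cg; exact: cvgB. Qed.

Lemma contN f x : {for x, continuous f} -> {for x, continuous (fun y => - f y)}.
Proof. by move=> cf; exact: cvgN. Qed.

Lemma contM f g x : {for x, continuous f} -> {for x, continuous g} ->
  {for x, continuous (fun y => f y * g y)}.
Proof. by move=> cf cg; exact: cvgM. Qed.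

Lemma contV f x : f x != 0 -> {for x, continuous f} ->
  {for x, continuous (fun y => (f y)^-1)}.
Proof. by move=> f0 cf; exact: cvgV. Qed.

Lemma cont_cst (U : topologicalType) (c : U) x :
  {for x, continuous (fun _ : T => c)}.
Proof. exact: cvg_cst. Qed.

Lemma cont_max f g x : {for x, continuous f} -> {for x, continuous g} ->
  {for x, continuous (fun y => Num.max (f y) (g y))}.
Proof. by move=> cf cg; apply: (@continuous_max R T f g x). Qed.

Lemma cont_min f g x : {for x, continuous f} -> {for x, continuous g} ->
  {for x, continuous (fun y => Num.min (f y) (g y))}.
Proof. by move=> cf cg; apply: (@continuous_min R T f g x). Qed.

Lemma cont_comp (U V : topologicalType) (f : T -> U) (g : U -> V) x :
  {for x, continuous f} -> {for (f x), continuous g} ->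
  {for x, continuous (fun y => g (f y))}.
Proof. by move=> cf cg; exact: continuous_comp. Qed.

Lemma open_norm_lt f (e : R) : continuous f -> open [set x | `|f x| < e].
Proof.
move=> cf; apply: (@open_comp _ _ (fun x => `|f x|) [set u : R | u < e]).
  by move=> x _; exact: (cont_comp (cf x) (@norm_continuous _ _ _)).
exact: open_lt.
Qed.

Lemma open_gt0 f : continuous f -> open [set x | 0 < f x].
Proof.
move=> cf; apply: (@open_comp _ _ f [set u : R | 0 < u]); last exact: open_gt.
by move=> x _; exact: cf.
Qed.

End ContinuityRules.

Lemma cont_id (T : topologicalType) (x : T) : {for x, continuous (fun y : T => y)}.
Proof. exact: cvg_id. Qed.

Lemma cont_for (T U : topologicalType) (f : T -> U) :
  (forall x, {for x, continuous f}) -> continuous f.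
Proof. by []. Qed.

(* Keyed on the head symbol of the function, since blind unification against
   each rule is slow. *)
Ltac cont := lazymatch goal with
  | |- {for _, continuous (fun y => y)} => exact: cont_id
  | |- {for _, continuous (fun _ => ?c)} => exact: cont_cst
  | |- {for _, continuous (fun y => (_, _))} => apply: cont_pair; cont
  | |- {for _, continuous (fun y => _ + - _)} => apply: contB; cont
  | |- {for _, continuous (fun y => _ + _)} => apply: contD; cont
  | |- {for _, continuous (fun y => - _)} => apply: contN; cont
  | |- {for _, continuous (fun y => _ * _)} => apply: contM; cont
  | |- {for _, continuous (fun y => Num.max _ _)} => apply: cont_max; cont
  | |- {for _, continuous (fun y => Num.min _ _)} => apply: cont_min; cont
  | |- {for _, continuous (fun y => fst _)} => apply: cont_fst; cont
  | |- {for _, continuous (fun y => snd _)} => apply: cont_snd; cont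
  | |- {for _, continuous fst} => exact: cvg_fst
  | |- {for _, continuous snd} => exact: cvg_snd
  | |- {for _, continuous ?F} =>
      first [match goal with h : {for _, continuous F} |- _ => exact h end | assumption | solve [auto]]
  end.

Section Winding.
Variable R : realType.
Local Notation plane := (R * R)%type.
Implicit Types (a b z : plane) (s t : R).

Definition dot a b : R := a.1 * b.1 + a.2 * b.2.
Definition cross a b : R := a.1 * b.2 - a.2 * b.1.

(** [polar a x]: the nonzero vector [a] has argument [x]. *)
Definition polar a (x : R) : Prop :=
  exists2 r, 0 < r & a = (r * cos x, r * sin x).

Lemma polar_exists a : a != (0, 0) -> exists x, polar a x.
Proof.
case: a => a1 a2 /eqP a0; pose r := Num.sqrt (a1 ^+ 2 + a2 ^+ 2).
have n0 : 0 < a1 ^+ 2 + a2 ^+ 2.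
  rewrite lt_neqAle addr_ge0 ?sqr_ge0// andbT eq_sym paddr_eq0 ?sqr_ge0//.
  by apply/negP => /andP[]; rewrite !sqrf_eq0 => /eqP z1 /eqP z2; case: a0; rewrite z1 z2.
have r0 : 0 < r by rewrite sqrtr_gt0.
have rr : r ^+ 2 = a1 ^+ 2 + a2 ^+ 2 by rewrite sqr_sqrtr// ltW.
have c1 : -1 <= a1 / r <= 1.
  rewrite -ler_norml normrM normfV (gtr0_norm r0) ler_pdivrMr// mul1r.
  by rewrite -[leLHS]sqrtr_sqr ler_sqrt ?lerDl ?sqr_ge0// ltW.
have s0 : Num.sqrt (1 - (a1 / r) ^+ 2) = `|a2| / r.
  rewrite (_ : 1 - _ = (a2 / r) ^+ 2).
    by rewrite sqrtr_sqr normrM normfV (gtr0_norm r0).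
  rewrite !expr_div_n rr; apply: (mulIf (lt0r_neq0 n0)).
  by rewrite mulrBl !divfK ?gt_eqF//; ring.
have [a2p|a2n] := leP 0 a2.
  exists (acos (a1 / r)), r => //; rewrite acosK// sin_acos// s0 ger0_norm//.
  by congr pair; rewrite mulrC divfK// gt_eqF.
exists (- acos (a1 / r)), r => //; rewrite cosN sinN acosK// sin_acos// s0.
by rewrite ltr0_norm//; congr pair; rewrite mulrC ?mulNr ?opprK divfK// gt_eqF.
Qed.

(** The angle between [a] and [b] is given by an arctangent as long as it is acute,
    and then depends continuously on both. *)
Lemma polar_rot a b x : polar a x -> 0 < dot a b ->
  polar b (x + atan (cross a b / dot a b)).
Proof.
move=> [r r0 ->]; case: b => b1 b2; rewrite /dot /cross /=.
set d := _ + _; set c := _ - _ => d0; set t := atan _.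
have ct : 0 < cos t by rewrite cos_gt0_pihalf// atan_gtNpi2 atan_ltpi2.
have st : sin t = c / d * cos t.
  have := @atanK R (c / d); rewrite -/t /tan => /(congr1 (fun x => x * cos t)).
  by rewrite divfK// gt_eqF.
exists (d / (r * cos t)); first by rewrite divr_gt0// mulr_gt0.
have cs := cos2Dsin2 x.
rewrite cosD sinD st; congr pair.
  transitivity (d / r * cos x - c / r * sin x); last by field; rewrite !gt_eqF.
  transitivity ((cos x ^+ 2 + sin x ^+ 2) * b1); first by rewrite cs mul1r.
  by rewrite /d /c; field; rewrite gt_eqF.
transitivity (d / r * sin x + c / r * cos x); last by field; rewrite !gt_eqF.
transitivity ((cos x ^+ 2 + sin x ^+ 2) * b2); first by rewrite cs mul1r.
by rewrite /d /c; field; rewrite gt_eqF.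
Qed.

Lemma polar_cos1 a x y : polar a x -> polar a y -> cos (y - x) = 1.
Proof.
move=> [r r0 ->] [q q0 [e1 e2]].
have cx := cos2Dsin2 x; have cy := cos2Dsin2 y.
have rq : r = q.
  apply/eqP; rewrite -(@eqrXn2 _ 2) ?ltW//; apply/eqP.
  transitivity ((r * cos x) ^+ 2 + (r * sin x) ^+ 2).
    by rewrite !exprMn -mulrDr cx mulr1.
  by rewrite e1 e2 !exprMn -mulrDr cy mulr1.
rewrite rq in e1 e2; have q1 : q != 0 by rewrite gt_eqF.
by rewrite cosB -(mulfI q1 e1) -(mulfI q1 e2) -!expr2.
Qed.

Definition in_square (N : R) z := (`|z.1| <= N) && (`|z.2| <= N).

Definition clamp (N t : R) : R := Num.max (- N) (Num.min N t).

Lemma clamp_id N t : `|t| <= N -> clamp N t = t.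
Proof. by rewrite ler_norml /clamp => /andP[h1 h2]; rewrite (min_idPr h2) (max_idPr h1). Qed.

Lemma clamp_le N t : 0 <= N -> `|clamp N t| <= N.
Proof.
move=> N0; rewrite /clamp ler_norml le_max lexx /= ge_max ge_min lexx /= andbT.
by rewrite (le_trans _ N0)// oppr_le0.
Qed.

Lemma cont_clamp N (T : topologicalType) (f : T -> R) x :
  {for x, continuous f} -> {for x, continuous (fun y => clamp N (f y))}.
Proof. by move=> cf; rewrite /clamp; cont. Qed.

Lemma compact_square N : compact [set z | in_square N z].
Proof.
rewrite (_ : mkset _ = `[-N, N] `*` `[-N, N]).
  by apply: compact_setX; exact: segment_compact.
by rewrite predeqE => -[a b]; rewrite /in_square /= !in_itv /= !ler_norml; split=> [/andP[]|[-> ->]].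
Qed.

(** Uniform continuity, in the form used to lift arguments: at nearby points of the
    square the values of [f] make an acute angle. *)
Lemma dot_gt0_near (f : plane -> plane) N : continuous f ->
  (forall z, f z <> (0, 0)) ->
  exists2 d, 0 < d & forall u v, in_square N u -> `|u.1 - v.1| < d ->
    `|u.2 - v.2| < d -> 0 < dot (f u) (f v).
Proof.
move=> cf f0.
pose P (d : R) u := forall v, `|u.1 - v.1| < d -> `|u.2 - v.2| < d ->
  0 < dot (f u) (f v).
have [+ _] := @compact_near_coveringP plane [set z | in_square N z].
move=> /(_ (@compact_square N)) nc.
have /nc : forall u, in_square N u -> \forall u' \near u & d \near (0:R)^'+, P d u'.
  move=> u uN.
  pose F (p : plane * plane) := dot (f p.1) (f p.2).
  have cF p : {for p, continuous F}.
    rewrite /F /dot.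
    have p1 : {for p, continuous (fun p : plane * plane => p.1)} by cont.
    have c1 : {for p, continuous (fun p : plane * plane => f p.1)}.
      exact: (cont_comp p1 (cf _)).
    have p2 : {for p, continuous (fun p : plane * plane => p.2)} by cont.
    have c2 : {for p, continuous (fun p : plane * plane => f p.2)}.
      exact: (cont_comp p2 (cf _)).
    exact: (contD (contM (cont_fst c1) (cont_fst c2))
                  (contM (cont_snd c1) (cont_snd c2))).
  have F0 : 0 < F (u, u).
    rewrite /F /dot /=; have := f0 u; case: (f u) => a b /= ab.
    rewrite -!expr2 lt_neqAle addr_ge0 ?sqr_ge0// andbT eq_sym paddr_eq0 ?sqr_ge0//.
    apply/negP => /andP[]; rewrite !sqrf_eq0 => /eqP a0 /eqP b0.
    by apply: ab; rewrite a0 b0.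
  have : \forall p \near (u, u), 0 < F p by exact: (cF _ _ (lt_nbhsr F0)).
  move=> /nbhs_ballP[e /= e0 eF].
  exists (ball u (e / 2), [set d | 0 < d /\ d < e / 2]) => /=.
    split; first by apply: nbhsx_ballx; rewrite divr_gt0.
    by apply: filterI; [exact: nbhs_right_gt|apply: nbhs_right_lt; rewrite divr_gt0].
  move=> [u' d] /= [uu' [d0 de]] v v1 v2.
  apply: (eF (u', v)); split => /=.
    by apply: le_ball uu'; rewrite ler_pdivrMr// ler_peMr ?ltW// ltr1n.
  rewrite (splitr e); apply: ball_triangle uu' _.
  by split; rewrite /ball /= ?(lt_trans v1)// ?(lt_trans v2)//.
move=> nd.
have [d [d0 dP]] : exists d, 0 < d /\ forall u, in_square N u -> P d u.
  by apply: (@filter_ex _ (0:R)^'+); apply: filterI => //; exact: nbhs_right_gt.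
by exists d => // u v uN; exact: dP.
Qed.

(** The argument is the sum of the angles between consecutive values of [f] along
    the subdivided segment from the origin to [z]. *)
Lemma arg_lift (f : plane -> plane) N : continuous f ->
  (forall z, f z <> (0, 0)) -> 0 < N ->
  exists2 th : plane -> R, continuous th &
    forall z, in_square N z -> polar (f z) (th z).
Proof.
move=> cf f0 N0; have [d d0 dP] := dot_gt0_near N cf f0.
have [n nN] : exists n, N / n.+1%:R < d.
  exists (Num.bound (N / d)); rewrite ltr_pdivrMr ?ltr0n// mulrC -ltr_pdivrMr//.
  have := archi_boundP (_ : 0 <= N / d); rewrite divr_ge0 ?ltW// => /(_ isT) h.
  by apply: lt_trans h _; rewrite ltr_nat.
pose c z : plane := (clamp N z.1, clamp N z.2).
pose u k z : plane := (k%:R / n.+1%:R * (c z).1, k%:R / n.+1%:R * (c z).2).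
have cN z : in_square N (c z) by rewrite /in_square !clamp_le ?ltW.
have uN k z : (k <= n.+1)%N -> in_square N (u k z).
  move=> kn; have /andP[h1 h2] := cN z.
  have k1 : `|k%:R / n.+1%:R| <= 1 :> R.
    by rewrite ger0_norm ?divr_ge0// ler_pdivrMr ?ltr0n// mul1r ler_nat.
  have le1 (t : R) : `|t| <= N -> `|k%:R / n.+1%:R| * `|t| <= N.
    by move=> tN; rewrite -[N]mul1r ler_pM.
  by apply/andP; split; rewrite normrM; exact: le1.
have dotu k z : (k < n.+1)%N -> 0 < dot (f (u k z)) (f (u k.+1 z)).
  have n10 : (0 : R) < n.+1%:R by rewrite ltr0n.
  have step t : `|t| <= N -> `|k%:R / n.+1%:R * t - k.+1%:R / n.+1%:R * t| < d.
    move=> tN; rewrite -mulrBl -mulrBl -natr1 opprD addNKr mulN1r mulNr normrN.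
    rewrite normrM normfV (gtr0_norm n10); apply: le_lt_trans nN.
    by rewrite mulrC ler_pM2r ?invr_gt0.
  have /andP[h1 h2] := cN z.
  by move=> kn; apply: dP; [exact/uN/ltnW|exact: step|exact: step].
have [x0 px0] := polar_exists (introN eqP (f0 (0, 0))).
pose th k z := x0 + \sum_(i < k)
  atan (cross (f (u i z)) (f (u i.+1 z)) / dot (f (u i z)) (f (u i.+1 z))).
have thP k z : (k <= n.+1)%N -> polar (f (u k z)) (th k z).
  elim: k => [_|k IH kn].
    by rewrite /th big_ord0 addr0 /u !mul0r.
  rewrite /th big_ord_recr /= addrA; apply: polar_rot; last exact: dotu.
  exact/IH/ltnW.
exists (th n.+1); last first.
  move=> z /andP[h1 h2]; have := thP _ z (leqnn n.+1).
  by rewrite /u divff ?pnatr_eq0// !mul1r /c /= !clamp_id//; case: (z).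
move=> z; rewrite /th.
have cu k : {for z, continuous (u k)}.
  have c1 : {for z, continuous (fun z : plane => clamp N z.1)}.
    by apply: cont_clamp; cont.
  have c2 : {for z, continuous (fun z : plane => clamp N z.2)}.
    by apply: cont_clamp; cont.
  have : {for z, continuous (fun z : plane => (k%:R / n.+1%:R * clamp N z.1,
    k%:R / n.+1%:R * clamp N z.2))} by cont.
  by [].
have cfu k : {for z, continuous (fun z => f (u k z))}.
  exact: (cont_comp (cu k) (cf _)).
apply: contD; first exact: cont_cst.
apply: (cvg_big (@add_continuous R)) => i _.
have cq : {for z, continuous (fun z =>
    cross (f (u i z)) (f (u i.+1 z)) / dot (f (u i z)) (f (u i.+1 z)))}.
  rewrite /cross /dot; apply: contM; first by cont.
  by apply: contV; [rewrite gt_eqF//; exact: dotu|cont].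
exact: (cont_comp cq (@continuous_atan R _)).
Qed.

(** [winds c w]: along the loop [c], parametrized by [0, 1], the argument
    increases by [w]. *)
Definition winds (c : R -> plane) (w : R) : Prop :=
  exists th : R -> R, [/\ continuous th,
    forall t, 0 <= t <= 1 -> polar (c t) (th t) & w = th 1 - th 0].

Lemma cos_lt1 (x : R) : 0 < x < pi *+ 2 -> cos x < 1.
Proof.
move=> /andP[x0 xpi]; have h : 0 < sin (x / 2).
  by apply: sin_gt0_pi; move: x0 xpi; rewrite -mulr_natr => x0 xpi; apply/andP; split; lra.
have -> : x = (x / 2) *+ 2 by rewrite -mulr_natr; lra.
by rewrite cos_mulr2n cos2sin2 mulr2n; have := exprn_gt0 2 h; lra.
Qed.

(** [u] takes values in the multiples of a full turn, so the intermediate value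
    theorem makes it constant. *)
Lemma cos1_const (u : R -> R) : continuous u ->
  (forall t, 0 <= t <= 1 -> cos (u t) = 1) -> u 1 = u 0.
Proof.
move=> cu u1; apply/eqP; case: (eqVneq (u 1) (u 0)) => // u10.
pose lo := Num.min (u 0) (u 1); pose hi := Num.max (u 0) (u 1).
have lohi : lo < hi.
  by rewrite /lo /hi; case: (ltgtP (u 0) (u 1)) u10 => // ->; rewrite eqxx.
pose e := Num.min ((hi - lo) / 2) 1.
have e0 : 0 < e by rewrite lt_min divr_gt0//= subr_gt0.
have eh : e <= (hi - lo) / 2 by rewrite ge_min lexx.
have e1 : e <= 1 by rewrite ge_min lexx orbT.
have [||t tI ut] := @IVT R u 0 1 (lo + e) ler01.
- by apply: continuous_subspaceT.
- by rewrite -/lo -/hi; apply/andP; split; lra.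
have [||s sI us] := @IVT R u 0 1 lo ler01.
  by apply: continuous_subspaceT.
  by rewrite -/lo -/hi; apply/andP; split; lra.
have : cos e < 1 by apply: cos_lt1; rewrite e0 /= (le_lt_trans e1)// mulr2n; have := @pi_ge2 R; lra.
have c1 := u1 t tI; have c2 := u1 s sI.
have s2 : sin lo = 0.
  by apply/eqP; rewrite -sqrf_eq0 sin2cos2 -us c2 expr1n subrr.
by move: c1; rewrite ut cosD s2 mul0r subr0 -us c2 mul1r => ->; rewrite ltxx.
Qed.

Lemma winds_uniq c w w' : winds c w -> winds c w' -> w = w'.
Proof.
move=> [th [cth pth ->]] [th' [cth' pth' ->]].
suff : th' 1 - th 1 = th' 0 - th 0 by move=> h; lra.
apply: (@cos1_const (fun t => th' t - th t)) => [t|t t01].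
  by apply: contB; [exact: cth'|exact: cth].
by apply: polar_cos1; [exact: pth|exact: pth'].
Qed.

Lemma winds_exists c : continuous c -> (forall t, c t <> (0, 0)) ->
  exists w, winds c w.
Proof.
move=> cc c0; have [|||th cth pth] := @arg_lift (fun z => c z.1) 1.
- apply: cont_for => z; have c1 : {for z, continuous (fun z : plane => z.1)} by cont.
  exact: (cont_comp c1 (cc _)).
- by move=> z; exact: c0.
- exact: ltr01.
exists (th (1, 0) - th (0, 0)), (fun t => th (t, 0)); split => //.
  move=> t; have cp : {for t, continuous (fun t : R => (t, 0 : R))} by cont.
  exact: (cont_comp cp (cth _)).
move=> t /andP[t0 t1]; apply: (pth (t, 0)).
by rewrite /in_square /= normr0 ger0_norm// t1 ler01.
Qed.

(** A loop that contracts to a point in the punctured plane does not wind. *)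
Lemma winds_null (F : plane -> plane) c : continuous F ->
  (forall z, F z <> (0, 0)) ->
  (forall s, F (s, 0) = F (s, 1)) ->
  (forall t, F (0, t) = F (0, 0)) ->
  (forall t, F (1, t) = c t) -> winds c 0.
Proof.
move=> cF F0 Fp Fc F1; have [th cth pth] := arg_lift cF F0 (@ltr01 R).
have sq (s t : R) : 0 <= s <= 1 -> 0 <= t <= 1 -> in_square 1 (s, t).
  by move=> /andP[s0 s1] /andP[t0 t1]; rewrite /in_square /= !ger0_norm// s1.
have i0 : (0 : R) <= (0 : R) <= (1 : R) by apply/andP; split; lra.
have i1 : (0 : R) <= (1 : R) <= (1 : R) by apply/andP; split; lra.
have cl (t : R) : continuous (fun s => th (s, t)).
  move=> s; have cp : {for s, continuous (fun s : R => (s, t))} by cont.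
  exact: (cont_comp cp (cth _)).
have cr (s : R) : continuous (fun t => th (s, t)).
  move=> t; have cp : {for t, continuous (fun t : R => (s, t))} by cont.
  exact: (cont_comp cp (cth _)).
exists (fun t => th (1, t)); split.
- exact: cr.
- by move=> t tI; rewrite -F1; apply/pth/sq.
have -> : th (1, 1) - th (1, 0) = th (0, 1) - th (0, 0).
  apply: (@cos1_const (fun s => th (s, 1) - th (s, 0))) => [s|s sI].
    by apply: contB; exact: cl.
  by apply: (@polar_cos1 (F (s, 0))); [|rewrite Fp]; apply/pth/sq.
apply: esym; have /= := @cos1_const (fun t => th (0, t) - th (0, 0)).
rewrite subrr; apply => [t|t tI].
  apply: contB; last exact: cont_cst.
  exact: cr.
by apply: (@polar_cos1 (F (0, 0))); [|rewrite -(Fc t)]; apply/pth/sq.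
Qed.

Definition circle (r t : R) : plane :=
  (r * cos (pi *+ 2 * t), r * sin (pi *+ 2 * t)).

Lemma cont_circle r : continuous (circle r).
Proof.
move=> t; have ct : {for t, continuous (fun t : R => pi *+ 2 * t)} by cont.
have cc : {for t, continuous (fun t : R => cos (pi *+ 2 * t))}.
  exact: (cont_comp ct (@continuous_cos R _)).
have cs : {for t, continuous (fun t : R => sin (pi *+ 2 * t))}.
  exact: (cont_comp ct (@continuous_sin R _)).
have cp : {for t, continuous (fun t : R =>
  (r * cos (pi *+ 2 * t), r * sin (pi *+ 2 * t)))} by cont.
exact: cp.
Qed.

Lemma circle01 r : circle r 0 = circle r 1.
Proof. by rewrite /circle mulr0 mulr1 cos0 sin0 cos2pi sin2pi. Qed.

Lemma winds_circle r : 0 < r -> winds (circle r) (pi *+ 2).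
Proof.
move=> r0; exists (fun t => pi *+ 2 * t); split.
- by apply: cont_for => t; cont.
- by move=> t _; exists r.
- by rewrite mulr0 mulr1 subr0.
Qed.

(** Such a loop runs back along itself. *)
Lemma winds_palindrome c w : (forall t, c (1 - t) = c t) -> winds c w -> w = 0.
Proof.
move=> cs cw; suff : winds c (- w) by move=> /(winds_uniq cw) h; lra.
have [th [cth pth ->]] := cw; exists (fun t => th (1 - t)); split.
- move=> t; have ct : {for t, continuous (fun t : R => 1 - t)} by cont.
  exact: (cont_comp ct (cth _)).
- by move=> t /andP[t0 t1]; rewrite -cs; apply: pth; apply/andP; split; lra.
- by rewrite subrr subr0 opprB.
Qed.

Lemma winds_loop_int c w : winds c w -> c 0 = c 1 ->
  exists n : nat, `|w| = pi *+ 2 * n%:R.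
Proof.
move=> [th [cth pth wE]] c01; rewrite {w}wE; set w := _ - _.
have w1 : cos `|w| = 1.
  rewrite cos_norm; apply: (@polar_cos1 (c 0)); first by apply: pth; apply/andP; split; lra.
  by rewrite c01; apply: pth; apply/andP; split; lra.
have p0 : 0 < pi *+ 2 :> R by rewrite mulrn_wgt0// pi_gt0.
pose n := Num.truncn (`|w| / (pi *+ 2)); exists n.
have /andP[n1 n2] : n%:R <= `|w| / (pi *+ 2) < n.+1%:R.
  by apply: truncn_itv; rewrite divr_ge0//; exact: ltW.
rewrite ler_pdivlMr// in n1; rewrite ltr_pdivrMr// -natr1 mulrDl mul1r in n2.
pose y := `|w| - pi *+ 2 * n%:R.
have y0 : 0 <= y by rewrite subr_ge0 mulrC.
have y2 : y < pi *+ 2 by rewrite /y ltrBlDl mulrC.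
have cyk k : cos (`|w| - pi *+ 2 * k%:R) = cos `|w|.
  elim: k => [|k <-]; first by rewrite mulr0n mulr0 subr0.
  rewrite -[LHS]cosD2pi; congr cos; rewrite -natr1; ring.
have cy : cos y = 1 by rewrite /y cyk.
have [y00|y00] := eqVneq y 0; first by apply/eqP; rewrite -subr_eq0 -/y y00.
have := @cos_lt1 y; rewrite cy ltxx y2 lt_neqAle eq_sym y00 y0 => /(_ isT) //.
Qed.

End Winding.

(** * Maps of the punctured disc *)

Section PuncturedDisc.
Variable R : realType.
Local Notation plane := (R * R)%type.
Implicit Types (z : plane) (t : R).

Definition rad z : R := Num.sqrt (z.1 ^+ 2 + z.2 ^+ 2).

Lemma rad_polar (r x : R) : 0 <= r -> rad (r * cos x, r * sin x) = r.
Proof.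
move=> r0; rewrite /rad /= !exprMn -mulrDr cos2Dsin2 mulr1 sqrtr_sqr.
exact: ger0_norm.
Qed.

Lemma rad0 z : rad z = 0 -> z = (0, 0).
Proof.
case: z => a b /eqP; rewrite sqrtr_eq0 /= => h.
have : a ^+ 2 + b ^+ 2 == 0 by rewrite eq_le h addr_ge0 ?sqr_ge0.
by rewrite paddr_eq0 ?sqr_ge0// !sqrf_eq0 => /andP[/eqP-> /eqP->].
Qed.

Lemma rad_gt0 z : z <> (0, 0) -> 0 < rad z.
Proof. by move=> z0; rewrite lt_neqAle sqrtr_ge0 andbT eq_sym; apply/eqP => /rad0. Qed.

Lemma rad_ge z : `|z.1| <= rad z /\ `|z.2| <= rad z.
Proof.
have s0 : 0 <= z.1 ^+ 2 + z.2 ^+ 2 by rewrite addr_ge0 ?sqr_ge0.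
by rewrite /rad -!sqrtr_sqr !ler_sqrt// lerDl lerDr !sqr_ge0.
Qed.

Lemma rad_le z : rad z <= `|z.1| + `|z.2|.
Proof.
have n0 : 0 <= `|z.1| + `|z.2| by rewrite addr_ge0.
rewrite /rad -[leRHS](ger0_norm n0) -sqrtr_sqr ler_sqrt ?sqr_ge0//.
rewrite -(real_normK (num_real z.1)) -(real_normK (num_real z.2)).
by have := mulr_ge0 (normr_ge0 z.1) (normr_ge0 z.2); rewrite !expr2; lra.
Qed.

Lemma cont_rad : continuous rad.
Proof.
have -> : rad = fun z => Num.sqrt (z.1 * z.1 + z.2 * z.2).
  by apply/funext => z; rewrite /rad !expr2.
move=> z; have c : {for z, continuous (fun z : plane => z.1 * z.1 + z.2 * z.2)} by cont.
exact: (cont_comp c (@sqrt_continuous R _)).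
Qed.

Lemma continuous_within01 (u : R -> R) :
  continuous u -> {within `[0, 1], continuous u}.
Proof. by move=> cu; exact: continuous_subspaceT. Qed.

Lemma continuous_bounded01 (u : R -> R) : continuous u ->
  exists N, forall t, 0 <= t <= 1 -> `|u t| <= N.
Proof.
move=> cu; have c01 := continuous_within01 cu.
have [a _ ha] := EVT_max (@ler01 R) c01.
have [b _ hb] := EVT_min (@ler01 R) c01.
exists (`|u a| + `|u b|) => t tI.
have tI' : t \in `[0, 1] by rewrite in_itv.
have h1 := ha t tI'; have h2 := hb t tI'.
have := ler_norm (u a); have := ler_norm (- u b); rewrite normrN.
by have := normr_ge0 (u a); have := normr_ge0 (u b); rewrite ler_norml => *; apply/andP; split; lra.
Qed.

(** Maps of the punctured disc multiply winding numbers by a constant: lift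
    [psi] in polar coordinates, and compare the values of the lift at points
    whose angles differ by a full turn. *)
Lemma winds_punctured (psi : plane -> plane) (r1 : R) (c1 c2 : R -> plane) :
  0 < r1 ->
  (forall z, 0 < rad z <= r1 -> {for z, continuous psi} /\ psi z <> (0, 0)) ->
  continuous c1 -> continuous c2 -> c1 0 = c1 1 -> c2 0 = c2 1 ->
  (forall t, 0 < rad (c1 t) <= r1) -> (forall t, 0 < rad (c2 t) <= r1) ->
  exists k, (forall w, winds c1 w -> winds (psi \o c1) (k * w)) /\
            (forall w, winds c2 w -> winds (psi \o c2) (k * w)).
Proof.
move=> r10 psiP cc1 cc2 l1 l2 r1P r2P.
have crc (c : R -> plane) : continuous c -> continuous (fun t => rad (c t)).
  by move=> cc t; exact: (cont_comp (cc t) (@cont_rad _)).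
have [r0 r00 r0P] : exists2 r0, 0 < r0 & forall t, 0 <= t <= 1 ->
    r0 <= rad (c1 t) /\ r0 <= rad (c2 t).
  have [a _ ha] := EVT_min (@ler01 R) (continuous_within01 (crc _ cc1)).
  have [b _ hb] := EVT_min (@ler01 R) (continuous_within01 (crc _ cc2)).
  exists (Num.min (rad (c1 a)) (rad (c2 b))).
    by rewrite lt_min; have /andP[-> _] := r1P a; have /andP[-> _] := r2P b.
  by move=> t tI; rewrite !ge_min ha ?in_itv// hb ?in_itv// orbT.
have r01 : r0 <= r1.
  have [|h _] := r0P 0; first by apply/andP; split; lra.
  by apply: le_trans h _; have /andP[] := r1P 0.
have nz c t : 0 < rad (c t) <= r1 -> c t <> (0, 0) :> plane.
  by move=> /andP[+ _] cE; rewrite cE /rad /= expr0n /= addr0 sqrtr0 ltxx.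
have [u1 wu1] : exists w, winds c1 w.
  by apply: winds_exists => // t; apply: nz; exact: r1P.
have [u2 wu2] : exists w, winds c2 w.
  by apply: winds_exists => // t; apply: nz; exact: r2P.
(* polar coordinates, with the radius clamped to an annulus around both loops *)
pose q s := Num.max r0 (Num.min r1 s).
have qP s : r0 <= q s <= r1 by rewrite /q le_max lexx /= ge_max r01 ge_min lexx.
have q_id s : r0 <= s <= r1 -> q s = s.
  by move=> /andP[h1 h2]; rewrite /q (min_idPr h2) (max_idPr h1).
pose P z : plane := (q z.1 * cos z.2, q z.1 * sin z.2).
have radP z : rad (P z) = q z.1.
  by apply: rad_polar; apply: le_trans (ltW r00) _; have /andP[] := qP z.1.
have Pann z : 0 < rad (P z) <= r1.
  by rewrite radP; have /andP[h1 ->] := qP z.1; rewrite (lt_le_trans r00).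
have cP : continuous P.
  apply: cont_for => z; have cq : {for z, continuous (fun z => q z.1)}.
    by rewrite /q; cont.
  have c2z : {for z, continuous (fun z : plane => z.2)} by cont.
  have ccz := cont_comp c2z (@continuous_cos R _).
  have csz := cont_comp c2z (@continuous_sin R _).
  by rewrite /P; cont.
pose F z := psi (P z).
have cF : continuous F.
  by move=> z; have [h _] := psiP _ (Pann z); exact: (cont_comp (cP z) h).
have F0 z : F z <> (0, 0) by have [_ h] := psiP _ (Pann z).
have [th1 [cth1 pth1 u1E]] := wu1; have [th2 [cth2 pth2 u2E]] := wu2.
have [N1 hN1] := continuous_bounded01 cth1.
have [N2 hN2] := continuous_bounded01 cth2.
have pi0 : 0 < pi :> R by exact: pi_gt0.
pose N := N1 + N2 + r1 + pi.
have t0 : 0 <= (0 : R) <= 1 by apply/andP; split; lra.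
have t1 : 0 <= (1 : R) <= 1 by apply/andP; split; lra.
have N10 : 0 <= N1 by apply: le_trans (hN1 0 t0).
have N20 : 0 <= N2 by apply: le_trans (hN2 0 t0).
have N0 : 0 < N by rewrite /N; lra.
have [L cL pL] := arg_lift cF F0 N0.
pose ok z := in_square N z && in_square N (z.1, z.2 + pi *+ 2).
have okI (z z' : plane) t : 0 <= t <= 1 -> ok z -> ok z' ->
    ok (z.1 + t * (z'.1 - z.1), z.2 + t * (z'.2 - z.2)).
  have cvx (a b M : R) : 0 <= t <= 1 -> `|a| <= M -> `|b| <= M -> `|a + t * (b - a)| <= M.
    by move=> /andP[? ?]; rewrite !ler_norml => /andP[? ?] /andP[? ?]; apply/andP; split; nra.
  rewrite /ok /in_square /= => tI /andP[/andP[h1 h2] /andP[_ h3]] /andP[/andP[h4 h5] /andP[_ h6]].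
  rewrite !cvx//= (_ : _ + _ + _ = (z.2 + pi *+ 2) + t * (z'.2 + pi *+ 2 - (z.2 + pi *+ 2))).
    exact: cvx.
  by ring.
(* the gain of the lift over one turn is a continuous multiple of a full turn *)
pose kap z := L (z.1, z.2 + pi *+ 2) - L z.
have kap_cst z z' : ok z -> ok z' -> kap z' = kap z.
  move=> oz oz'.
  pose m t : plane := (z.1 + t * (z'.1 - z.1), z.2 + t * (z'.2 - z.2)).
  have m0 : m 0 = z by rewrite /m !mul0r !addr0 -surjective_pairing.
  have m1 : m 1 = z' by rewrite /m !mul1r !subrKC -surjective_pairing.
  have := @cos1_const R (kap \o m); rewrite /= m0 m1; apply => [|t tI].
    apply: cont_for => t; have cm : {for t, continuous m} by rewrite /m; cont.
    have cm' : {for t, continuous (fun t => ((m t).1, (m t).2 + pi *+ 2))} by cont.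
    exact: (contB (cont_comp cm' (cL _)) (cont_comp cm (cL _))).
  have /andP[o1 o2] := okI z z' t tI oz oz'.
  rewrite /kap; apply: (@polar_cos1 _ (F (m t))); first exact: pL.
  have := pL _ o2; rewrite /F /P /= cosD2pi sinD2pi; exact.
pose k0 := kap (0, - N).
have kapE z : ok z -> kap z = k0.
  move=> oz; apply: kap_cst => //; rewrite /ok /in_square /= normr0 (ltW N0) normrN.
  rewrite gtr0_norm// lexx /= ler_norml -mulr_natr; apply/andP; split; rewrite /N; lra.
have turns r a (n : nat) : `|r| <= N -> `|a| <= N -> `|a + pi *+ 2 * n%:R| <= N ->
    L (r, a + pi *+ 2 * n%:R) - L (r, a) = n%:R * k0.
  move=> rN aN; elim: n => [_|n IH].
    by rewrite mulr0n mulr0 addr0 subrr mul0r.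
  rewrite -natr1 mulrDr mulr1 addrA => nN.
  have n0 : 0 <= pi *+ 2 * n%:R :> R by rewrite mulr_ge0// mulrn_wge0// ltW.
  have nN' : `|a + pi *+ 2 * n%:R| <= N.
    move: aN nN n0; set x := _ * n%:R; rewrite -[pi *+ 2]mulr_natr !ler_norml.
    by move=> /andP[? ?] /andP[? ?] ?; apply/andP; split; lra.
  have := kapE (r, a + pi *+ 2 * n%:R); rewrite /ok /in_square /= rN nN nN' /kap /=.
  by move=> /(_ isT) kE; rewrite [RHS]mulrDl mul1r -IH// -kE; ring.
have key (c : R -> plane) (th : R -> R) (u : R) : continuous c -> c 0 = c 1 -> continuous th ->
    (forall t, 0 <= t <= 1 -> polar (c t) (th t)) -> u = th 1 - th 0 ->
    (forall t, 0 <= t <= 1 -> `|th t| <= N) ->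
    (forall t, 0 <= t <= 1 -> r0 <= rad (c t) <= r1) ->
    winds (psi \o c) (k0 / (pi *+ 2) * u).
  move=> cc cl cth pth uE thN rc.
  have w : winds (psi \o c) (L (rad (c 1), th 1) - L (rad (c 0), th 0)).
    exists (fun t => L (rad (c t), th t)); split => //.
      move=> t; exact: (cont_comp (cont_pair (crc _ cc t) (cth t)) (cL _)).
    move=> t tI; have := pL (rad (c t), th t); rewrite /F /P /=.
    have rct := rc t tI; rewrite q_id//.
    have [r rp cE] := pth t tI; rewrite {2 3}cE rad_polar ?(ltW rp)// -cE; apply.
    rewrite /in_square /= thN// andbT; have /andP[h1 h2] := rct.
    rewrite ger0_norm ?(le_trans (ltW r00) h1)//; apply: le_trans h2 _; rewrite /N; lra.
  have [n nE] := winds_loop_int (ex_intro _ th (And3 cth pth uE)) cl.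
  have rN : `|rad (c 1)| <= N.
    have /andP[h1 h2] := rc 1 t1; rewrite ger0_norm ?(le_trans (ltW r00) h1)//.
    apply: le_trans h2 _; rewrite /N; lra.
  have pi20 : pi *+ 2 != 0 :> R by rewrite mulrn_eq0 /= gt_eqF.
  have [u0|u0] := leP 0 u.
    have tE : th 0 + pi *+ 2 * n%:R = th 1.
      by rewrite -nE ger0_norm// uE subrKC.
    rewrite (_ : _ * u = n%:R * k0); last by rewrite -(ger0_norm u0) nE mulrA divfK// mulrC.
    by rewrite -(turns (rad (c 1)) (th 0)) ?tE//; [rewrite -{2}cl|exact: thN|exact: thN].
  have tE : th 1 + pi *+ 2 * n%:R = th 0.
    by rewrite -nE ltr0_norm// uE opprB subrKC.
  rewrite (_ : _ * u = - (n%:R * k0)); last first.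
    by rewrite -[u]opprK -(ltr0_norm u0) nE mulrN mulrA divfK// mulrC.
  rewrite -(turns (rad (c 1)) (th 1)) ?tE//; [|exact: thN|exact: thN].
  by rewrite opprB -{2}cl.
exists (k0 / (pi *+ 2)); split => u /winds_uniq.
  move=> /(_ _ wu1) ->; apply: key cth1 pth1 u1E _ _ => // t tI.
    by apply: le_trans (hN1 t tI) _; rewrite /N; lra.
  by have [-> _] := r0P t tI; have /andP[_ ->] := r1P t.
move=> /(_ _ wu2) ->; apply: key cth2 pth2 u2E _ _ => // t tI.
  by apply: le_trans (hN2 t tI) _; rewrite /N; lra.
by have [_ ->] := r0P t tI; have /andP[_ ->] := r2P t.
Qed.

End PuncturedDisc.

(** * Boundary points of surfaces *)

Section Within.
Variables (S T U : topologicalType).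

Lemma within_open (A : set S) (f : S -> T) x :
  open A -> {within A, continuous f} -> A x -> {for x, continuous f}.
Proof.
by move=> oA; rewrite continuous_open_subspace// => cf Ax; apply: cf; rewrite inE.
Qed.

Lemma cont_comp_within (A : set T) (f : S -> T) (g : T -> U) x :
  {for x, continuous f} -> (\forall y \near x, A (f y)) ->
  {within A, continuous g} -> {for x, continuous (fun y => g (f y))}.
Proof.
move=> cf Af; rewrite subspace_continuousP => cg.
have Afx : A (f x) by exact: nbhs_singleton Af.
move=> P /(cg _ Afx); rewrite /= !nbhs_simpl => /cf /=.
by rewrite nbhs_simpl => h; apply: filterS2 Af h => y /[swap]; exact.
Qed.

Lemma within_near (A : set S) (f : S -> T) x (P : set T) :
  {within A, continuous f} -> A x -> nbhs (f x) P ->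
  \forall y \near x, A y -> P (f y).
Proof. by rewrite subspace_continuousP => cf Ax /(cf _ Ax). Qed.

End Within.

Section BoundaryInvariance.
Variable R : realType.
Local Notation plane := (R * R)%type.
Implicit Types (z b q : plane) (t : R).

Lemma nbhs_plane b (P : set plane) : nbhs b P <->
  exists2 d : R, 0 < d & forall z, `|z.1 - b.1| < d -> `|z.2 - b.2| < d -> P z.
Proof.
split.
  move=> /nbhs_ballP[d /= d0 dP]; exists d => // z h1 h2; apply: dP.
  by split; rewrite /ball /= distrC.
move=> [d d0 dP]; apply/nbhs_ballP; exists d => // z [h1 h2].
by apply: dP; rewrite distrC.
Qed.

(** Move the loop along segments to the point [(a, d)]. Only the end of a segment
    can meet the diameter, so [(a, 0)] is avoided. *)
Lemma loop_half_disc_null (phi : plane -> plane) (a d : R) (c : R -> plane) :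
  let D := [set z : plane | [/\ `|z.1 - a| <= d, 0 <= z.2 & z.2 <= d]] in
  0 < d -> {within D, continuous phi} ->
  (forall z, D z -> z <> (a, 0) -> phi z <> (0, 0)) ->
  continuous c -> (forall t, D (c t)) -> (forall t, c t <> (a, 0)) ->
  c 0 = c 1 -> winds (phi \o c) 0.
Proof.
move=> D d0 cphi phi0 cc cD ca c01.
pose k s : R := Num.max 0 (Num.min 1 s).
have kI s : 0 <= k s <= 1 by rewrite /k le_max lexx /= ge_max ler01 ge_min lexx.
have k0 : k 0 = 0 by rewrite /k (min_idPr (@ler01 R)) maxxx.
have k1 : k 1 = 1 by rewrite /k minxx (max_idPr (@ler01 R)).
pose m z : plane := (a + k z.1 * ((c z.2).1 - a), (1 - k z.1) * d + k z.1 * (c z.2).2).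
have mD z : D (m z).
  have [h1 h2 h3] := cD z.2; have /andP[s0 s1] := kI z.1; rewrite /D /m /=.
  have hk := mulr_ge0 s0 h2.
  have hd := ler_wpM2l s0 h3.
  split; [rewrite addrAC subrr add0r normrM ger0_norm//| | lra]; last first.
    by rewrite addr_ge0// mulr_ge0 ?subr_ge0// ltW.
  by apply: le_trans h1; rewrite ler_piMl.
have ma z : m z <> (a, 0).
  have [h1 h2 h3] := cD z.2; have /andP[s0 s1] := kI z.1; rewrite /m => -[e1 e2].
  apply: (ca z.2); have k_1 : k z.1 = 1.
    have := mulr_ge0 s0 h2; have : 0 <= (1 - k z.1) * d by rewrite mulr_ge0 ?subr_ge0// ltW.
    move=> p1 p2; have /eqP : (1 - k z.1) * d = 0 by lra.
    by rewrite mulf_eq0 (gt_eqF d0) orbF subr_eq0 => /eqP.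
  move: e1 e2; rewrite k_1 subrr mul0r add0r !mul1r subrKC => e1 e2.
  by rewrite [c _]surjective_pairing e1 e2.
have cm : continuous m.
  apply: cont_for => z; have c2 : {for z, continuous (fun z : plane => z.2)} by cont.
  have cc2 : {for z, continuous (fun z : plane => c z.2)} by exact: (cont_comp c2 (cc _)).
  by rewrite /m /k; cont.
apply: (@winds_null _ (phi \o m)).
- move=> z; have nD : \forall y \near z, D (m y) by apply/nbhs_plane; exists 1 => // *; exact: mD.
  exact: (cont_comp_within (cm z) nD cphi).
- by move=> z; apply: phi0.
- by move=> s; rewrite /m /= c01.
- by move=> t; rewrite /m /= k0 !mul0r.
- by move=> t; rewrite /m /= k1 !mul1r subrr mul0r add0r subrKC -surjective_pairing.
Qed.

(** A small circle around an interior point winds around it, while all loops in a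
    half disc without a given point of the diameter contract. *)
Lemma boundary_not_interior (M : topologicalType) (p : M) (U1 U2 : set M)
    (V1 V2 : set plane) (f2 : M -> plane) (g2 : plane -> M) :
  open_nbhs p U1 -> open V1 -> homeomorphic_sets U1 V1 ->
  open_nbhs p U2 -> open V2 ->
  {within U2, continuous f2} -> {within V2 `&` half_plane R, continuous g2} ->
  (forall x, U2 x -> (V2 `&` half_plane R) (f2 x) /\ g2 (f2 x) = x) ->
  (forall y, (V2 `&` half_plane R) y -> U2 (g2 y) /\ f2 (g2 y) = y) ->
  (f2 p).2 <> 0.
Proof.
move=> [oU1 U1p] oV1 [f1 [g1 [cf1 cg1 fg1 gf1]]] [oU2 U2p] oV2 cf2 cg2 fg2 gf2 b0.
set b := f2 p in b0; set q := f1 p.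
have [[V2b Hb] g2b] := fg2 p U2p; have [V1q g1q] := fg1 p U1p.
have [d d0 dP] : exists2 d : R, 0 < d & forall z, `|z.1 - b.1| < d -> `|z.2 - b.2| < d ->
    V2 z /\ (half_plane R z -> U1 (g2 z)).
  apply/nbhs_plane; have nV2 : nbhs b V2 by exact: open_nbhs_nbhs.
  have nU1 : nbhs (g2 b) U1 by rewrite g2b; exact: open_nbhs_nbhs.
  have := within_near cg2 (conj V2b Hb) nU1.
  apply: filterS2 nV2 => z V2z h; split => // Hz; exact: h.
have cg1q : {for q, continuous g1} by exact: within_open cg1 _.
have cf2p : {for p, continuous f2} by exact: within_open cf2 _.
pose P z := [/\ V1 z, U2 (g1 z), `|(f2 (g1 z)).1 - b.1| < d / 2 &
  `|(f2 (g1 z)).2 - b.2| < d / 2].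
have d20 : 0 < d / 2 by rewrite divr_gt0.
have [r r0 rP] : exists2 r : R, 0 < r & forall z, `|z.1 - q.1| < r ->
    `|z.2 - q.2| < r -> P z.
  apply/nbhs_plane; have nV1 : nbhs q V1 by exact: open_nbhs_nbhs.
  have nU2 : nbhs (g1 q) U2 by rewrite g1q; exact: open_nbhs_nbhs.
  have nb : nbhs (f2 (g1 q)) [set z | `|z.1 - b.1| < d / 2 /\ `|z.2 - b.2| < d / 2].
    by rewrite g1q; apply/nbhs_plane; exists (d / 2).
  have cfg : {for q, continuous (fun z => f2 (g1 z))}.
    by apply: (cont_comp cg1q); rewrite g1q.
  have n2 : nbhs q (fun z => U2 (g1 z)) by exact: cg1q nU2.
  have n3 : nbhs q (fun z => `|(f2 (g1 z)).1 - b.1| < d / 2 /\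
    `|(f2 (g1 z)).2 - b.2| < d / 2) by exact: cfg nb.
  by apply: filterS3 nV1 n2 n3 => z h1 h2 [h3 h4].
pose k t : plane := (q.1 + (circle (r / 2) t).1, q.2 + (circle (r / 2) t).2).
have r20 : 0 < r / 2 by rewrite divr_gt0.
have kP t : P (k t).
  have bd (x : R) : `|x| <= 1 -> `|r / 2 * x| < r.
    move=> x1; rewrite normrM (gtr0_norm r20).
    apply: (@le_lt_trans _ _ (r / 2)); last lra.
    by rewrite -[leRHS]mulr1 ler_pM2l.
  by apply: rP; rewrite /k /= addrAC subrr add0r; apply: bd; rewrite ?cos_max ?sin_max.
have ck : continuous k.
  apply: cont_for => t; have cct : {for t, continuous (circle (r / 2))} by exact: cont_circle.
  by rewrite /k; cont.
pose c t := f2 (g1 (k t)).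
have cc : continuous c.
  move=> t; have [h1 h2 _ _] := kP t.
  have cgk := cont_comp (ck t) (within_open oV1 cg1 h1).
  exact: (cont_comp cgk (within_open oU2 cf2 h2)).
pose phi z : plane := ((f1 (g2 z)).1 - q.1, (f1 (g2 z)).2 - q.2).
pose D := [set z : plane | [/\ `|z.1 - b.1| <= d / 2, 0 <= z.2 & z.2 <= d / 2]].
have DV z : D z -> [/\ V2 z, half_plane R z & U1 (g2 z)].
  move=> [h1 h2 h3]; have [||V2z U1z] := dP z.
  - by apply: le_lt_trans h1 _; lra.
  - by rewrite b0 subr0 ger0_norm//; apply: le_lt_trans h3 _; lra.
  by split => //; exact: U1z.
have wnd : winds (phi \o c) 0.
  apply: (@loop_half_disc_null phi b.1 (d / 2)) => //.
  - rewrite subspace_continuousP => z Dz; have [V2z Hz U1z] := DV z Dz.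
    have cg : {within D, continuous g2}.
      by apply: continuous_subspaceW cg2 => y /DV[].
    have cfz : {for (g2 z), continuous f1} by exact: within_open cf1 _.
    have cgz : g2 @ within D (nbhs z) --> g2 z.
      by move: cg; rewrite subspace_continuousP; apply.
    have cfg : (f1 \o g2) @ within D (nbhs z) --> f1 (g2 z).
      exact: (cvg_comp _ _ cgz cfz).
    have cT : {for (f1 (g2 z)), continuous (fun w : plane => (w.1 - q.1, w.2 - q.2))}.
      by cont.
    exact: (cvg_comp _ _ cfg cT).
  - move=> z Dz zb [/eqP e1 /eqP e2]; apply: zb; have [V2z Hz U1z] := DV z Dz.
    have e : f1 (g2 z) = q.
      rewrite [LHS]surjective_pairing [RHS]surjective_pairing.
      by move: e1 e2; rewrite !subr_eq0 => /eqP-> /eqP->.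
    have [_ h] := fg1 _ U1z; have [_ <-] := gf2 z (conj V2z Hz).
    by rewrite -h e g1q [LHS]surjective_pairing -/b b0.
  - move=> t; have [h1 h2 h3 h4] := kP t; have [[_ H] _] := fg2 _ h2.
    split; [exact: ltW|exact: H|].
    by move: h4; rewrite b0 subr0 => /ltW; apply: le_trans; exact: ler_norm.
  - move=> t cb; have [h1 h2 _ _] := kP t; have [_ h] := fg2 _ h2.
    have kq : k t = q.
      have [_ <-] := gf1 _ h1; rewrite -h -/(c t) cb.
      by rewrite -b0 -surjective_pairing g2b.
    have c1 : (circle (r / 2) t).1 = 0.
      apply: (addrI q.1); rewrite addr0; exact: (congr1 fst kq).
    have c2 : (circle (r / 2) t).2 = 0.
      apply: (addrI q.2); rewrite addr0; exact: (congr1 snd kq).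
    have := rad_polar (pi *+ 2 * t) (ltW r20); rewrite -/(circle (r / 2) t).
    by rewrite /rad c1 c2 expr0n /= addr0 sqrtr0 => e; rewrite -e ltxx in r20.
  - by rewrite /c /k circle01.
have cE : phi \o c = circle (r / 2).
  apply/funext => t /=; have [h1 h2 _ _] := kP t; rewrite /phi /c.
  have [_ ->] := fg2 _ h2; have [_ ->] := gf1 _ h1.
  by rewrite /k /circle /= !(addrAC _ _ (- _)) !subrr !add0r.
move: wnd; rewrite cE => /(winds_uniq (winds_circle r20)) /eqP.
by rewrite mulrn_eq0 /= gt_eqF// pi_gt0.
Qed.

End BoundaryInvariance.

(** * Coordinates on a triangulated surface *)

Section Tri.
Variables (R : realType) (J : Type).
Local Notation E := (J -> R).
Local Notation plane := (R * R)%type.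
Implicit Types (p q r x y : E) (z : plane).

Definition tri p q r z : E := (1 - z.1 - z.2) *: p + z.1 *: q + z.2 *: r.

Lemma funE (x y : E) : (forall j, x j = y j) -> x = y.
Proof. by move=> h; apply/funext. Qed.

Lemma addE x y j : (x + y) j = x j + y j. Proof. by []. Qed.
Lemma oppE x j : (- x) j = - x j. Proof. by []. Qed.
Lemma scaleE (a : R) x j : (a *: x) j = a * x j. Proof. by []. Qed.
Lemma zeroE j : (0 : E) j = 0. Proof. by []. Qed.

Definition vecE := (addE, oppE, scaleE, zeroE).

Definition Delta : set plane := [set z | [/\ 0 <= z.1, 0 <= z.2 & z.1 + z.2 <= 1]].

Lemma closed_Delta : closed Delta.
Proof.
have -> : Delta = (fst @^-1` [set s | 0 <= s] `&` snd @^-1` [set s | 0 <= s]) `&`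
   (fun z : plane => z.1 + z.2) @^-1` [set s | s <= 1].
  by rewrite predeqE => z; split => [[h1 h2 h3]|[[h1 h2] h3]].
apply: closedI; first apply: closedI.
- by apply: closed_comp; [move=> z _; exact: cvg_fst|exact: closed_ge].
- by apply: closed_comp; [move=> z _; exact: cvg_snd|exact: closed_ge].
- apply: closed_comp; [move=> z _|exact: closed_le].
  by have : {for z, continuous (fun z : plane => z.1 + z.2)} by cont.
Qed.

Lemma compact_Delta : compact Delta.
Proof.
apply: (@subclosed_compact _ _ [set z | in_square 1 z]); first exact: closed_Delta.
  exact: compact_square.
by move=> z [h1 h2 h3]; rewrite /= /in_square !ger0_norm//; apply/andP; split; lra.
Qed.

Lemma tri_cont p q r : continuous (tri p q r : plane -> {ptws J -> R}).
Proof.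
move=> z; apply/cvg_sup => j.
suff : continuous (tri p q r : plane -> initial_topology (@proj J (fun=> R) j)) by exact.
apply: continuous_comp_initial; apply: cont_for => {}z.
have : {for z, continuous (fun z : plane =>
  (1 - z.1 - z.2) * p j + z.1 * q j + z.2 * r j)} by cont.
exact.
Qed.

Lemma cont_proj (j : J) : continuous (fun f : {ptws J -> R} => f j).
Proof.
move=> f; have /cvg_sup/(_ j) h : nbhs f --> (f : {ptws J -> R}) by exact: cvg_id.
exact: (cvg_comp _ _ h (@initial_continuous _ _ (@proj J (fun=> R) j) f)).
Qed.

Lemma hausdorff_ptws : hausdorff_space {ptws J -> R}.
Proof.
move=> f g fg; apply: funE => j; apply: (@Rhausdorff R) => A B nA nB.
have [h [hA hB]] := fg _ _ (@cont_proj j f A nA) (@cont_proj j g B nB).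
by exists (h j).
Qed.

(** The triangle is compact, so [tri p q r] is closed on it, also when vertices
    are repeated. *)
Lemma closed_tri p q r (C : set plane) : closed C -> C `<=` Delta ->
  closed (tri p q r @` C : set {ptws J -> R}).
Proof.
move=> cC CD; apply: compact_closed.
  exact: hausdorff_ptws.
apply: continuous_compact; last exact: subclosed_compact cC compact_Delta CD.
by apply: continuous_subspaceT; exact: tri_cont.
Qed.

(** Barycentric weights of [tri p q r z]; repeated vertices add their weights. *)
Definition triW p q r z x : R :=
  (1 - z.1 - z.2) * (x == p)%:R + z.1 * (x == q)%:R + z.2 * (x == r)%:R.

Lemma sum_delta (V : lmodType R) (s : seq E) (F : E -> V) p : uniq s -> p \in s ->
  \sum_(x <- s) (x == p)%:R *: F x = F p.
Proof.
move=> us ps; rewrite (bigD1_seq p)//= eqxx scale1r big1 ?addr0// => x xp.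
by rewrite (negbTE xp) scale0r.
Qed.

Lemma sum_triW (V : lmodType R) (s : seq E) (F : E -> V) p q r z :
  uniq s -> p \in s -> q \in s -> r \in s ->
  \sum_(x <- s) triW p q r z x *: F x =
  (1 - z.1 - z.2) *: F p + z.1 *: F q + z.2 *: F r.
Proof.
move=> us ps qs rs; rewrite -(sum_delta F us ps) -(sum_delta F us qs) -(sum_delta F us rs).
rewrite !scaler_sumr -!big_split; apply: eq_bigr => x _.
by rewrite /= !scalerA -!scalerDl.
Qed.

End Tri.

Definition in_fsetE := (in_fsetU, in_fset1).

Section Complex.
Variables (R : realType) (J : Type).
Local Notation E := (J -> R).
Local Notation plane := (R * R)%type.
Implicit Types (p q r x y : E) (z : plane).

Variable K : set {fset E}.
Hypothesis cK : simplicial_complex K.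
Hypothesis dimK : forall s, K s -> (#|` s| <= 3)%N.

Definition weights y (s : {fset E}) (l : E -> R) : Prop :=
  [/\ forall p, 0 <= l p, forall p, p \notin s -> l p = 0,
      \sum_(p <- s) l p = 1 & y = \sum_(p <- s) l p *: p].

Lemma hull_weights y s : simplex_hull s y -> exists l, weights y s l.
Proof.
move=> [l [l0 l1 yE]]; exists (fun p => if p \in s then l p else 0); split.
- by move=> p; case: ifP.
- by move=> p /negbTE ->.
- by rewrite -l1; apply: eq_big_seq => p ->.
- by rewrite yE; apply: eq_big_seq => p ->.
Qed.

Lemma weights_hull y s l : weights y s l -> simplex_hull s y.
Proof. by move=> [l0 _ l1 yE]; exists l. Qed.

Lemma weights_incl y s t l : (s `<=` t)%fset -> weights y s l -> weights y t l.
Proof.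
move=> st [l0 ls l1 yE]; split => //.
- by move=> p pt; apply: ls; apply: contra pt; apply/fsubsetP.
- by rewrite -l1; apply/esym/big_fset_incl => // p _ ps; rewrite ls.
- by rewrite yE; apply: big_fset_incl => // p _ ps; rewrite ls// scale0r.
Qed.

Lemma weights_indep y s l m : affinely_independent s ->
  weights y s l -> weights y s m -> l = m.
Proof.
move=> ai [l0 ls l1 yl] [m0 ms m1 ym]; apply/funext => p.
have [ps|ps] := boolP (p \in s); last by rewrite ls ?ms.
apply/eqP; rewrite -subr_eq0; apply/eqP; apply: (ai (fun p => l p - m p)) => //.
  by rewrite sumrB l1 m1 subrr.
by under eq_bigr do rewrite scalerBl; rewrite sumrB -yl -ym subrr.
Qed.

Lemma weights_uniq y s t l m : K s -> K t ->
  weights y s l -> weights y t m -> l = m.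
Proof.
case: cK => ai _ meet Ks Kt wl wm.
have /hull_weights[n wn] : simplex_hull (s `&` t)%fset y.
  by apply: meet => //; split; [exact: weights_hull wl|exact: weights_hull wm].
rewrite (weights_indep (ai s Ks).2 wl (weights_incl (fsubsetIl _ _) wn)).
by rewrite (weights_indep (ai t Kt).2 wm (weights_incl (fsubsetIr _ _) wn)).
Qed.

(** Barycentric coordinates on the whole polyhedron; they do not depend on the
    simplex because simplices meet along common faces. *)
Definition bc y : E -> R :=
  xget (fun=> 0) [set l | exists2 s, K s & weights y s l].

Lemma bcE y s l : K s -> weights y s l -> bc y = l.
Proof.
move=> Ks w; rewrite /bc; case: xgetP => [l' _ [t Kt w']|/(_ l)]; last first.
  by case; exists s.
exact: weights_uniq w' w.
Qed.

Lemma bc_weights y s : K s -> simplex_hull s y -> weights y s (bc y).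
Proof. by move=> Ks /hull_weights[l w]; rewrite (bcE Ks w). Qed.

Lemma bc_notin y s p : K s -> simplex_hull s y -> p \notin s -> bc y p = 0.
Proof. by move=> Ks h; have [_ + _ _] := bc_weights Ks h; apply. Qed.

Lemma bc_gt0_in y s p : K s -> simplex_hull s y -> 0 < bc y p -> p \in s.
Proof. by move=> Ks h; apply: contraTT => /(bc_notin Ks h) ->; rewrite ltxx. Qed.

Lemma tri_weights p q r z : Delta z ->
  weights (tri p q r z) [fset p; q; r]%fset (triW p q r z).
Proof.
move=> [z1 z2 z12]; set s := [fset p; q; r]%fset.
have ps : p \in s by rewrite !in_fsetE eqxx.
have qs : q \in s by rewrite !in_fsetE eqxx orbT.
have rs : r \in s by rewrite !in_fsetE eqxx orbT.
have us : uniq s by exact: fset_uniq.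
split.
- by move=> x; rewrite /triW !addr_ge0// mulr_ge0 ?ler0n//; lra.
- move=> x xs; have xE a : a \in s -> (x == a) = false.
    by move=> ain; apply/negbTE; apply: contra xs => /eqP ->.
  by rewrite /triW !xE// !mulr0 !addr0.
- transitivity (\sum_(x <- s) triW p q r z x *: (1 : R^o)).
    by apply: eq_bigr => x _; rewrite /GRing.scale /= mulr1.
  by rewrite sum_triW// /GRing.scale /= !mulr1; ring.
- by rewrite sum_triW.
Qed.

Lemma bc_tri p q r z : K [fset p; q; r]%fset -> Delta z ->
  bc (tri p q r z) = triW p q r z.
Proof. by move=> Ks Dz; exact: bcE Ks (tri_weights _ _ _ Dz). Qed.

Lemma tri_hull p q r z : Delta z -> simplex_hull [fset p; q; r]%fset (tri p q r z).
Proof. by move=> Dz; exact: weights_hull (tri_weights _ _ _ Dz). Qed.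

(** Repeated vertices let [tri p q r] parametrize simplices of all dimensions. *)
Lemma simplex_cases s : K s -> [\/ exists p, s = [fset p; p; p]%fset,
  exists p q, p != q /\ s = [fset p; q; q]%fset |
  exists p q r, [/\ p != q, p != r, q != r & s = [fset p; q; r]%fset]].
Proof.
move=> Ks; have s0 : s != fset0 by have [/(_ _ Ks)[]] := cK.
have sz : (size (enum_fset s) <= 3)%N := dimK Ks.
have us : uniq (enum_fset s) by exact: fset_uniq.
have sE x : (x \in s) = (x \in enum_fset s) by [].
move: (enum_fset s) sz us sE => [|p [|q [|r []]]]// _ us sE.
- by case/eqP: s0; apply/fsetP => x; rewrite sE in_fset0.
- by constructor 1; exists p; apply/fsetP => x; rewrite sE !in_fsetE !orbb mem_seq1.
- constructor 2; exists p, q; split; first by move: us => /= /andP[]; rewrite mem_seq1.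
  by apply/fsetP => x; rewrite sE !in_fsetE -orbA orbb mem_seq2.
- have /= /and3P[n1 n2 _] := us; constructor 3; exists p, q, r; split.
  + by apply: contra n1 => /eqP ->; rewrite mem_head.
  + by apply: contra n1 => /eqP ->; rewrite in_cons mem_head orbT.
  + by apply: contra n2 => /eqP ->; rewrite mem_head.
  + by apply/fsetP => x; rewrite sE !in_fsetE -orbA mem_seq3.
Qed.

Lemma simplexE s : K s -> exists p q r, s = [fset p; q; r]%fset.
Proof.
by case/simplex_cases => [[p ->]|[p [q [_ ->]]]|[p [q [r [_ _ _ ->]]]]];
  [exists p, p, p|exists p, q, q|exists p, q, r].
Qed.

Lemma sum_fset3 (V : zmodType) (F : E -> V) p q r :
  \sum_(x <- [fset p; q; r]%fset) F x =
  F p + (if q == p then 0 else F q) + (if (r == p) || (r == q) then 0 else F r).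
Proof.
have fsetE a (s : {fset E}) : \sum_(x <- (a |` s)%fset) F x =
    (if a \in s then 0 else F a) + \sum_(x <- s) F x.
  case: ifPn => [as_|as_]; last by rewrite big_fsetU1.
  by rewrite add0r; congr bigop; congr enum_fset; apply/fsetUidPr; rewrite fsub1set.
have -> : [fset p; q; r]%fset = (r |` (q |` [fset p]))%fset.
  by apply/fsetP => x; rewrite !in_fsetE orbC (orbC (x == p)).
rewrite !fsetE big_seq_fset1 !in_fsetE (orbC (r == q)).
by rewrite addrC (addrC _ (F p)).
Qed.

Lemma hull_tri p q r :
  simplex_hull [fset p; q; r]%fset = @tri R J p q r @` @Delta R.
Proof.
apply/seteqP; split; last by move=> _ [z Dz <-]; exact: tri_hull.
move=> y [l [l0 l1 ->]]; move: l1; rewrite !sum_fset3 => l1.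
set a := if q == p then 0 else l q in l1; set b := if _ || _ then 0 else l r in l1.
have a0 : 0 <= a by rewrite /a; case: ifP.
have b0 : 0 <= b by rewrite /b; case: ifP.
exists (a, b); first by split => //=; have := l0 p; lra.
rewrite /tri /= (_ : 1 - a - b = l p); last by rewrite -l1; ring.
by rewrite /a /b; do 2?case: ifP; rewrite ?scale0r.
Qed.

End Complex.

(** * Triangulations and charts *)

(** A triangulation, with an inverse of the homeomorphism onto the polyhedron. *)
Record model (R : realType) (J : Type) (M : topologicalType)
    (K : set {fset (J -> R)}) (phi : M -> (J -> R)) (psi : (J -> R) -> M) : Prop := {
  model_complex : simplicial_complex K;
  model_dim : forall s, K s -> (#|` s| <= 3)%N;
  model_poly : forall m, polyhedron K (phi m);
  model_phiK : forall m, psi (phi m) = m;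
  model_psiK : forall y, polyhedron K y -> phi (psi y) = y;
  model_weak : forall C : set M, closed C <->
    forall s, K s -> closed ((phi @` C `&` simplex_hull s) : set {ptws J -> R}) }.

Section Chart.
Variables (R : realType) (M : topologicalType).
Local Notation plane := (R * R)%type.
Implicit Types (z : plane) (m : M).

(** Homeomorphic charts, with an inverse that is defined everywhere. *)
Record chart (O : set plane) (f : M -> plane) (g : plane -> M) : Prop := {
  chart_cont : continuous f;
  chart_inv_cont : {within O, continuous g};
  chartK : forall z, O z -> f (g z) = z;
  chart_open : open (g @` O) }.

Lemma chart_homeo O f g : chart O f g -> homeomorphic_sets (g @` O) O.
Proof.
move=> [cf cg fgK _]; exists f, g; split => //.
- exact: continuous_subspaceT.
- by move=> _ [z Oz <-]; rewrite fgK.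
- by move=> z Oz; split; [exists z|exact: fgK].
Qed.

Lemma chart_interior O f g z : chart O f g -> open O -> O z ->
  surface_interior R M (g z).
Proof.
move=> ch oO Oz; exists (g @` O), O; split => //; last exact: chart_homeo ch.
by split; [exact: chart_open ch|exists z].
Qed.

Lemma half_chart_boundary O f g z : open O -> chart (O `&` half_plane R) f g ->
  O z -> z.2 = 0 -> surface_boundary R M (g z).
Proof.
move=> oO ch Oz z0 [U1 [V1 [pU1 oV1 h1]]].
have Hz : (O `&` half_plane R) z by split => //; rewrite /half_plane /= z0.
apply: (boundary_not_interior (g2 := g) (f2 := f) pU1 oV1 h1 _ oO).
- by split; [exact: chart_open ch|exists z].
- exact/continuous_subspaceT/(chart_cont ch).
- exact: chart_inv_cont ch.
- by move=> _ [y Oy <-]; rewrite (chartK ch).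
- by move=> y Oy; split; [exists y|rewrite (chartK ch)].
- by rewrite (chartK ch).
Qed.

End Chart.

Section Model.
Variables (R : realType) (J : Type) (M : topologicalType).
Local Notation E := (J -> R).
Local Notation plane := (R * R)%type.
Implicit Types (p q r x y : E) (z : plane) (m : M).

Variables (K : set {fset E}) (phi : M -> E) (psi : E -> M).
Hypothesis md : model K phi psi.
Let cK := model_complex md.
Let dimK := model_dim md.
Let phiP := model_poly md.
Let phiK := model_phiK md.
Let psiK := model_psiK md.
Let weakK := model_weak md.

Local Notation bc := (bc K).

Definition mtri p q r z : M := psi (tri p q r z).
Definition bary x m : R := bc (phi m) x.

Lemma tri_poly p q r z : K [fset p; q; r]%fset -> Delta z ->
  polyhedron K (tri p q r z).
Proof. by move=> Ks Dz; exists [fset p; q; r]%fset => //; exact: tri_hull. Qed.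

Lemma phi_mtri p q r z : K [fset p; q; r]%fset -> Delta z ->
  phi (mtri p q r z) = tri p q r z.
Proof. by move=> Ks Dz; apply: psiK; exact: tri_poly. Qed.

Lemma bary_mtri p q r z x : K [fset p; q; r]%fset -> Delta z ->
  bary x (mtri p q r z) = triW p q r z x.
Proof. by move=> Ks Dz; rewrite /bary phi_mtri// bc_tri. Qed.

(** The weak topology, tested in the coordinates of the simplices. *)
Lemma closed_criterion (C : set M) :
  (forall p q r, K [fset p; q; r]%fset ->
     closed [set z | Delta z /\ C (mtri p q r z)]) -> closed C.
Proof.
move=> h; apply/weakK => s Ks; have [p [q [r sE]]] := simplexE cK dimK Ks.
rewrite sE in Ks *; have cl : closed (tri p q r @` [set z | Delta z /\
    C (mtri p q r z)] : set {ptws J -> R}).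
  by apply: closed_tri; [exact: h|move=> z []].
move: cl; congr (@closed _ _); apply/seteqP; split.
  move=> _ [z [Dz Cz] <-]; split; last exact: tri_hull.
  by exists (mtri p q r z) => //; rewrite phi_mtri.
move=> _ [[m Cm <-] hm]; move: (hm); rewrite hull_tri => -[z Dz zE].
by exists z => //; split => //; rewrite /mtri zE phiK.
Qed.

Lemma cont_bary x : continuous (bary x).
Proof.
apply/continuous_closedP => Z cZ.
apply: closed_criterion => p q r Ks.
have -> : [set z | Delta z /\ (bary x @^-1` Z) (mtri p q r z)] =
    @Delta R `&` (triW p q r ^~ x) @^-1` Z.
  by apply/seteqP; split => z [Dz]; rewrite /= bary_mtri.
apply: closedI; first exact: closed_Delta.
apply: closed_comp => // z _.
by have : {for z, continuous (triW p q r ^~ x)} by rewrite /triW; cont.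
Qed.

Lemma cont_mtri p q r : K [fset p; q; r]%fset ->
  {within @Delta R, continuous (mtri p q r)}.
Proof.
move=> Ks; apply/continuous_closedP => C cC; apply/closed_subspaceP.
exists (tri p q r @^-1` (phi @` C `&` simplex_hull [fset p; q; r]%fset)).
  apply: (@closed_comp _ {ptws J -> R}); first by move=> z _; exact: tri_cont.
  by move/weakK : cC; exact.
apply/seteqP; split => z /= [].
  move=> [[m Cm mE] _] Dz; split => //; change (C (psi (tri p q r z))).
  by rewrite -mE phiK.
move=> /= Cz Dz; split => //; split; last exact: tri_hull.
by exists (mtri p q r z) => //; rewrite phi_mtri.
Qed.

End Model.

(** * Surfaces have no local cut points *)

Section LocalConnectivity.
Variables (R : realType) (M : topologicalType).
Local Notation plane := (R * R)%type.

Lemma within_comp (S T U : topologicalType) (A : set S) (B : set T)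
    (f : S -> T) (g : T -> U) :
  continuous f -> (forall x, A x -> B (f x)) -> {within B, continuous g} ->
  {within A, continuous (fun x => g (f x))}.
Proof.
move=> cf AB cg; rewrite subspace_continuousP => x Ax.
rewrite subspace_continuousP in cg.
apply: (cvg_comp f g _ (cg _ (AB _ Ax))) => P; rewrite /= !nbhs_simpl /= => nP.
have h := cf x _ nP; rewrite nbhs_simpl /= in h *.
by apply: filterS h => y h Ay; apply: h; exact: AB.
Qed.

Lemma lt_seg (a b c t : R) : 0 <= t <= 1 -> a < b -> a < c -> a < b + t * (c - b).
Proof.
move=> /andP[t0 t1] ab ac; have [bc|cb] := leP b c.
  by have := mulr_ge0 t0 (_ : 0 <= c - b); rewrite subr_ge0 => /(_ bc); lra.
by have := mulr_ge0 (_ : 0 <= 1 - t) (_ : 0 <= b - c);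
  rewrite !subr_ge0 => /(_ t1 (ltW cb)); lra.
Qed.

Lemma gt_seg (a b c t : R) : 0 <= t <= 1 -> b < a -> c < a -> b + t * (c - b) < a.
Proof.
move=> tI ba ca; have := @lt_seg (- a) (- b) (- c) t tI; rewrite !ltrN2 => /(_ ba ca); lra.
Qed.

Definition segpt (z w : plane) (t : R) : plane :=
  (z.1 + t * (w.1 - z.1), z.2 + t * (w.2 - z.2)).

Lemma convex_connected (A : set plane) :
  (forall z w t, A z -> A w -> 0 <= t <= 1 -> A (segpt z w t)) -> connected A.
Proof.
move=> cA; have [->|/set0P[z Az]] := eqVneq A set0; first exact: connected0.
have -> : A = \bigcup_(w in A) (segpt z w @` `[0, 1]).
  apply/seteqP; split => [w Aw|_ [w Aw [t /= tI <-]]].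
    exists w => //; exists 1; first by rewrite /= in_itv /= ler01 lexx.
    by rewrite /segpt !mul1r !subrKC -surjective_pairing.
  by apply: cA => //; move: tI; rewrite in_itv.
apply: bigcup_connected.
  exists z => w _; exists 0; first by rewrite /= in_itv /= ler01 lexx.
  by rewrite /segpt !mul0r !addr0 -surjective_pairing.
move=> w _; apply: connected_continuous_connected; first exact: segment_connected.
apply: continuous_subspaceT; apply: cont_for => t; rewrite /segpt.
by have : {for t, continuous (fun t : R =>
  (z.1 + t * (w.1 - z.1), z.2 + t * (w.2 - z.2)))} by cont.
Qed.

Definition half_square (q : plane) (d : R) : set plane :=
  [set z | [/\ `|z.1 - q.1| < d, `|z.2 - q.2| < d & 0 <= z.2]].

(** The parts to the left, to the right, above and below [q] are convex, and the
    first meets the last two; the part below is empty when [q] is on the boundary line. *)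
Lemma connected_punctured_half_square (q : plane) (d : R) : 0 < d -> 0 <= q.2 ->
  connected (half_square q d `\ q).
Proof.
move=> d0 q0; pose A P := half_square q d `&` P.
have cvx (P : set plane) : (forall z w t, P z -> P w -> 0 <= t <= 1 -> P (segpt z w t)) ->
    connected (A P).
  move=> cP; apply: convex_connected => z w t [[h1 h2 h3] Pz] [[h4 h5 h6] Pw] tI.
  split; last exact: cP.
  have /andP[t0 t1] := tI; rewrite /segpt; move: h1 h2 h4 h5.
  rewrite !ltr_norml => /andP[? ?] /andP[? ?] /andP[? ?] /andP[? ?].
  have hb := @lt_seg _ _ _ t tI; have ht := @gt_seg _ _ _ t tI.
  split => /=; last by nra.
    by rewrite ltr_norml; apply/andP; split; [have := hb (q.1 - d) z.1 w.1|have := ht (q.1 + d) z.1 w.1]; lra.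
  by rewrite ltr_norml; apply/andP; split; [have := hb (q.2 - d) z.2 w.2|have := ht (q.2 + d) z.2 w.2]; lra.
pose L := A [set z | z.1 < q.1]; pose Rt := A [set z | z.1 > q.1].
pose T := A [set z | z.2 > q.2]; pose B := A [set z | z.2 < q.2].
have cL : connected L by apply: cvx => z w t /= ? ? ?; exact: gt_seg.
have cR : connected Rt by apply: cvx => z w t /= ? ? ?; exact: lt_seg.
have cT : connected T by apply: cvx => z w t /= ? ? ?; exact: lt_seg.
have cB : connected B by apply: cvx => z w t /= ? ? ?; exact: gt_seg.
have hn (x : R) : - d < x -> x < d -> `|x| < d by rewrite ltr_norml => -> ->.
have cLT : connected (L `|` T).
  apply: connectedU => //; exists (q.1 - d / 2, q.2 + d / 2).
  by split; split => /=; [split => /=; [apply: hn; lra|apply: hn; lra|lra]|lra|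
    split => /=; [apply: hn; lra|apply: hn; lra|lra]|lra].
have cLTR : connected ((L `|` T) `|` Rt).
  apply: connectedU => //; exists (q.1 + d / 2, q.2 + d / 2).
  by split; [right|]; split => /=; [split => /=; [apply: hn; lra|apply: hn; lra|lra]|lra|
    split => /=; [apply: hn; lra|apply: hn; lra|lra]|lra].
have -> : half_square q d `\ q = (L `|` T `|` Rt) `|` B.
  apply/seteqP; split => z.
    move=> [hz zq]; have [h|h|h1] := ltgtP z.1 q.1.
    - by left; left; left.
    - by left; right.
    have [h|h|h2] := ltgtP z.2 q.2; [by right|by left; left; right|].
    by case: zq; rewrite [z]surjective_pairing h1 h2 -surjective_pairing.
  by move=> [[[]|]|] [hz /= h]; split => // e; rewrite e ltxx in h.
have [->|/set0P[w Bw]] := eqVneq B set0; first by rewrite setU0.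
apply: connectedU => //; exists (q.1 - d / 2, w.2); have [[h1 h2 h3] h4] := Bw.
by split; [left; left|]; split => //=; try split => //=; try (apply: hn); lra.
Qed.

(** In a chart on the half plane, small squares around the point stay connected
    when the point is removed. *)
Lemma no_local_cut (p : M) (N : set M) : surface R M -> nbhs p N ->
  exists N', [/\ open_nbhs p N', N' `<=` N, connected (N' `\ p) &
    (N' `\ p) !=set0].
Proof.
move=> [_ _ /(_ p)[U [V [[oU Up] oV [f [g [cf cg fg gf]]]]]]] nN.
set q := f p; have [[Vq Hq] gq] := fg p Up.
have [d d0 dP] : exists2 d : R, 0 < d & forall z, `|z.1 - q.1| < d -> `|z.2 - q.2| < d ->
    V z /\ (half_plane R z -> N (g z)).
  apply/nbhs_plane; have nV : nbhs q V by exact: open_nbhs_nbhs.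
  have nN' : nbhs (g q) N by rewrite gq.
  have := within_near cg (conj Vq Hq) nN'.
  by apply: filterS2 nV => z Vz h; split => // Hz; exact: h.
pose Q := [set z : plane | `|z.1 - q.1| < d /\ `|z.2 - q.2| < d].
have oQ : open Q.
  by apply: openI; apply: open_norm_lt; apply: cont_for => z; cont.
have QE : half_square q d = Q `&` half_plane R.
  by apply/seteqP; split => [z []|z [[]]].
pose N' := U `&` f @^-1` Q.
have NE : N' = g @` half_square q d.
  apply/seteqP; split => [x [Ux Qx]|_ [z hz <-]].
    by exists (f x); [rewrite QE; split => //; have [[]] := fg x Ux|have [] := fg x Ux].
  have [h1 h2 h3] := hz; have [Vz _] := dP z h1 h2.
  have [Ug fgz] := gf z (conj Vz h3); split => //=; rewrite fgz; split => //.
have NpE : N' `\ p = g @` (half_square q d `\ q).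
  rewrite NE; apply/seteqP; split => [_ [[z hz <-] zp]|_ [z [hz zq] <-]].
    by exists z => //; split => // zq; apply: zp; rewrite zq.
  split; first by exists z.
  have [h1 h2 h3] := hz; have [Vz _] := dP z h1 h2.
  by move=> /(congr1 f); have [_ ->] := gf z (conj Vz h3).
exists N'; split.
- split.
    have := (continuous_inP f oU).1; apply => //.
    by rewrite -continuous_open_subspace.
  by split => //; rewrite /Q /= !subrr !normr0.
- rewrite NE => _ [z [h1 h2 h3] <-]; have [_] := dP z h1 h2; exact.
- rewrite NpE; apply: connected_continuous_connected.
    by apply: connected_punctured_half_square.
  apply: continuous_subspaceW cg => z [[h1 h2 h3] _]; split => //.
  by have [] := dP z h1 h2.
- rewrite NpE; exists (g (q.1, q.2 + d / 2)); exists (q.1, q.2 + d / 2) => //.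
  have d20 : 0 < d / 2 by rewrite divr_gt0.
  split; first split => /=; rewrite ?subrr ?normr0//.
  + by rewrite addrAC subrr add0r gtr0_norm//; lra.
  + by rewrite /half_plane /= in Hq; lra.
  + by move=> /(congr1 snd) /= h; clear -d20 h; lra.
Qed.

End LocalConnectivity.

(** * Edges of a triangulated surface *)

Section Edges.
Variables (R : realType) (J : Type) (M : topologicalType).
Local Notation E := (J -> R).
Local Notation plane := (R * R)%type.
Implicit Types (p q r x y : E) (z : plane) (m : M) (c e : R).

Variables (K : set {fset E}) (phi : M -> E) (psi : E -> M).
Hypothesis md : model K phi psi.

Local Notation mt := (mtri psi).
Local Notation bary := (bary K phi).

(** The triangles that contain the edge [p q] are like the pages of a book along it;
    [r] is the vertex opposite to the edge. *)
Definition page p q r : Prop := [/\ r != p, r != q & K [fset p; q; r]%fset].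

Lemma face s t : K s -> t != fset0 -> (t `<=` s)%fset -> K t.
Proof. by have [_ h _] := model_complex md; exact: h. Qed.

Lemma fset3_card p q r : p != q -> p != r -> q != r -> #|` [fset p; q; r]%fset| = 3%N.
Proof.
move=> pq pr qr; have -> : [fset p; q; r]%fset = (p |` [fset q; r])%fset.
  by apply/fsetP => x; rewrite !in_fsetE orbA.
by rewrite cardfsU1 cardfs2 qr !in_fsetE negb_or pq pr.
Qed.

Lemma carrier3 s p q r : K s -> p \in s -> q \in s -> r \in s ->
  p != q -> p != r -> q != r -> s = [fset p; q; r]%fset.
Proof.
move=> Ks ps qs rs pq pr qr; apply/esym/eqP; rewrite eqEfcard fset3_card//.
rewrite (model_dim md)// andbT; apply/fsubsetP => x.
by rewrite !in_fsetE -orbA => /or3P[] /eqP ->.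
Qed.

Lemma triW_q p q r z : q != p -> q != r -> triW p q r z q = z.1.
Proof. by move=> /negbTE qp /negbTE qr; rewrite /triW qp qr eqxx mulr1 !mulr0 ?add0r ?addr0. Qed.

Lemma triW_r p q r z : r != p -> r != q -> triW p q r z r = z.2.
Proof. by move=> /negbTE qp /negbTE qr; rewrite /triW qp qr eqxx mulr1 !mulr0 ?add0r ?addr0. Qed.

Lemma triW_p p q r z : p != q -> p != r -> triW p q r z p = 1 - z.1 - z.2.
Proof. by move=> /negbTE qp /negbTE qr; rewrite /triW qp qr eqxx mulr1 !mulr0 ?add0r ?addr0. Qed.

Lemma triW_out p q r z x : x != p -> x != q -> x != r -> triW p q r z x = 0.
Proof.
by move=> /negbTE h1 /negbTE h2 /negbTE h3; rewrite /triW h1 h2 h3 !mulr0 !addr0.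
Qed.

Lemma mtri_bary p q r m : K [fset p; q; r]%fset ->
  p != q -> p != r -> q != r -> simplex_hull [fset p; q; r]%fset (phi m) ->
  Delta (bary q m, bary r m) /\ m = mt p q r (bary q m, bary r m).
Proof.
move=> Ks pq pr qr; rewrite hull_tri => -[z Dz zE].
have mE : m = mt p q r z by rewrite /mtri zE (model_phiK md).
have bq : bary q m = z.1.
  by rewrite mE (bary_mtri md)//; apply: triW_q => //; rewrite eq_sym.
have br : bary r m = z.2.
  by rewrite mE (bary_mtri md)//; apply: triW_r; rewrite eq_sym.
by rewrite bq br -surjective_pairing.
Qed.

Lemma star_tri p q r m : p != q -> p != r -> q != r ->
  0 < bary p m -> 0 < bary q m -> 0 < bary r m ->
  [/\ K [fset p; q; r]%fset, Delta (bary q m, bary r m) &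
      m = mt p q r (bary q m, bary r m)].
Proof.
move=> pq pr qr bp bq br; have [s Ks hs] := model_poly md m.
have inS := bc_gt0_in (model_complex md) Ks hs.
have sE : s = [fset p; q; r]%fset by apply: carrier3 => //; exact: inS.
by rewrite sE in Ks hs; have [] := mtri_bary Ks pq pr qr hs.
Qed.

Lemma bary_out s m x : K s -> simplex_hull s (phi m) -> x \notin s -> bary x m = 0.
Proof. by move=> Ks hs; exact: (bc_notin (model_complex md)). Qed.

Lemma mtri_edge p q r r' s : mt p q r (s, 0) = mt p q r' (s, 0).
Proof. by rewrite /mtri /tri /= !scale0r. Qed.

(** A simplex that contains the point has the vertices [p] and [q], and at most one
    more. *)
Lemma star_edge p q m : p != q -> 0 < bary p m -> 0 < bary q m ->
  (exists r, [/\ page p q r, Delta (bary q m, bary r m),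
     m = mt p q r (bary q m, bary r m) &
     forall x, x != p -> x != q -> x != r -> bary x m = 0]) \/
  [/\ K [fset p; q; q]%fset, m = mt p q q (bary q m, 0),
     bary q m <= 1 & forall x, x != p -> x != q -> bary x m = 0].
Proof.
move=> pq bp bq; have [s Ks hs] := model_poly md m.
have inS := bc_gt0_in (model_complex md) Ks hs.
have [ps qs] : p \in s /\ q \in s by split; exact: inS.
have [[r [rs rp rq]]|nr] := pselect (exists r, [/\ r \in s, r != p & r != q]).
  left; exists r; have pr : p != r by rewrite eq_sym.
  have qr : q != r by rewrite eq_sym.
  have sE := carrier3 Ks ps qs rs pq pr qr.
  rewrite sE in Ks hs; have [D mE] := mtri_bary Ks pq pr qr hs; split => //.
  move=> x xp xq xr; apply: bary_out Ks hs _.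
  by rewrite !in_fsetE; apply/negP => /orP[/orP[]|]; apply/negP.
right; have out x : x != p -> x != q -> x \notin s.
  by move=> xp xq; apply/negP => xs; apply: nr; exists x.
have sE : s = [fset p; q; q]%fset.
  apply/fsetP => x; rewrite !in_fsetE -orbA orbb; apply/idP/orP.
    move=> xs; have [xp|xp] := eqVneq x p; first by left.
    have [xq|xq] := eqVneq x q; first by right.
    by have := out x xp xq; rewrite xs.
  by move=> [] /eqP ->.
have outb x : x != p -> x != q -> bary x m = 0.
  by move=> xp xq; apply: bary_out Ks hs _; exact: out.
rewrite sE in Ks hs; move: (hs); rewrite hull_tri => -[z [z1 z2 z12] zE].
have mE : m = mt p q q z by rewrite /mtri zE (model_phiK md).
have bqE : bary q m = z.1 + z.2.
  by rewrite mE (bary_mtri md)// /triW eqxx eq_sym (negbTE pq) mulr0 add0r !mulr1.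
split => //; last by rewrite bqE.
rewrite bqE mE /mtri /tri /= scale0r addr0 subr0 -addrA -scalerDl.
by rewrite opprD addrA.
Qed.

(** Near the interior point of parameter [c] of the edge [p q], the map [rho p q
    r c] unfolds the page [r] onto the upper half plane and all other pages onto
    the lower one. *)
Definition rho p q r c m : plane :=
  (bary q m - c, 2 * bary r m + bary p m + bary q m - 1).

Lemma cont_rho p q r c : continuous (rho p q r c).
Proof.
apply: cont_for => m; have cb x : {for m, continuous (bary x)} by exact: (cont_bary md).
have c1 := cb p; have c2 := cb q; have c3 := cb r.
rewrite /rho; apply: cont_pair; first by apply: contB => //; exact: cont_cst.
by do 3?[apply: contB || apply: contD] => //; try exact: cont_cst;
  apply: contM => //; exact: cont_cst.
Qed.

Lemma rho_page p q r c z : p != q -> page p q r -> Delta z ->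
  rho p q r c (mt p q r z) = (z.1 - c, z.2).
Proof.
move=> pq [rp rq Ks] Dz; rewrite /rho !(bary_mtri md)//.
have qp : q != p by rewrite eq_sym.
have qr : q != r by rewrite eq_sym.
have pr : p != r by rewrite eq_sym.
by rewrite triW_q// triW_r// triW_p//; congr pair; ring.
Qed.

Lemma rho_other p q r r' c z : p != q -> page p q r -> page p q r' -> r != r' ->
  Delta z -> rho p q r c (mt p q r' z) = (z.1 - c, - z.2).
Proof.
move=> pq [rp rq Ks] [r'p r'q Ks'] rr' Dz; rewrite /rho !(bary_mtri md)//.
have qp : q != p by rewrite eq_sym.
have qr : q != r' by rewrite eq_sym.
have pr : p != r' by rewrite eq_sym.
by rewrite triW_q// triW_out// triW_p//; congr pair; ring.
Qed.

(** [rho] vanishes only at the point of parameter [c], which is what makes the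
    images of loops around this point wind. *)
Lemma rho_zero p q r c m : p != q -> page p q r -> 0 < bary p m -> 0 < bary q m ->
  rho p q r c m = (0, 0) -> m = mt p q r (c, 0).
Proof.
move=> pq pr bp bq m0; have [[r' [pr' D mE out]]|[Ks mE _ _]] := star_edge pq bp bq.
  have [rr'|rr'] := eqVneq r r'.
    move: m0; rewrite mE -rr' rho_page// ?rr'// => -[/eqP + ->].
    by rewrite subr_eq0 => /eqP ->.
  move: m0; rewrite mE rho_other// => -[/eqP + /eqP].
  by rewrite subr_eq0 oppr_eq0 => /eqP -> /eqP ->; exact: mtri_edge.
move: m0; rewrite /rho => -[/eqP + _]; rewrite subr_eq0 => /eqP h.
by rewrite mE h; exact: mtri_edge.
Qed.

(** The pages [r1] and [r2], laid on the upper and lower half planes; with [r1 = r2]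
    only the upper half is meaningful. *)
Definition glue p q r1 r2 c z : M :=
  if 0 <= z.2 then mt p q r1 (c + z.1, z.2) else mt p q r2 (c + z.1, - z.2).

(** The factor 1/2 leaves positive coordinates at both [p] and [q] on the square. *)
Definition small c e := [/\ 0 < e, e <= c / 2 & e <= (1 - c) / 2].

Lemma small_exists c : 0 < c < 1 -> exists e, small c e.
Proof.
move=> /andP[c0 c1]; exists (Num.min (c / 2) ((1 - c) / 2)); split.
- by rewrite lt_min; apply/andP; split; lra.
- by rewrite ge_min lexx.
- by rewrite ge_min lexx orbT.
Qed.

Lemma small_Delta c e z : small c e -> in_square e z -> Delta (c + z.1, `|z.2|).
Proof.
move=> [e0 e1 e2] /andP[]; rewrite ler_norml => /andP[h1 h2] h3.
by split => /=; [lra|exact: normr_ge0|lra].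
Qed.

Lemma glue_up p q r1 r2 c z : 0 <= z.2 ->
  glue p q r1 r2 c z = mt p q r1 (c + z.1, `|z.2|).
Proof. by move=> z2; rewrite /glue z2 ger0_norm. Qed.

Lemma glue_down p q r1 r2 c z : z.2 <= 0 ->
  glue p q r1 r2 c z = mt p q r2 (c + z.1, `|z.2|).
Proof.
move=> z2; rewrite /glue ler0_norm//; case: ifP => // z2'.
have -> : z.2 = 0 by apply/eqP; rewrite eq_le z2.
by rewrite oppr0; exact: mtri_edge.
Qed.

Lemma cont_glue p q r1 r2 c e : page p q r1 -> page p q r2 -> small c e ->
  {within [set z | in_square e z], continuous (glue p q r1 r2 c)}.
Proof.
move=> [_ _ K1] [_ _ K2] sm.
pose up := [set z : plane | in_square e z /\ 0 <= z.2].
pose dn := [set z : plane | in_square e z /\ z.2 <= 0].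
have -> : [set z | in_square e z] = up `|` dn.
  apply/seteqP; split => z; last by move=> [[]|[]].
  by move=> h; have [h2|/ltW h2] := leP 0 z.2; [left|right].
have csq : closed [set z : plane | in_square e z].
  by apply: compact_closed; [exact: norm_hausdorff|exact: compact_square].
have cgen r : K [fset p; q; r]%fset -> {within [set z | in_square e z],
    continuous (fun z => mt p q r (c + z.1, `|z.2|))}.
  move=> Kr; apply: within_comp (cont_mtri md Kr).
    apply: cont_for => z; have cn : {for z, continuous (fun z : plane => `|z.2|)}.
      have c2 : {for z, continuous (fun z : plane => z.2)} by cont.
      exact: (cont_comp c2 (@norm_continuous _ _ _)).
    by cont.
  by move=> z; exact: small_Delta.
apply: withinU_continuous.
- rewrite (_ : up = [set z : plane | in_square e z] `&` snd @^-1` [set s | 0 <= s]) //.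
  by apply: closedI => //; apply: closed_comp => [z _|]; [exact: cvg_snd|exact: closed_ge].
- rewrite (_ : dn = [set z : plane | in_square e z] `&` snd @^-1` [set s | s <= 0]) //.
  by apply: closedI => //; apply: closed_comp => [z _|]; [exact: cvg_snd|exact: closed_le].
- apply: (@subspace_eq_continuous _ _ _ (fun z => mt p q r1 (c + z.1, `|z.2|))).
    by move=> z /set_mem[_ z2]; rewrite /from_subspace glue_up.
  by apply: continuous_subspaceW (cgen _ K1) => z [].
- apply: (@subspace_eq_continuous _ _ _ (fun z => mt p q r2 (c + z.1, `|z.2|))).
    by move=> z /set_mem[_ z2]; rewrite /from_subspace glue_down.
  by apply: continuous_subspaceW (cgen _ K2) => z [].
Qed.

Lemma rho_glue_up p q r1 r2 c e z : p != q -> page p q r1 -> small c e ->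
  in_square e z -> 0 <= z.2 -> rho p q r1 c (glue p q r1 r2 c z) = z.
Proof.
move=> pq p1 sm sz z2; rewrite glue_up// rho_page//; last exact: small_Delta sm sz.
by rewrite /= ger0_norm// addrAC subrr add0r -surjective_pairing.
Qed.

Lemma rho_glue p q r1 r2 c e z : p != q -> page p q r1 -> page p q r2 ->
  r1 != r2 -> small c e -> in_square e z -> rho p q r1 c (glue p q r1 r2 c z) = z.
Proof.
move=> pq p1 p2 r12 sm sz; have [z2|/ltW z2] := leP 0 z.2; first exact: rho_glue_up sm sz z2.
rewrite glue_down// rho_other//; last exact: small_Delta sm sz.
by rewrite /= ler0_norm// opprK addrAC subrr add0r -surjective_pairing.
Qed.

Lemma rho_glue_off p q r r1 r2 c e z : p != q -> page p q r -> page p q r1 ->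
  page p q r2 -> r != r1 -> r != r2 -> small c e -> in_square e z ->
  rho p q r c (glue p q r1 r2 c z) = (z.1, - `|z.2|).
Proof.
move=> pq p0 p1 p2 h1 h2 sm sz; have D := small_Delta sm sz.
have [z2|/ltW z2] := leP 0 z.2; [rewrite glue_up//|rewrite glue_down//];
  by rewrite rho_other// /= addrAC subrr add0r.
Qed.

Definition open_square e : set plane := [set z | `|z.1| < e /\ `|z.2| < e].

Lemma open_open_square e : open (open_square e).
Proof. by apply: openI; apply: open_norm_lt => z; [exact: cvg_fst|exact: cvg_snd]. Qed.

Lemma open_squareW e z : open_square e z -> in_square e z.
Proof. by move=> [h1 h2]; rewrite /in_square !ltW. Qed.

Lemma bary_glue p q r1 r2 c e z : p != q -> page p q r1 -> page p q r2 -> small c e ->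
  open_square e z -> 0 < bary p (glue p q r1 r2 c z) /\ 0 < bary q (glue p q r1 r2 c z).
Proof.
move=> pq p1 p2 sm oz; have D := small_Delta sm (open_squareW oz).
have [e0 e1 e2] := sm; have [] := oz; rewrite ltr_norml => /andP[h1 h2] h3.
suff h r : page p q r -> 0 < bary p (mt p q r (c + z.1, `|z.2|)) /\
    0 < bary q (mt p q r (c + z.1, `|z.2|)).
  by have [z2|/ltW z2] := leP 0 z.2; [rewrite glue_up//|rewrite glue_down//]; exact: h.
move=> [rp rq Kr]; rewrite !(bary_mtri md)//.
have qp : q != p by rewrite eq_sym.
have qr : q != r by rewrite eq_sym.
have pr : p != r by rewrite eq_sym.
by rewrite triW_q// triW_p//=; split; lra.
Qed.

Lemma open_edge_nbhd p q r c e : open [set m | [/\ 0 < bary p m, 0 < bary q m,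
  `|(rho p q r c m).1| < e & `|(rho p q r c m).2| < e]].
Proof.
rewrite (_ : mkset _ = ([set m | 0 < bary p m] `&` [set m | 0 < bary q m]) `&`
  ([set m | `|(rho p q r c m).1| < e] `&` [set m | `|(rho p q r c m).2| < e])).
  apply: openI; apply: openI; (apply: open_gt0 || apply: open_norm_lt);
    try exact: (cont_bary md).
  - by move=> m; apply: cont_fst; exact: cont_rho.
  - by move=> m; apply: cont_snd; exact: cont_rho.
by apply/seteqP; split => m; [move=> []|move=> [[? ?] [? ?]]].
Qed.

(** An edge with one page is on the boundary, an edge with two is inside. *)
Definition edge_type p q r1 r2 (D : set plane) : Prop :=
  [/\ page p q r1, page p q r2, forall r, page p q r -> r = r1 \/ r = r2 &
      (r1 != r2 /\ D = setT) \/ (r1 = r2 /\ D = half_plane R)].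

Lemma edge_type_rho p q r1 r2 D c e z : p != q -> edge_type p q r1 r2 D ->
  small c e -> in_square e z -> D z -> rho p q r1 c (glue p q r1 r2 c z) = z.
Proof.
move=> pq [p1 p2 _ [[r12 DE]|[r12 DE]]] sm sz Dz; first exact: rho_glue sm sz.
by apply: rho_glue_up sm sz _ => //; rewrite DE in Dz.
Qed.

(** The image is open because it is described by strict inequalities between
    barycentric coordinates: all pages of the edge are among [r1] and [r2]. *)
Lemma edge_chart p q r1 r2 D c e : p != q -> edge_type p q r1 r2 D -> small c e ->
  chart (open_square e `&` D) (rho p q r1 c) (glue p q r1 r2 c).
Proof.
move=> pq et sm; have [p1 p2 pall DE] := et; split.
- exact: cont_rho.
- by apply: continuous_subspaceW (cont_glue p1 p2 sm) => z [/open_squareW].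
- by move=> z [oz Dz]; apply: (edge_type_rho pq et sm _ Dz); exact: open_squareW.
have -> : glue p q r1 r2 c @` (open_square e `&` D) = [set m | [/\ 0 < bary p m,
    0 < bary q m, `|(rho p q r1 c m).1| < e & `|(rho p q r1 c m).2| < e]].
  apply/seteqP; split => [_ [z [oz Dz] <-]|m [bp bq h1 h2]].
    have [bp bq] := bary_glue pq p1 p2 sm oz.
    have rE := edge_type_rho pq et sm (open_squareW oz) Dz.
    by split => //; rewrite rE; case: oz.
  have inpage r : page p q r -> m = mt p q r (bary q m, bary r m) ->
      Delta (bary q m, bary r m) ->
      (glue p q r1 r2 c @` (open_square e `&` D)) m.
    move=> pr mE [d1 d2 d3]; have [rr|rr] := eqVneq r r1.
      have rE : rho p q r1 c m = (bary q m - c, bary r m).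
        by rewrite [in LHS]mE rr rho_page// -rr.
      rewrite rE in h1 h2; exists (bary q m - c, bary r m).
        split; first by [].
        by case: DE => [[_ ->]|[_ ->]].
      by rewrite glue_up//= subrKC ger0_norm// -rr -mE.
    have r2r : r = r2 by have [rE|//] := pall r pr; rewrite rE eqxx in rr.
    case: DE => [[r12 DE]|[r12 _]]; last by rewrite r2r r12 eqxx in rr.
    have rE : rho p q r1 c m = (bary q m - c, - bary r m).
      by rewrite [in LHS]mE rho_other// eq_sym.
    rewrite rE in h1 h2; exists (bary q m - c, - bary r m).
      by split; [|rewrite DE].
    by rewrite glue_down ?oppr_le0//= subrKC normrN ger0_norm// -r2r -mE.
  have [[r [pr Dr mE _]]|[Ks mE b1 out]] := star_edge pq bp bq; first exact: (inpage r).
  have r10 : bary r1 m = 0 by have [? ? _] := p1; exact: out.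
  apply: (inpage r1) => //; rewrite r10; last by split => //=; [exact: ltW|rewrite addr0].
  by rewrite [LHS]mE; exact: mtri_edge.
exact: open_edge_nbhd.
Qed.

End Edges.

(** * Edges have one or two pages *)

Section Pages.
Variables (R : realType) (J : Type) (M : topologicalType).
Local Notation E := (J -> R).
Local Notation plane := (R * R)%type.
Implicit Types (p q r x y : E) (z : plane) (m : M) (c e : R).

Variables (K : set {fset E}) (phi : M -> E) (psi : E -> M).
Hypothesis md : model K phi psi.
Hypothesis sM : surface R M.

Local Notation mt := (mtri psi).
Local Notation bary := (bary K phi).
Local Notation page := (page K).
Local Notation rho := (rho K phi).
Local Notation gl := (glue psi).

Lemma open_bary_gt0 p q : open [set m | 0 < bary p m /\ 0 < bary q m].
Proof. by apply: openI; apply: open_gt0; exact: (cont_bary md). Qed.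

(** Otherwise the point in the middle of the edge would cut the surface locally:
    near it the coordinate at [q] takes values on both sides of 1/2, but the value
    1/2 only at this point. *)
Lemma edge_has_page p q : p != q -> K [fset p; q; q]%fset -> exists r, page p q r.
Proof.
move=> pq Kpq; apply: contrapT => np.
pose x := mt p q q (2^-1, 0).
have D s : 0 <= s <= 1 -> Delta (s, 0 : R).
  by move=> /andP[s0 s1]; split => //=; rewrite addr0.
have D2 : Delta (2^-1 : R, 0 : R) by apply: D; apply/andP; split; lra.
have bE s : 0 <= s <= 1 -> bary p (mt p q q (s, 0)) = 1 - s /\
    bary q (mt p q q (s, 0)) = s.
  move=> sI; rewrite !(bary_mtri md)//; try exact: D.
  by rewrite /triW !eqxx (eq_sym q p) (negbTE pq) /= !mulr0 !mul0r !mulr1; split; ring.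
have i2 : 0 <= (2^-1 : R) <= 1 by apply/andP; split; lra.
have [bp bq] := bE _ i2.
have nN : nbhs x [set m | 0 < bary p m /\ 0 < bary q m].
  apply: open_nbhs_nbhs; split; first exact: open_bary_gt0.
  by rewrite /= bp bq; split; lra.
have [N [[oN Nx] subN cN _]] := no_local_cut sM nN.
pose u m := bary q m - 2^-1.
have u0 m : (N `\ x) m -> u m != 0.
  move=> [Nm mx]; apply/eqP => um; apply: mx; have [h1 h2] := subN m Nm.
  have [[r [pr _ _ _]]|[_ mE _ _]] := star_edge md pq h1 h2.
    by case: np; exists r.
  by rewrite mE (_ : bary q m = 2^-1)//; move: um; rewrite /u; lra.
have [d d0 dP] : exists2 d : R, 0 < d & forall s, 0 <= s <= 1 -> `|s - 2^-1| < d ->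
    N (mt p q q (s, 0)).
  have := within_near (cont_mtri md Kpq) D2 (open_nbhs_nbhs (conj oN Nx)).
  move=> /nbhs_plane[d d0 dP]; exists d => // s sI sd; apply: dP => //=.
    by rewrite subrr normr0.
  exact: D.
pose k := Num.min (d / 2) 2^-1.
have k0 : 0 < k by rewrite lt_min; apply/andP; split; lra.
have k1 : k <= 2^-1 by rewrite ge_min lexx orbT.
have kd : k < d by apply: (@le_lt_trans _ _ (d / 2)); [rewrite ge_min lexx|lra].
have cu : connected (u @` (N `\ x)).
  apply: connected_continuous_connected => //; apply: continuous_subspaceT.
  by move=> m; apply: contB; [exact: (cont_bary md)|exact: cont_cst].
have uim s : 0 <= s <= 1 -> `|s - 2^-1| < d -> s != 2^-1 -> (u @` (N `\ x)) (s - 2^-1).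
  move=> sI sd s2; have [_ bs] := bE s sI; exists (mt p q q (s, 0)); last by rewrite /u bs.
  by split; [exact: dP|move=> e; move: bs; rewrite e bq => es; rewrite es eqxx in s2].
have h1 : (u @` (N `\ x)) (- k).
  rewrite (_ : - k = (2^-1 - k) - 2^-1); last by ring.
  apply: uim; first by apply/andP; split; lra.
    by rewrite addrAC subrr add0r normrN gtr0_norm.
  by rewrite lt_eqF//; lra.
have h2 : (u @` (N `\ x)) k.
  rewrite (_ : k = (2^-1 + k) - 2^-1); last by ring.
  apply: uim; first by apply/andP; split; lra.
    by rewrite addrAC subrr add0r gtr0_norm.
  by rewrite gt_eqF//; lra.
have /connected_intervalP ic := cu.
have [m Nm um] : (u @` (N `\ x)) 0.
  by apply: (ic _ _ h1 h2); apply/andP; split; lra.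
by have := u0 m Nm; rewrite um eqxx.
Qed.

(** The pages [r1] and [r2], as well as [r2] and [r3], give a loop around a point of
    the edge. Maps of a punctured disc multiply the windings of all loops by the same
    number. The first loop winds when unfolded at [r1], the second one when unfolded
    at [r2], but the second one does not wind when unfolded at [r1]. *)
Lemma no_three_pages p q r1 r2 r3 : p != q -> page p q r1 -> page p q r2 ->
  page p q r3 -> r1 != r2 -> r1 != r3 -> r2 != r3 -> False.
Proof.
move=> pq p1 p2 p3 r12 r13 r23.
have half : 0 < (2^-1 : R) < 1 by apply/andP; split; lra.
have [e sm] := small_exists half; have [e0 e1 e2] := sm.
pose x := mt p q r1 (2^-1, 0).
have D2 : Delta (2^-1 : R, 0 : R) by split => //=; lra.
have [_ _ /(_ x)[U [V [[oU Ux] oV [f [g [cf cg fg gf]]]]]]] := sM.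
set b := f x; have [[Vb Hb] gb] := fg x Ux.
have gl0 ri rj : gl p q ri rj 2^-1 (0, 0) = x.
  by rewrite /glue /= lexx addr0; exact: mtri_edge.
have bx : 0 < bary p x /\ 0 < bary q x.
  rewrite -(gl0 r1 r2); apply: (bary_glue md pq p1 p2 sm).
  by split; rewrite normr0.
have [d' d'0 d'P] : exists2 d : R, 0 < d & forall z, `|z.1 - b.1| < d -> `|z.2 - b.2| < d ->
    V z /\ (half_plane R z -> 0 < bary p (g z) /\ 0 < bary q (g z)).
  apply/nbhs_plane; have nV : nbhs b V by exact: open_nbhs_nbhs.
  have nS : nbhs (g b) [set m | 0 < bary p m /\ 0 < bary q m].
    by rewrite gb; apply: open_nbhs_nbhs; split => //; exact: open_bary_gt0.
  have := within_near cg (conj Vb Hb) nS.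
  by apply: filterS2 nV => z Vz h; split => // Hz; apply: h.
(* off the boundary line, the disc has to stay off it too *)
pose d := if b.2 == 0 then d' else Num.min d' b.2.
have d0 : 0 < d.
  rewrite /d; case: ifPn => // b0; rewrite lt_min d'0 lt_neqAle eq_sym b0.
  exact: Hb.
have dd : d <= d' by rewrite /d; case: ifP => // _; rewrite ge_min lexx.
have dP z : `|z.1 - b.1| < d -> `|z.2 - b.2| < d ->
    V z /\ (half_plane R z -> 0 < bary p (g z) /\ 0 < bary q (g z)).
  by move=> h1 h2; apply: d'P; [exact: lt_le_trans h1 dd|exact: lt_le_trans h2 dd].
have db : b.2 != 0 -> d <= b.2.
  by rewrite /d => /negbTE ->; rewrite ge_min lexx orbT.
have d20 : 0 < d / 2 by rewrite divr_gt0.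
have cfx : {for x, continuous f} by exact: within_open cf Ux.
pose near_b (z : plane) := `|z.1 - b.1| < d / 4 /\ `|z.2 - b.2| < d / 4.
have nb : nbhs b near_b by apply/nbhs_plane; exists (d / 4); rewrite ?divr_gt0.
have loop ri rj : page p q ri -> page p q rj -> ri != rj -> exists2 s, 0 < s & s <= e /\
    forall z, `|z.1| < s -> `|z.2| < s ->
      [/\ U (gl p q ri rj 2^-1 z), near_b (f (gl p q ri rj 2^-1 z)) &
          {for z, continuous (gl p q ri rj 2^-1)}].
  move=> pi pj rij.
  have cgl z : open_square e z -> {for z, continuous (gl p q ri rj 2^-1)}.
    move=> [h1 h2].
    have := cont_glue md pi pj sm; rewrite subspace_continuousP => /(_ z) cz.
    have zi : nbhs z [set z | in_square e z].
      apply: (filterS (@open_squareW _ e)); apply: open_nbhs_nbhs.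
      by split; [exact: open_open_square|].
    move=> P nP; have := cz (open_squareW (conj h1 h2)) P nP; rewrite /= nbhs_simpl => h.
    by apply: filterS2 zi h => w wi; apply.
  have o0 : open_square e (0, 0) by split; rewrite normr0.
  have nU : nbhs (0 : R, 0 : R) (fun z => U (gl p q ri rj 2^-1 z)).
    by apply: (cgl _ o0); rewrite gl0; exact: open_nbhs_nbhs.
  have nB : nbhs (0 : R, 0 : R) (fun z => near_b (f (gl p q ri rj 2^-1 z))).
    have c0 : {for (0, 0), continuous (fun z => f (gl p q ri rj 2^-1 z))}.
      by apply: (cont_comp (cgl _ o0)); rewrite gl0.
    by apply: c0; rewrite gl0.
  have [s s0 sP] := (nbhs_plane _ _).1 (filterI nU nB).
  exists (Num.min s e); first by rewrite lt_min s0.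
  split; first by rewrite ge_min lexx orbT.
  move=> z; rewrite !lt_min => /andP[h1 h2] /andP[h3 h4].
  have [||h5 h6] := sP z; rewrite ?subr0//; split => //; exact: cgl.
have [s1 s10 [s1e s1P]] := loop r1 r2 p1 p2 r12.
have [s2 s20 [s2e s2P]] := loop r2 r3 p2 p3 r23.
pose s := Num.min s1 s2 / 2.
have s0 : 0 < s by rewrite divr_gt0// lt_min s10.
have circ t (a : R) : Num.min s1 s2 <= a -> `|(circle s t).1| < a /\ `|(circle s t).2| < a.
  move=> sa; have sa' : s < a by apply: lt_le_trans sa; move: s0; rewrite /s; lra.
  by split; rewrite /circle /= normrM (gtr0_norm s0);
    apply: le_lt_trans sa'; rewrite ler_piMr ?(ltW s0)// ?cos_max ?sin_max.
have c1s t : `|(circle s t).1| < s1 /\ `|(circle s t).2| < s1.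
  by apply: circ; rewrite ge_min lexx.
have c2s t : `|(circle s t).1| < s2 /\ `|(circle s t).2| < s2.
  by apply: circ; rewrite ge_min lexx orbT.
have cin t : in_square e (circle s t).
  have [h1 h2] := c1s t.
  by apply/andP; split; apply: le_trans s1e; exact: ltW.
pose S1 t := gl p q r1 r2 2^-1 (circle s t).
pose S2 t := gl p q r2 r3 2^-1 (circle s t).
have S1P t : [/\ U (S1 t), near_b (f (S1 t)) & {for t, continuous S1}].
  have [h1 h2] := c1s t; have [h3 h4 h5] := s1P _ h1 h2; split => //.
  exact: (cont_comp (@cont_circle R s t) h5).
have S2P t : [/\ U (S2 t), near_b (f (S2 t)) & {for t, continuous S2}].
  have [h1 h2] := c2s t; have [h3 h4 h5] := s2P _ h1 h2; split => //.
  exact: (cont_comp (@cont_circle R s t) h5).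
have rho11 t : rho p q r1 2^-1 (S1 t) = circle s t.
  by apply: (rho_glue md pq p1 p2 r12 sm).
have rho22 t : rho p q r2 2^-1 (S2 t) = circle s t.
  by apply: (rho_glue md pq p2 p3 r23 sm).
have rho12 t : rho p q r1 2^-1 (S2 t) = ((circle s t).1, - `|(circle s t).2|).
  by apply: (rho_glue_off md pq p1 p2 p3 r12 r13 sm).
have cS (S : R -> M) : (forall t, [/\ U (S t), near_b (f (S t)) & {for t, continuous S}]) ->
    continuous (fun t => f (S t)).
  move=> SP t; have [h1 _ h3] := SP t.
  exact: (cont_comp h3 (within_open oU cf h1)).
have c1 := cS _ S1P; have c2 := cS _ S2P.
have gfS (S : R -> M) t : U (S t) -> g (f (S t)) = S t by move=> h; have [] := fg _ h.
have circ0 t : circle s t <> (0, 0).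
  move=> h; have := rad_polar (pi *+ 2 * t) (ltW s0); rewrite -/(circle s t) h.
  by rewrite /rad /= expr0n /= addr0 sqrtr0 => h'; rewrite -h' ltxx in s0.
have rho0 r z : page p q r -> half_plane R z -> `|z.1 - b.1| < d -> `|z.2 - b.2| < d ->
    rho p q r 2^-1 (g z) = (0, 0) -> z = b.
  move=> pr Hz h1 h2 h0; have [Vz /(_ Hz)[h3 h4]] := dP z h1 h2.
  have [_ <-] := gf z (conj Vz Hz).
  by rewrite (rho_zero md pq pr h3 h4 h0) /b; congr f; exact: mtri_edge.
have crho r z : (V `&` half_plane R) z ->
    (fun z => rho p q r 2^-1 (g z)) @ within (V `&` half_plane R) (nbhs z) -->
    rho p q r 2^-1 (g z).
  move=> Vz; move: cg; rewrite subspace_continuousP => /(_ z Vz) h.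
  exact: (cvg_comp _ _ h (@cont_rho _ _ _ _ _ _ md p q r 2^-1 _)).
have HS (S : R -> M) : (forall t, [/\ U (S t), near_b (f (S t)) & {for t, continuous S}]) ->
    forall t, (V `&` half_plane R) (f (S t)).
  by move=> SP t; have [h _ _] := SP t; have [] := fg _ h.
have w1 : winds (fun t => rho p q r1 2^-1 (g (f (S1 t)))) (pi *+ 2).
  have -> : (fun t => rho p q r1 2^-1 (g (f (S1 t)))) = circle s.
    by apply/funext => t; have [h _ _] := S1P t; rewrite gfS.
  exact: winds_circle.
have w2 : winds (fun t => rho p q r2 2^-1 (g (f (S2 t)))) (pi *+ 2).
  have -> : (fun t => rho p q r2 2^-1 (g (f (S2 t)))) = circle s.
    by apply/funext => t; have [h _ _] := S2P t; rewrite gfS.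
  exact: winds_circle.
have pi20 : pi *+ 2 != 0 :> R by rewrite mulrn_eq0 /= gt_eqF// pi_gt0.
have fS1b t : f (S1 t) <> b.
  move=> h; apply: (circ0 t); rewrite -rho11; have [h1 _ _] := S1P t.
  rewrite -gfS// h gb -(gl0 r1 r2); apply: (rho_glue md pq p1 p2 r12 sm).
  by rewrite /in_square /= normr0 ltW.
have fS2b t : f (S2 t) <> b.
  move=> h; apply: (circ0 t); rewrite -rho22; have [h1 _ _] := S2P t.
  rewrite -gfS// h gb -(gl0 r2 r3); apply: (rho_glue md pq p2 p3 r23 sm).
  by rewrite /in_square /= normr0 ltW.
have [b0|b0] := eqVneq b.2 0.
  (* the image of the first loop contracts in a half disc minus [b] *)
  have wn : winds ((fun z => rho p q r1 2^-1 (g z)) \o (fun t => f (S1 t))) 0.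
    apply: (@loop_half_disc_null _ (fun z => rho p q r1 2^-1 (g z)) b.1 (d / 2)) => //.
    - rewrite subspace_continuousP => z [h1 h2 h3].
      have [||Vz _] := dP z; first by apply: le_lt_trans h1 _; lra.
        by rewrite b0 subr0 ger0_norm//; apply: le_lt_trans h3 _; lra.
      have cz := crho r1 z (conj Vz h2).
      apply: cvg_trans cz; apply: cvg_fmap2; apply: within_subset.
      move=> w [h4 h5 h6].
      suff [Vw _] : V w /\ (half_plane R w -> 0 < bary p (g w) /\ 0 < bary q (g w)) by split.
      apply: dP; first by apply: le_lt_trans h4 _; lra.
      by rewrite b0 subr0 ger0_norm//; apply: le_lt_trans h6 _; lra.
    - move=> z [h1 h2 h3] zb /rho0 h; apply: zb; rewrite h//.
      + by rewrite [LHS]surjective_pairing b0.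
      + by apply: le_lt_trans h1 _; lra.
      + by rewrite b0 subr0 ger0_norm//; apply: le_lt_trans h3 _; lra.
    - move=> t; have [h1 [h2 h3] _] := S1P t; have [_ h4] := HS _ S1P t.
      split => //; first by lra.
      by move: h3; rewrite b0 subr0; have := ler_norm (f (S1 t)).2; lra.
    - by move=> t h; apply: (fS1b t); rewrite h -b0 -surjective_pairing.
    - by rewrite /S1 circle01.
  by move/eqP: (winds_uniq w1 wn); rewrite (negbTE pi20).
have b2 : 0 < b.2 by rewrite lt_neqAle eq_sym b0.
(* now the disc around [b] lies in the chart: the unfolding at [r1] multiplies
   the windings by [k1], the one at [r2] by [k2] *)
pose psir r (w : plane) := rho p q r 2^-1 (g (b.1 + w.1, b.2 + w.2)).
have psirP r w : page p q r -> 0 < rad w <= d / 2 ->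
    {for w, continuous (psir r)} /\ psir r w <> (0, 0).
  move=> pr /andP[w0 wd]; have [w1' w2'] := rad_ge w.
  have [||Vw _] := dP (b.1 + w.1, b.2 + w.2).
  - by rewrite /= addrAC subrr add0r; lra.
  - by rewrite /= addrAC subrr add0r; lra.
  have bw : 0 < b.2 + w.2.
    by have := db b0; have := ler_norm (- w.2); rewrite normrN; lra.
  split; last first.
    move=> /rho0 h; move: w0; have -> : w = (0, 0).
      have be : (b.1 + w.1, b.2 + w.2) = b.
        apply: h => //=; first exact: ltW.
          by rewrite addrAC subrr add0r; lra.
        by rewrite addrAC subrr add0r; lra.
      have w10 : w.1 = 0 by apply: (addrI b.1); rewrite addr0; exact: (congr1 fst be).
      have w20 : w.2 = 0 by apply: (addrI b.2); rewrite addr0; exact: (congr1 snd be).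
      by rewrite [w]surjective_pairing w10 w20.
    by rewrite /rad /= expr0n /= addr0 sqrtr0 ltxx.
  have ct : {for w, continuous (fun w : plane => (b.1 + w.1, b.2 + w.2))} by cont.
  suff cg' : {for (b.1 + w.1, b.2 + w.2), continuous (fun z => rho p q r 2^-1 (g z))}.
    exact: (cont_comp ct cg').
  move=> P nP; have := crho r _ (conj Vw (ltW bw)) P nP; rewrite /= nbhs_simpl => h.
  have nH : nbhs (b.1 + w.1, b.2 + w.2) (V `&` half_plane R).
    apply: filterI; first exact: open_nbhs_nbhs.
    apply: (filterS (P := snd @^-1` [set s | 0 < s])); first by move=> z /ltW.
    by apply: cvg_snd; apply: open_nbhs_nbhs; split => //; exact: open_gt.
  by apply: filterS2 nH h => z Hz; apply.
pose sh (S : R -> M) t : plane := ((f (S t)).1 - b.1, (f (S t)).2 - b.2).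
have shE r S t : U (S t) -> psir r (sh S t) = rho p q r 2^-1 (S t).
  by move=> h; rewrite /psir /sh /= !subrKC -surjective_pairing gfS.
have csh S : continuous (fun t => f (S t)) -> continuous (sh S).
  move=> c; apply: cont_for => t; have ct : {for t, continuous (fun t => f (S t))} by exact: c.
  by rewrite /sh; cont.
have shr S t : near_b (f (S t)) -> f (S t) <> b -> 0 < rad (sh S t) <= d / 2.
  move=> [h1 h2] h; apply/andP; split; last first.
    by apply: le_trans (rad_le _) _; rewrite /sh /=; lra.
  apply: rad_gt0 => -[/eqP h3 /eqP h4]; apply: h; rewrite !subr_eq0 in h3 h4.
  by rewrite [LHS]surjective_pairing (eqP h3) (eqP h4) -surjective_pairing.
have r1P t : 0 < rad (sh S1 t) <= d / 2 by apply: shr => //; have [] := S1P t.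
have r2P t : 0 < rad (sh S2 t) <= d / 2 by apply: shr => //; have [] := S2P t.
have nz S t : 0 < rad (sh S t) <= d / 2 -> sh S t <> (0, 0).
  by move=> /andP[+ _] h; rewrite h /rad /= expr0n /= addr0 sqrtr0 ltxx.
have l1 : sh S1 0 = sh S1 1 by rewrite /sh /S1 circle01.
have l2 : sh S2 0 = sh S2 1 by rewrite /sh /S2 circle01.
have [u1 wu1] := winds_exists (csh _ c1) (fun t => @nz S1 t (r1P t)).
have [u2 wu2] := winds_exists (csh _ c2) (fun t => @nz S2 t (r2P t)).
have [k1 [h1 h2]] := winds_punctured d20 (fun w => @psirP r1 w p1) (csh _ c1) (csh _ c2) l1 l2 r1P r2P.
have [k2 [_ h3]] := winds_punctured d20 (fun w => @psirP r2 w p2) (csh _ c1) (csh _ c2) l1 l2 r1P r2P.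
have E11 : psir r1 \o sh S1 = circle s.
  by apply/funext => t; have [h _ _] := S1P t; rewrite /= shE.
have E22 : psir r2 \o sh S2 = circle s.
  by apply/funext => t; have [h _ _] := S2P t; rewrite /= shE.
have k1u1 : k1 * u1 = pi *+ 2.
  by apply: winds_uniq (h1 _ wu1) _; rewrite E11; exact: winds_circle.
have k2u2 : k2 * u2 = pi *+ 2.
  by apply: winds_uniq (h3 _ wu2) _; rewrite E22; exact: winds_circle.
(* the page [r1] is not on the second loop, which [rho] at [r1] folds *)
have k1u2 : k1 * u2 = 0.
  apply: winds_palindrome (h2 _ wu2) => t.
  have [h _ _] := S2P t; have [h' _ _] := S2P (1 - t); rewrite /= !shE// !rho12.
  rewrite /circle /= mulrBr mulr1 cosB sinB cos2pi sin2pi.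
  by rewrite !mul1r !mul0r addr0 sub0r mulrN normrN.
move/eqP: k1u2; rewrite mulf_eq0 => /orP[]/eqP k0.
  by move/eqP: k1u1; rewrite k0 mul0r eq_sym (negbTE pi20).
by move/eqP: k2u2; rewrite k0 mulr0 eq_sym (negbTE pi20).
Qed.

Lemma edge_typeP p q : p != q -> K [fset p; q; q]%fset ->
  exists r1 r2 D, edge_type K p q r1 r2 D.
Proof.
move=> pq Kpq; have [r1 p1] := edge_has_page pq Kpq.
have [[r2 [p2 r12]]|n2] := pselect (exists r2, page p q r2 /\ r1 != r2).
  exists r1, r2, setT; split => //; last by left.
  move=> r pr; have [->|rr1] := eqVneq r r1; first by left.
  have [->|rr2] := eqVneq r r2; first by right.
  by have := no_three_pages pq p1 p2 pr r12; rewrite eq_sym => /(_ rr1); rewrite eq_sym => /(_ rr2).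
exists r1, r1, (half_plane R); split => //; last by right.
move=> r pr; have [->|rr1] := eqVneq r r1; first by left.
by case: n2; exists r; rewrite eq_sym.
Qed.

End Pages.

(** * Piecewise-linear maps in affine coordinates of a triangle *)

Section Lines.
Variable R : realType.
Local Notation plane := (R * R)%type.
Local Notation line := (R * R * R)%type.
Implicit Types (z v w : plane) (s t e : R) (l : line) (ls : seq line).

Definition lin l v : R := l.1.1 * v.1 + l.1.2 * v.2.
Definition ev l z : R := lin l z + l.2.
Definition is_line l : Prop := l.1.1 != 0 \/ l.1.2 != 0.

Definition hp z v w s t : plane :=
  (z.1 + s * v.1 + t * w.1, z.2 + s * v.2 + t * w.2).

Lemma ev_hp l z v w s t : ev l (hp z v w s t) = ev l z + s * lin l v + t * lin l w.
Proof. by rewrite /ev /lin /hp /=; ring. Qed.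

Definition range_ge0 e s t := `|s| <= e /\ 0 <= t <= e.
Definition range_gt0 e s t := `|s| <= e /\ 0 < t <= e.

(** On a segment from the point [(0, e)] to a point with a negative value there would
    be a zero. *)
Lemma affine_sign (a b c e : R) : 0 < e ->
  (forall s t, range_gt0 e s t -> a + s * b + t * c != 0) ->
  0 <= a + e * c -> forall s t, range_ge0 e s t -> 0 <= a + s * b + t * c.
Proof.
move=> e0 nz p0 s t [sI /andP[t0 te]]; rewrite leNgt; apply/negP => n0.
have p1 : 0 < a + e * c.
  have := nz 0 e; rewrite mul0r addr0 => h; rewrite lt_neqAle p0 eq_sym h//.
  by split; [rewrite normr0 ltW|rewrite e0 lexx].
set g := a + s * b + t * c in n0.
pose k := (a + e * c) / (a + e * c - g).
have d0 : 0 < a + e * c - g by lra.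
have k0 : 0 < k by rewrite divr_gt0.
have k1 : k < 1 by rewrite ltr_pdivrMr// mul1r; lra.
have := nz (k * s) ((1 - k) * e + k * t).
have -> : a + k * s * b + ((1 - k) * e + k * t) * c = (a + e * c) - k * (a + e * c - g).
  by rewrite /g; ring.
have kE : k * (a + e * c - g) = a + e * c by rewrite /k divfK// gt_eqF.
rewrite kE subrr eqxx => h; suff /h : range_gt0 e (k * s) ((1 - k) * e + k * t) by [].
split.
  rewrite normrM (gtr0_norm k0); apply: le_trans sI.
  by rewrite ler_piMl// ltW.
have h1 : 0 < (1 - k) * e by rewrite mulr_gt0// subr_gt0.
have h2 : 0 <= k * t by rewrite mulr_ge0// ltW.
have h3 : k * t <= k * e by rewrite ler_pM2l.
by apply/andP; split; lra.
Qed.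

Definition det_lines l l' : R := l.1.1 * l'.1.2 - l.1.2 * l'.1.1.

Definition crossing ls z : Prop := exists l l',
  [/\ l \in ls, l' \in ls, det_lines l l' != 0, ev l z = 0 & ev l' z = 0].

Lemma finite_crossing ls : finite_set [set z | crossing ls z].
Proof.
pose cr l l' : plane := ((l.1.2 * l'.2 - l'.1.2 * l.2) / det_lines l l',
                         (l'.1.1 * l.2 - l.1.1 * l'.2) / det_lines l l').
apply: (@sub_finite_set _ _ [set` [seq cr l l' | l <- ls, l' <- ls]]).
  move=> z [l [l' [ll l'l d h1 h2]]]; apply/allpairsP; exists (l, l'); split => //=.
  rewrite [z]surjective_pairing /cr; congr pair.
    apply: (mulIf d); rewrite divfK//; move: h1 h2; rewrite /ev /lin /det_lines => h1 h2.
    have -> : l.2 = - (l.1.1 * z.1 + l.1.2 * z.2) by lra.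
    have -> : l'.2 = - (l'.1.1 * z.1 + l'.1.2 * z.2) by lra.
    ring.
  apply: (mulIf d); rewrite divfK//; move: h1 h2; rewrite /ev /lin /det_lines => h1 h2.
  have -> : l.2 = - (l.1.1 * z.1 + l.1.2 * z.2) by lra.
  have -> : l'.2 = - (l'.1.1 * z.1 + l'.1.2 * z.2) by lra.
  ring.
exact: finite_seq.
Qed.

(** A direction [v] along all the lines through [z], and a direction [w] across. *)
Definition transverse ls z v w : Prop :=
  forall l, l \in ls -> ev l z = 0 -> lin l v = 0 /\ lin l w != 0.

Lemma transverse_avoid ls z v w : transverse ls z v w ->
  exists2 e, 0 < e & forall l s t, l \in ls -> `|s| <= e -> `|t| <= e -> t != 0 ->
    ev l (hp z v w s t) != 0.
Proof.
elim: ls => [|l ls IH] tr; first by exists 1.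
have [|e e0 eP] := IH; first by move=> l' l'l; apply: tr; rewrite inE l'l orbT.
suff [d d0 dP] : exists2 d, 0 < d & forall s t, `|s| <= d -> `|t| <= d -> t != 0 ->
    ev l (hp z v w s t) != 0.
  exists (Num.min e d); first by rewrite lt_min e0.
  move=> l' s t; rewrite inE !le_min => /orP[/eqP ->|l'l] /andP[h1 h2] /andP[h3 h4] t0.
    exact: dP.
  exact: eP.
have [lz|lz] := eqVneq (ev l z) 0.
  exists 1 => // s t _ _ t0; rewrite ev_hp lz.
  have [-> lw] := tr l (mem_head _ _) lz.
  by rewrite mulr0 !add0r mulf_neq0.
have p1 : 0 < 1 + `|lin l v| + `|lin l w|.
  by rewrite -addrA ltr_pwDl// addr_ge0.
have n0 : 0 < `|ev l z| by rewrite normr_gt0.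
exists (`|ev l z| / (1 + `|lin l v| + `|lin l w|)); first by rewrite divr_gt0.
move=> s t; rewrite !ler_pdivlMr// => h1 h2 _; apply/eqP; rewrite ev_hp => h.
have h3 : `|ev l z| <= `|s| * `|lin l v| + `|t| * `|lin l w|.
  rewrite -!normrM; have -> : ev l z = - (s * lin l v + t * lin l w) by lra.
  by rewrite normrN ler_normD.
have [a b c d] := And4 (normr_ge0 s) (normr_ge0 t) (normr_ge0 (lin l v)) (normr_ge0 (lin l w)).
have [st|ts] := leP `|s| `|t|.
  have := ler_wpM2r c st; move: h2; rewrite !mulrDr mulr1.
  have := mulr_ge0 b c; have := mulr_ge0 b d => ? ? ? ?.
  have t0 : `|t| <= 0 by lra.
  have t00 : `|t| = 0 by lra.
  by rewrite t00 !mul0r in h3; have s00 : `|s| = 0 by [lra|]; rewrite s00 mul0r in h3; lra.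
have := ler_wpM2r d (ltW ts); move: h1; rewrite !mulrDr mulr1.
have := mulr_ge0 a c; have := mulr_ge0 a d => ? ? ? ?; lra.
Qed.

Lemma transverse_exists ls z : (forall l, l \in ls -> is_line l) ->
  ~ crossing ls z -> exists v w, cross v w != 0 /\ transverse ls z v w.
Proof.
move=> isl nc; have [[l0 [l0l z0]]|none] := pselect (exists l0, l0 \in ls /\ ev l0 z = 0).
  exists (- l0.1.2, l0.1.1), (l0.1.1, l0.1.2).
  have sq (l : line) : is_line l -> 0 < l.1.1 ^+ 2 + l.1.2 ^+ 2.
    move=> [h|h]; [apply: ltr_pwDl|rewrite addrC; apply: ltr_pwDl]; rewrite ?sqr_ge0//;
      by rewrite lt_neqAle sqr_ge0 andbT eq_sym sqrf_eq0.
  split.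
    have := sq _ (isl _ l0l); rewrite /cross /= !expr2 => h.
    by rewrite lt_eqF//; lra.
  move=> l ll zl; have d0 : det_lines l0 l = 0.
    by apply/eqP; apply: contraPT isT => d; case: nc; exists l0, l.
  split; first by move: d0; rewrite /det_lines /lin /=; lra.
  have h1 := sq _ (isl _ l0l); have h2 := sq _ (isl _ ll).
  have := mulr_gt0 h1 h2; apply: contraTneq => h.
  have -> : (l0.1.1 ^+ 2 + l0.1.2 ^+ 2) * (l.1.1 ^+ 2 + l.1.2 ^+ 2) =
     lin l (l0.1.1, l0.1.2) ^+ 2 + det_lines l0 l ^+ 2.
    by rewrite /lin /det_lines /=; ring.
  by rewrite h d0 expr0n /= addr0 ltxx.
exists (1, 0), (0, 1); split.
  by rewrite /cross /= mulr1 mulr0 subr0 oner_neq0.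
by move=> l ll zl; case: none; exists l.
Qed.

(** The line of this side of the triangle is in the list, so away from the crossings
    the lines through a point of the side coincide with it. *)
Lemma transverse_side ls c : (forall l, l \in ls -> is_line l) ->
  (0, 1, 0) \in ls -> ~ crossing ls (c, 0) -> transverse ls (c, 0) (1, 0) (0, 1).
Proof.
move=> isl el nc l ll zl.
have d0 : det_lines (0, 1, 0) l = 0.
  apply/eqP; apply: contraPT isT => d; case: nc; exists (0, 1, 0), l; split => //.
  by rewrite /ev /lin /=; ring.
have l1 : l.1.1 = 0 by move: d0; rewrite /det_lines /=; lra.
rewrite /lin /= l1; split; first by ring.
rewrite mul0r add0r mulr1; case: (isl l ll) => //.
by rewrite l1 eqxx.
Qed.

End Lines.

Section SimplexLines.
Variables (R : realType) (J : Type).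
Local Notation E := (J -> R).
Local Notation plane := (R * R)%type.
Local Notation line := (R * R * R)%type.
Implicit Types (p q r x y a b c d : E) (z v w : plane) (s t e : R) (l : line).

Definition indep (v w : E) : Prop :=
  forall s t : R, s *: v + t *: w = 0 -> s = 0 /\ t = 0.

Definition delta4 a b c d (k1 k2 k3 k4 : R) x : R :=
  k1 * (x == a)%:R + k2 * (x == b)%:R + k3 * (x == c)%:R + k4 * (x == d)%:R.

Lemma sum_delta4 (V : lmodType R) (F : E -> V) (s : {fset E}) a b c d k1 k2 k3 k4 :
  a \in s -> b \in s -> c \in s -> d \in s ->
  \sum_(x <- s) delta4 a b c d k1 k2 k3 k4 x *: F x =
  k1 *: F a + k2 *: F b + k3 *: F c + k4 *: F d.
Proof.
move=> ai bi ci di; have us : uniq s by exact: fset_uniq.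
rewrite -(sum_delta F us ai) -(sum_delta F us bi) -(sum_delta F us ci) -(sum_delta F us di).
rewrite !scaler_sumr -!big_split; apply: eq_bigr => x _.
by rewrite /delta4 /= !scalerA -!scalerDl.
Qed.

(** An affine relation between four vertices, possibly repeated, is trivial once
    the coefficients of equal vertices are added. *)
Lemma affine_relation (s : {fset E}) a b c d k1 k2 k3 k4 :
  affinely_independent s -> a \in s -> b \in s -> c \in s -> d \in s ->
  k1 + k2 + k3 + k4 = 0 -> k1 *: a + k2 *: b + k3 *: c + k4 *: d = 0 ->
  forall x, x \in s -> delta4 a b c d k1 k2 k3 k4 x = 0.
Proof.
move=> ai ain bin cin din k0 kv; apply: ai; last by rewrite (sum_delta4 id).
transitivity (\sum_(x <- s) delta4 a b c d k1 k2 k3 k4 x *: (1 : R^o)).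
  by apply: eq_bigr => x _; rewrite /GRing.scale /= mulr1.
by rewrite sum_delta4// /GRing.scale /= !mulr1.
Qed.

Lemma affine_indep3 (s : {fset E}) a b c k1 k2 k3 :
  affinely_independent s -> a \in s -> b \in s -> c \in s ->
  a != b -> a != c -> b != c ->
  k1 + k2 + k3 = 0 -> k1 *: a + k2 *: b + k3 *: c = 0 ->
  [/\ k1 = 0, k2 = 0 & k3 = 0].
Proof.
move=> ai ain bin cin ab ac bc k0 kv.
have h := @affine_relation s a b c a k1 k2 k3 0 ai ain bin cin ain.
have {}h : forall x, x \in s -> delta4 a b c a k1 k2 k3 0 x = 0.
  by apply: h; rewrite ?addr0// scale0r addr0.
have := h a ain; have := h b bin; have := h c cin.
rewrite /delta4 !eqxx (eq_sym b a) (eq_sym c a) (eq_sym c b).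
rewrite (negbTE ab) (negbTE ac) (negbTE bc) !mulr0 !mulr1 ?mul0r ?addr0 ?add0r.
by move=> -> -> ->.
Qed.

Lemma indep_simplex (s : {fset E}) p q r : affinely_independent s ->
  p \in s -> q \in s -> r \in s -> p != q -> p != r -> q != r ->
  indep (q - p) (r - p).
Proof.
move=> ai pi qi ri pq pr qr k1 k2 h.
have [||_ -> ->//] := @affine_indep3 s p q r (- k1 - k2) k1 k2 ai pi qi ri pq pr qr.
  by ring.
by rewrite -h; apply: funE => j; rewrite !vecE; ring.
Qed.

Variables (p q r : E).
Hypothesis ind : indep (q - p) (r - p).
Local Notation T := (tri p q r).

Lemma tri_inj : injective T.
Proof.
move=> z w zw; have [h1 h2] : z.1 - w.1 = 0 /\ z.2 - w.2 = 0.
  apply: ind; apply: funE => j; have := congr1 (fun f => f j) zw.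
  by rewrite /tri !vecE; lra.
by rewrite [z]surjective_pairing [w]surjective_pairing; congr pair; lra.
Qed.

Definition det3 (ca cb cc : plane) : R :=
  (cb.1 - ca.1) * (cc.2 - ca.2) - (cb.2 - ca.2) * (cc.1 - ca.1).

Lemma det3_neq0 (s : {fset E}) ca cb cc : affinely_independent s ->
  T ca \in s -> T cb \in s -> T cc \in s ->
  ca != cb -> ca != cc -> cb != cc -> det3 ca cb cc != 0.
Proof.
move=> ai ain bin cin ab ac bc; apply/eqP => D0.
have neq (z w : plane) : z != w -> T z != T w.
  by move=> zw; apply: contra zw => /eqP /tri_inj ->.
have rel := affine_indep3 ai ain bin cin (neq _ _ ab) (neq _ _ ac) (neq _ _ bc).
have main (u v : R) : u * (cb.1 - ca.1) + v * (cc.1 - ca.1) = 0 ->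
    u * (cb.2 - ca.2) + v * (cc.2 - ca.2) = 0 -> u = 0 /\ v = 0.
  move=> h1 h2; have [||_ -> ->//] := rel (- u - v) u v; first by ring.
  apply: funE => j; rewrite /tri !vecE.
  transitivity ((u * (cb.1 - ca.1) + v * (cc.1 - ca.1)) * (q j - p j) +
                (u * (cb.2 - ca.2) + v * (cc.2 - ca.2)) * (r j - p j)); first by ring.
  by rewrite h1 h2 !mul0r addr0.
have [||_ /eqP] := main (cc.1 - ca.1) (- (cb.1 - ca.1)); first by ring.
  by move: D0; rewrite /det3; lra.
rewrite oppr_eq0 subr_eq0 => /eqP e1.
have [||_ /eqP] := main (cc.2 - ca.2) (- (cb.2 - ca.2)); first by move: D0; rewrite /det3; lra.
  by ring.
rewrite oppr_eq0 subr_eq0 => /eqP e2.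
by move/eqP: ab; apply; rewrite [LHS]surjective_pairing [RHS]surjective_pairing e1 e2.
Qed.

(** Barycentric coordinate of [z] at [ca], up to the factor [det3 ca cb cc]. *)
Definition side_line (cb cc : plane) : line :=
  (cb.2 - cc.2, cc.1 - cb.1, cb.1 * cc.2 - cb.2 * cc.1).

Lemma is_line_side cb cc : cb != cc -> is_line (side_line cb cc).
Proof.
move=> h; rewrite /is_line /= !subr_eq0; apply: contrapT => /not_orP[/negP h1 /negP h2].
move: h; rewrite !negbK in h1 h2; rewrite [cb]surjective_pairing [cc]surjective_pairing.
by rewrite (eqP h1) (eqP h2) eqxx.
Qed.

Lemma ev_side_det ca cb cc : ev (side_line cb cc) ca = det3 ca cb cc.
Proof. by rewrite /ev /lin /side_line /det3 /=; ring. Qed.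

Lemma ev_sidel cb cc : ev (side_line cb cc) cb = 0.
Proof. by rewrite /ev /lin /side_line /=; ring. Qed.

Lemma ev_sider cb cc : ev (side_line cb cc) cc = 0.
Proof. by rewrite /ev /lin /side_line /=; ring. Qed.

Lemma tri_comb ca cb cc (k1 k2 k3 : R) : k1 + k2 + k3 = 1 ->
  k1 *: T ca + k2 *: T cb + k3 *: T cc =
  T (k1 * ca.1 + k2 * cb.1 + k3 * cc.1, k1 * ca.2 + k2 * cb.2 + k3 * cc.2).
Proof.
move=> k; have -> : k1 = 1 - k2 - k3 by lra.
by apply: funE => j; rewrite /tri !vecE /=; ring.
Qed.

Lemma ev_comb l ca cb cc (k1 k2 k3 : R) : k1 + k2 + k3 = 1 ->
  ev l (k1 * ca.1 + k2 * cb.1 + k3 * cc.1, k1 * ca.2 + k2 * cb.2 + k3 * cc.2) =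
  k1 * ev l ca + k2 * ev l cb + k3 * ev l cc.
Proof.
move=> k; have k1E : k1 = 1 - k2 - k3 by lra.
by rewrite k1E /ev /lin /=; ring.
Qed.

Lemma side_bary ca cb cc z : det3 ca cb cc != 0 ->
  z = (let D := det3 ca cb cc in
       let k1 := ev (side_line cb cc) z / D in
       let k2 := ev (side_line cc ca) z / D in
       let k3 := ev (side_line ca cb) z / D in
       (k1 * ca.1 + k2 * cb.1 + k3 * cc.1, k1 * ca.2 + k2 * cb.2 + k3 * cc.2)) /\
  ev (side_line cb cc) z / det3 ca cb cc + ev (side_line cc ca) z / det3 ca cb cc +
  ev (side_line ca cb) z / det3 ca cb cc = 1.
Proof.
move=> D0; have D0' := D0; rewrite /det3 in D0'; split.
  rewrite {1}[z]surjective_pairing /=; congr pair;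
    by rewrite /ev /lin /side_line /det3 /=; field; exact: D0'.
by rewrite /ev /lin /side_line /det3 /=; field; exact: D0'.
Qed.

Definition affine_on (f : E -> E) z v w e : Prop := exists o u u' : E,
  forall s t, range_ge0 e s t -> f (T (hp z v w s t)) = o + s *: u + t *: u'.

Definition misses (ls : seq line) z v w e : Prop := forall l s t,
  l \in ls -> range_gt0 e s t -> ev l (hp z v w s t) != 0.

(** The sides of a simplex on which [f] is linear: a half-open rectangle that
    misses them and has a point in the simplex lies in it. *)
Lemma simplex_lines (s' : {fset E}) f : affinely_independent s' ->
  linear_on_simplex s' f -> (forall x, x \in s' -> exists cx : plane, x = T cx) ->
  exists ls : seq line, (forall l, l \in ls -> is_line l) /\
    forall z v w e, 0 < e -> misses ls z v w e ->
      simplex_hull s' (T (hp z v w 0 e)) -> affine_on f z v w e.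
Proof.
move=> ai lf; have us : uniq s' by exact: fset_uniq.
have mem x : (x \in s') = (x \in enum_fset s') by [].
have hullE x : simplex_hull s' x -> exists l : E -> R, [/\ forall y, 0 <= l y,
   \sum_(y <- enum_fset s') l y = 1 & x = \sum_(y <- enum_fset s') l y *: y] by [].
have r0e e : 0 < e -> range_gt0 e 0 e.
  by move=> e0; split; [rewrite normr0 ltW|rewrite e0 lexx].
move: us mem hullE; case E0 : (enum_fset s') => [|a [|b [|c rest]]] us mem hullE vert.
- exists nil; split => // z v w e _ _ /hullE[l [_ + _]].
  by rewrite big_nil => /eqP; rewrite eq_sym oner_eq0.
- have ain : a \in s' by rewrite mem mem_head.
  have [ca aE] := vert a ain.
  exists [:: (1, 0, - ca.1)]; split.
    by move=> l; rewrite inE => /eqP ->; left; rewrite /= oner_neq0.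
  move=> z v w e e0 ms /hullE[l [_]]; rewrite !big_seq1 => -> {}; rewrite scale1r aE.
  move=> /tri_inj h; have := ms _ 0 e (mem_head _ _) (r0e e e0).
  by rewrite h /ev /lin /= mul1r mul0r addr0 subrr eqxx.
- have ain : a \in s' by rewrite mem !inE eqxx.
  have bin : b \in s' by rewrite mem !inE eqxx orbT.
  have [ca aE] := vert a ain; have [cb bE] := vert b bin.
  have ab : ca != cb.
    move: us => /= /andP[+ _]; rewrite inE; apply: contra => /eqP h.
    by rewrite aE bE h.
  exists [:: side_line ca cb]; split.
    by move=> l; rewrite inE => /eqP ->; exact: is_line_side.
  move=> z v w e e0 ms /hullE[l [l0]]; rewrite !big_cons !big_nil !addr0 => l1.
  have := @tri_comb ca cb cb (l a) (l b) 0; rewrite addr0 scale0r addr0 -aE -bE => /(_ l1) ->.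
  move=> /tri_inj h; have := ms _ 0 e (mem_head _ _) (r0e e e0).
  rewrite h ev_comb; last by rewrite addr0.
  by rewrite ev_sidel ev_sider !mulr0 !addr0 eqxx.
have ain : a \in s' by rewrite mem !inE eqxx.
have bin : b \in s' by rewrite mem !inE eqxx orbT.
have cin : c \in s' by rewrite mem !inE eqxx !orbT.
have [ca aE] := vert a ain; have [cb bE] := vert b bin; have [cc cE] := vert c cin.
have [ab ac bc] : [/\ ca != cb, ca != cc & cb != cc].
  have /= /and3P[n1 n2 _] := us; split.
  - by apply: contra n1 => /eqP e; rewrite aE e -bE mem_head.
  - by apply: contra n1 => /eqP e; rewrite aE e -cE in_cons mem_head orbT.
  - by apply: contra n2 => /eqP e; rewrite bE e -cE mem_head.
have D0 : det3 ca cb cc != 0.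
  by apply: (det3_neq0 ai) => //; rewrite -?aE -?bE -?cE.
(* four points of a plane are affinely dependent *)
case: rest E0 us mem hullE => [|d rest] E0 us mem hullE; last first.
  have din : d \in s' by rewrite mem !inE eqxx !orbT.
  have [cd dE] := vert d din; have [/= zE k1] := side_bary cd D0.
  have := @affine_relation s' a b c d _ _ _ (- 1) ai ain bin cin din.
  move=> /(_ (ev (side_line cb cc) cd / det3 ca cb cc)
             (ev (side_line cc ca) cd / det3 ca cb cc)
             (ev (side_line ca cb) cd / det3 ca cb cc)).
  rewrite k1 subrr => /(_ erefl); rewrite aE bE cE tri_comb// -zE -dE scaleN1r subrr.
  move=> /(_ erefl d din); rewrite -aE -bE -cE /delta4.
  have /= /and4P[m1 m2 m3 _] := us.
  have da : (d == a) = false.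
    by apply/negbTE; apply: contra m1 => /eqP <-; rewrite !in_cons eqxx !orbT.
  have db : (d == b) = false.
    by apply/negbTE; apply: contra m2 => /eqP <-; rewrite !in_cons eqxx !orbT.
  have dc : (d == c) = false.
    by apply/negbTE; apply: contra m3 => /eqP <-; rewrite !in_cons eqxx.
  rewrite da db dc eqxx !mulr0 mulr1 !add0r => /eqP; by rewrite oppr_eq0 oner_eq0.
set ls := [:: side_line cb cc; side_line cc ca; side_line ca cb].
exists ls; split.
  by move=> l; rewrite !inE => /or3P[] /eqP ->; apply: is_line_side => //; rewrite eq_sym.
move=> z v w e e0 ms /hullE[l [l0]]; rewrite !big_cons !big_nil !addr0 => l1.
rewrite addrA in l1; rewrite addrA.
have := tri_comb ca cb cc l1; rewrite -aE -bE -cE => -> /tri_inj h.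
set D := det3 ca cb cc in D0.
pose k1 (y : plane) := ev (side_line cb cc) y / D.
pose k2 (y : plane) := ev (side_line cc ca) y / D.
pose k3 (y : plane) := ev (side_line ca cb) y / D.
have kE l' s t : ev l' (hp z v w s t) / D =
    ev l' z / D + s * (lin l' v / D) + t * (lin l' w / D).
  by rewrite ev_hp; ring.
have pos l' : l' \in ls -> 0 <= ev l' (hp z v w 0 e) / D ->
    forall s t, range_ge0 e s t -> 0 <= ev l' (hp z v w s t) / D.
  move=> l'l p0 s t rst; rewrite kE; apply: affine_sign (e0) _ _ s t rst => [s t rst|].
    by rewrite -kE mulf_neq0 ?invr_neq0//; exact: ms.
  by move: p0; rewrite kE mul0r addr0.
have ld : det3 cb cc ca = D by rewrite /D /det3; ring.
have ld' : det3 cc ca cb = D by rewrite /D /det3; ring.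
have p1 : 0 <= k1 (hp z v w 0 e).
  by rewrite /k1 h ev_comb// ev_sidel ev_sider ev_side_det !mulr0 !addr0 mulfK.
have p2 : 0 <= k2 (hp z v w 0 e).
  by rewrite /k2 h ev_comb// ev_sidel ev_sider ev_side_det ld !mulr0 add0r addr0 mulfK.
have p3 : 0 <= k3 (hp z v w 0 e).
  by rewrite /k3 h ev_comb// ev_sidel ev_sider ev_side_det ld' !mulr0 !add0r mulfK.
exists (k1 z *: f a + k2 z *: f b + k3 z *: f c).
exists ((lin (side_line cb cc) v / D) *: f a + (lin (side_line cc ca) v / D) *: f b +
        (lin (side_line ca cb) v / D) *: f c).
exists ((lin (side_line cb cc) w / D) *: f a + (lin (side_line cc ca) w / D) *: f b +
        (lin (side_line ca cb) w / D) *: f c).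
move=> s t rst; set y := hp z v w s t.
have [/= yE ksum] := side_bary y D0; rewrite -/D in ksum.
have q1 : 0 <= k1 y by apply: pos => //; rewrite !inE eqxx.
have q2 : 0 <= k2 y by apply: pos => //; rewrite !inE eqxx orbT.
have q3 : 0 <= k3 y by apply: pos => //; rewrite !inE eqxx !orbT.
pose lam := delta4 a b c a (k1 y) (k2 y) (k3 y) 0.
have sumE (V : lmodType R) (F : E -> V) : \sum_(x <- s') lam x *: F x =
    k1 y *: F a + k2 y *: F b + k3 y *: F c.
  by rewrite sum_delta4// scale0r addr0.
have TyE : T y = \sum_(x <- s') lam x *: x.
  by rewrite (sumE _ id) [in LHS]yE -tri_comb// -aE -bE -cE.
rewrite TyE lf; first 1 last.
- by move=> x; rewrite /lam /delta4 mul0r addr0 !addr_ge0// mulr_ge0.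
- transitivity (\sum_(x <- s') lam x *: (1 : R^o)).
    by apply: eq_bigr => x _; rewrite /GRing.scale /= mulr1.
  by rewrite sumE /GRing.scale /= !mulr1.
rewrite sumE /k1 /k2 /k3 /y !kE; apply: funE => j; rewrite !vecE; ring.
Qed.

End SimplexLines.

(** * Germs at a side *)

Section Germs.
Variables (R : realType) (J : Type) (M : topologicalType).
Local Notation E := (J -> R).
Implicit Types (x v w : E) (m : M) (s t e d b : R).

Variables (K : set {fset E}) (phi : M -> E) (psi : E -> M).
Hypothesis md : model K phi psi.

Definition pt x v w s t : E := x + s *: v + t *: w.

Lemma psi_inj y y' : polyhedron K y -> polyhedron K y' -> psi y = psi y' -> y = y'.
Proof. by move=> h h' /(congr1 phi); rewrite !(model_psiK md). Qed.

Lemma phi_inj : injective phi.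
Proof. by move=> m m' /(congr1 psi); rewrite !(model_phiK md). Qed.

(** A side: a rectangle in the polyhedron, spanned at [x] by [v] in both
    directions and by [w] in one. *)
Record side x v w e : Prop := {
  side_pos : 0 < e;
  side_indep : indep v w;
  side_poly : forall s t, range_ge0 e s t -> polyhedron K (pt x v w s t) }.

Lemma pt_inj x v w s t s' t' : indep v w -> pt x v w s t = pt x v w s' t' ->
  s = s' /\ t = t'.
Proof.
move=> ind h; have [h1 h2] : s - s' = 0 /\ t - t' = 0.
  apply: ind; apply: funE => j; have := congr1 (fun f => f j) h.
  by rewrite /pt !vecE; lra.
by split; lra.
Qed.

Lemma side_inj x v w e s t s' t' : side x v w e ->
  range_ge0 e s t -> range_ge0 e s' t' ->
  psi (pt x v w s t) = psi (pt x v w s' t') -> s = s' /\ t = t'.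
Proof.
move=> [_ ind po] h h' /psi_inj e'; apply: (@pt_inj x v w) => //.
by apply: e'; exact: po.
Qed.

(** [a] fixes the line through [x] along [v], preserves the side near [x], and is
    linear there with slopes [d] and [b]. *)
Definition germ (a : homeo M) x v w d b : Prop := 0 < d /\
  exists2 e, 0 < e & forall s t, range_ge0 e s t ->
    a (psi (pt x v w s t)) = psi (pt x v w (s + b * t) (d * t)).

Section OneSide.
Variables (x v w : E) (e0 : R).
Hypothesis sd : side x v w e0.
Local Notation germ a d b := (germ a x v w d b).

(** Rectangles small enough to be mapped into a given one. *)
Lemma shrink e d b : 0 < e -> 0 < d -> exists2 e', 0 < e' & e' <= e /\
  forall s t, range_ge0 e' s t -> range_ge0 e (s + b * t) (d * t).
Proof.
move=> e_0 d0; pose k := 1 + `|b| + d.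
have k1 : 1 <= k by rewrite /k; have := normr_ge0 b; lra.
have k0 : 0 < k by lra.
have [f f0 fE] : exists2 f, 0 < f & f + f * `|b| + f * d = e.
  exists (e / k); first by rewrite divr_gt0.
  by rewrite /k; field; rewrite gt_eqF.
have b0 : 0 <= f * `|b| by rewrite mulr_ge0// ltW.
have fd : 0 < f * d by rewrite mulr_gt0.
exists f => //; split; first by lra.
move=> s t [hs /andP[t0 te]]; split; last first.
  by apply/andP; split; [rewrite mulr_ge0// ltW|have := ler_wpM2l (ltW d0) te; lra].
apply: le_trans (ler_normD _ _) _; rewrite normrM (ger0_norm t0).
by have := ler_wpM2l (normr_ge0 b) te; lra.
Qed.

Lemma range_ge0W e e' s t : e <= e' -> range_ge0 e s t -> range_ge0 e' s t.
Proof.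
move=> ee [h1 /andP[h2 h3]]; split; first exact: le_trans ee.
by rewrite h2 (le_trans h3).
Qed.

Lemma germ1 : germ 1%g 1 0.
Proof. by split; [exact: ltr01|exists 1 => // s t _; rewrite mul0r addr0 mul1r]. Qed.

Lemma germM (a a' : homeo M) d b d' b' : germ a d b -> germ a' d' b' ->
  germ (a * a')%g (d * d') (b' + b * d').
Proof.
move=> [d0 [e e_0 eP]] [d'0 [e' e'0 e'P]]; split; first exact: mulr_gt0.
have [f f0 [fe fP]] := shrink b' e_0 d'0.
exists (Num.min f e'); first by rewrite lt_min f0.
move=> s t r; have r1 : range_ge0 f s t.
  by apply: range_ge0W r; rewrite ge_min lexx.
have r2 : range_ge0 e' s t.
  by apply: range_ge0W r; rewrite ge_min lexx orbT.
change (a (a' (psi (pt x v w s t))) =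
  psi (pt x v w (s + (b' + b * d') * t) (d * d' * t))).
by rewrite e'P// eP; [congr (psi (pt x v w _ _)); ring|exact: fP].
Qed.

Lemma germV (a : homeo M) d b : germ a d b -> germ (a^-1)%g d^-1 (- (b / d)).
Proof.
move=> [d0 [e e_0 eP]]; split; first by rewrite invr_gt0.
have [|f f0 [fe fP]] := @shrink e d^-1 (- (b / d)) e_0; first by rewrite invr_gt0.
exists f => // s t r; have := eP _ _ (fP s t r).
have -> : s + - (b / d) * t + b * (d^-1 * t) = s by ring.
have -> : d * (d^-1 * t) = t by rewrite mulVKf// gt_eqF.
by move=> <-; exact: homeo_funK.
Qed.

Lemma germ_uniq (a : homeo M) d b d' b' : germ a d b -> germ a d' b' ->
  d = d' /\ b = b'.
Proof.
move=> [d0 [e e_0 eP]] [d'0 [e' e'0 e'P]].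
have [f f0 [fe fP]] := shrink b (side_pos sd) d0.
have [f' f'0 [fe' fP']] := shrink b' (side_pos sd) d'0.
pose t := Num.min (Num.min e e') (Num.min f f').
have t0 : 0 < t by rewrite !lt_min e_0 e'0 f0.
have rg g : t <= g -> range_ge0 g 0 t.
  by move=> tg; split; [rewrite normr0 (le_trans (ltW t0))|rewrite ltW].
have te : t <= e by rewrite !ge_min lexx.
have te' : t <= e' by rewrite !ge_min lexx !orbT.
have tf : t <= f by rewrite !ge_min lexx !orbT.
have tf' : t <= f' by rewrite !ge_min lexx !orbT.
have := eP 0 t (rg _ te); rewrite (e'P 0 t (rg _ te')).
move=> /(side_inj sd (fP' _ _ (rg _ tf')) (fP _ _ (rg _ tf))) [h1 h2].
have tn : t != 0 by rewrite gt_eqF.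
by split; apply: (mulIf tn); lra.
Qed.

Definition germ_gt0 (a : homeo M) : Prop :=
  exists d b, germ a d b /\ (1 < d \/ d = 1 /\ 0 < b).

(** Germs at a side form an affine group, which is ordered. *)
Lemma germ_signs (A : seq (homeo M)) :
  (forall a, a \in A -> exists d b, germ a d b) ->
  (exists2 a, a \in A & ~ germ a 1 0) ->
  exists pos null, sign_pair A pos null.
Proof.
move=> Ag [a1 a1A a1n]; exists germ_gt0, (fun a => germ a 1 0); split.
- move=> g h [d [b [gg dg]]] [d' [b' [gh dh]]].
  exists (d * d'), (b' + b * d'); split; first exact: germM.
  have [p1 _] := gg; have [p2 _] := gh.
  case: dg dh => [d1|[-> b0]] [d'1|[-> b'0]].
  + by left; nra.
  + by left; rewrite mulr1.
  + by left; rewrite mul1r.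
  + by right; rewrite !mulr1; split => //; lra.
- move=> g h [d [b [gg dg]]] gh; exists d, b; split => //.
  by have := germM gg gh; rewrite !mulr1 add0r.
- move=> g h gg [d [b [gh dh]]]; exists d, b; split => //.
  by have := germM gg gh; rewrite mul1r mul0r addr0.
- by move=> g h gg gh; have := germM gg gh; rewrite !mul1r mul0r addr0.
- by move=> g /germV; rewrite invr1 mul0r oppr0.
- move=> [d [b [g1 h]]]; have [d1 b0] := germ_uniq g1 germ1.
  by case: h => [|[_]]; rewrite ?d1 ?b0 ltxx.
- move=> a aA; have [d [b ga]] := Ag a aA; have [d0 _] := ga.
  have gV := germV ga; have [d1|d1|d1] := ltgtP d 1.
  + by constructor 2; exists d^-1, (- (b / d)); split => //; left; rewrite invf_gt1.
  + by constructor 1; exists d, b; split => //; left.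
  have [b1|b1|b1] := ltgtP b 0.
  + constructor 2; exists d^-1, (- (b / d)); split => //; right.
    by rewrite d1 !invr1 mulr1; split => //; lra.
  + by constructor 1; exists d, b; split => //; right.
  + by constructor 3; rewrite -d1 -b1.
- by exists a1.
Qed.

End OneSide.
End Germs.

(** * Spreading a coincidence across an edge *)

Section Extension.
Variables (R : realType) (J : Type) (M : topologicalType).
Local Notation E := (J -> R).
Local Notation plane := (R * R)%type.
Implicit Types (x v w : E) (m : M) (s t e d b : R) (z : plane).

Variables (K : set {fset E}) (phi : M -> E) (psi : E -> M).
Hypothesis md : model K phi psi.

Local Notation side := (side K).
Local Notation germ := (germ psi).

(** Stated through [phi], since the values of [h] may lie in any simplex. *)
Definition side_affine (h : homeo M) x v w e : Prop := exists o u u' : E,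
  forall s t, range_ge0 e s t -> phi (h (psi (pt x v w s t))) = o + s *: u + t *: u'.

Definition half_nbhd x v w e : set M :=
  [set m | exists s t, [/\ `|s| < e, 0 <= t, t < e & m = psi (pt x v w s t)]].

(** One side at a boundary point, two sides with a common edge otherwise. *)
Record sides (two : bool) x v w1 w2 e : Prop := {
  sides1 : side x v w1 e;
  sides2 : side x v w2 e;
  sides_cont1 : {within [set z : plane | range_ge0 e z.1 z.2],
    continuous (fun z => psi (pt x v w1 z.1 z.2))};
  sides_cont2 : {within [set z : plane | range_ge0 e z.1 z.2],
    continuous (fun z => psi (pt x v w2 z.1 z.2))};
  sides_open : open (half_nbhd x v w1 e `|` half_nbhd x v w2 e);
  sides_one : ~~ two -> w1 = w2;
  sides_sep : two -> forall s t s' t', range_ge0 e s t -> range_ge0 e s' t' ->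
    pt x v w1 s t = pt x v w2 s' t' -> t = 0 /\ t' = 0 }.

Lemma sides_sym two x v w1 w2 e : sides two x v w1 w2 e -> sides two x v w2 w1 e.
Proof.
move=> [s1 s2 c1 c2 o one sep]; split => //.
- by rewrite setUC.
- by move=> /one.
- by move=> tw s t s' t' r r' /esym /(sep tw _ _ _ _ r' r)[].
Qed.

Lemma affine_agree (o u w o' u' w' : E) s t k : 0 < k ->
  o + s *: u + t *: w = o' + s *: u' + t *: w' ->
  o + (s + k) *: u + t *: w = o' + (s + k) *: u' + t *: w' ->
  o + s *: u + (t + k) *: w = o' + s *: u' + (t + k) *: w' ->
  [/\ o = o', u = u' & w = w'].
Proof.
move=> k0 h1 h2 h3; have kn : k != 0 by rewrite gt_eqF.
have uE : u = u'.
  apply: funE => j; have := congr1 (fun f => f j) h1; have := congr1 (fun f => f j) h2.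
  by rewrite !vecE => e2 e1; apply: (mulfI kn); lra.
have wE : w = w'.
  apply: funE => j; have := congr1 (fun f => f j) h1; have := congr1 (fun f => f j) h3.
  by rewrite !vecE => e2 e1; apply: (mulfI kn); lra.
split=> //; apply: funE => j; have := congr1 (fun f => f j) h1.
by rewrite uE wE !vecE; lra.
Qed.

Lemma pt00 x v w : pt x v w 0 0 = x.
Proof. by rewrite /pt !scale0r !addr0. Qed.

Lemma pt_line x v w w' s : pt x v w s 0 = pt x v w' s 0.
Proof. by rewrite /pt !scale0r. Qed.

(** If [g] and [h] are affine on a side and agree on its edge, then one point of
    the side that [g^-1 h] keeps in the side forces a germ. *)
Lemma germ_of_affine (g h : homeo M) x v w e (o u u1 u2 : E) dl s' t' :
  side x v w e ->
  (forall s t, range_ge0 e s t -> phi (g (psi (pt x v w s t))) = o + s *: u + t *: u1) ->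
  (forall s t, range_ge0 e s t -> phi (h (psi (pt x v w s t))) = o + s *: u + t *: u2) ->
  0 < dl -> dl <= e -> range_ge0 e s' t' -> 0 < t' ->
  (g^-1 * h)%g (psi (pt x v w 0 dl)) = psi (pt x v w s' t') ->
  exists d b, germ (g^-1 * h)%g x v w d b /\ (d = 1 -> b = 0 -> u1 = u2).
Proof.
move=> sd ga ha d0 de r' t'0 aE.
have r0 : range_ge0 e 0 dl.
  by split; [rewrite normr0 (le_trans (ltW d0))|rewrite (ltW d0)].
have hE : h (psi (pt x v w 0 dl)) = g (psi (pt x v w s' t')).
  by rewrite -aE; apply/esym; exact: homeo_invK.
have dn : dl != 0 by rewrite gt_eqF.
have u2E : u2 = (s' / dl) *: u + (t' / dl) *: u1.
  have := congr1 phi hE; rewrite ga// ha// => e1; apply: funE => j.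
  have := congr1 (fun f => f j) e1; rewrite !vecE => e2; apply: (mulfI dn).
  transitivity (s' * u j + t' * u1 j); first by lra.
  by field.
exists (t' / dl), (s' / dl); split; last first.
  by move=> d1 b0; rewrite u2E d1 b0 scale0r add0r scale1r.
split; first by rewrite divr_gt0.
have td0 : 0 < t' / dl by rewrite divr_gt0.
have [f f0 [fe fP]] := shrink (s' / dl) (side_pos sd) td0.
exists f => // s t r; have rs : range_ge0 e s t by exact: range_ge0W fe r.
have -> : psi (pt x v w (s + s' / dl * t) (t' / dl * t)) =
    (g^-1)%g (g (psi (pt x v w (s + s' / dl * t) (t' / dl * t)))).
  by apply/esym; exact: homeo_funK.
change ((g^-1)%g (h (psi (pt x v w s t))) =
  (g^-1)%g (g (psi (pt x v w (s + s' / dl * t) (t' / dl * t))))).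
congr ((g^-1)%g _); apply: (phi_inj md); rewrite ha// ga; last exact: fP.
by rewrite u2E; apply: funE => j; rewrite !vecE; ring.
Qed.

Variable P : seq (homeo M * homeo M).

Definition quotients : seq (homeo M) := [seq (gh.1^-1 * gh.2)%g | gh <- P].

Definition coincidence : set M := [set m | forall gh, gh \in P -> gh.1 m = gh.2 m].

(** What remains when no side gives signs for the list of quotients. *)
Definition trivial_germs : Prop := forall x v w e, side x v w e ->
  (forall a, a \in quotients -> exists d b, germ a x v w d b) ->
  forall a, a \in quotients -> germ a x v w 1 0.

Lemma coincidence_fix gh m : gh \in P -> coincidence m -> (gh.1^-1 * gh.2)%g m = m.
Proof.
move=> ghP /(_ gh ghP) e; change ((gh.1^-1)%g (gh.2 m) = m).
by rewrite -e; exact: homeo_funK.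
Qed.

Hypothesis trivG : trivial_germs.

(** By continuity [a] maps points of the side close to the fixed point [x] into [U]. *)
Lemma reach (a : homeo M) x v w (U : set M) e : side x v w e -> open U -> U (psi x) ->
  a (psi x) = psi x ->
  {within [set z : plane | range_ge0 e z.1 z.2],
    continuous (fun z => psi (pt x v w z.1 z.2))} ->
  exists2 dl, 0 < dl & dl <= e /\ U (a (psi (pt x v w 0 dl))).
Proof.
move=> [e0 _ _] oU Ux ax cw.
have nU : nbhs (psi x) (fun m => U (a m)).
  by apply: (homeo_fun_cont (h := a)); rewrite ax; exact: open_nbhs_nbhs.
have r00 : range_ge0 e 0 0 by split; rewrite ?normr0 ?lexx ltW.
have /nbhs_plane[dl d0 dP] : \forall z \near (0 : R, 0 : R),
    range_ge0 e z.1 z.2 -> U (a (psi (pt x v w z.1 z.2))).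
  have nU' : nbhs (psi (pt x v w 0 0)) (fun m => U (a m)) by rewrite pt00.
  exact: (@within_near _ _ _ _ (0, 0) _ cw r00 nU').
pose k := Num.min (dl / 2) e.
have k0 : 0 < k by rewrite lt_min e0 divr_gt0.
have ke : k <= e by rewrite ge_min lexx orbT.
have kd : k < dl by apply: (@le_lt_trans _ _ (dl / 2)); [rewrite ge_min lexx|lra].
exists k => //; split => //; apply: (dP (0, k)) => /=.
- by rewrite subrr normr0.
- by rewrite subr0 gtr0_norm.
- by split; rewrite ?normr0 ltW.
Qed.

(** If the edge is fixed and each [g^-1 h] maps the points of the side near [x]
    back into the side, then [g^-1 h] has a germ there. Its germ is trivial, that
    is, [g] and [h] are the same affine map on the side. *)
Lemma coincidence_on_side x v w e (U : set M) : side x v w e ->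
  {within [set z : plane | range_ge0 e z.1 z.2],
    continuous (fun z => psi (pt x v w z.1 z.2))} ->
  open U -> U (psi x) ->
  (forall gh, gh \in P -> side_affine gh.1 x v w e /\ side_affine gh.2 x v w e) ->
  (forall s, `|s| <= e -> coincidence (psi (pt x v w s 0))) ->
  (forall gh t, gh \in P -> 0 < t -> t <= e ->
     U ((gh.1^-1 * gh.2)%g (psi (pt x v w 0 t))) ->
     half_nbhd x v w e ((gh.1^-1 * gh.2)%g (psi (pt x v w 0 t)))) ->
  forall s t, range_ge0 e s t -> coincidence (psi (pt x v w s t)).
Proof.
move=> sd cw oU Ux aff line stay; have e0 := side_pos sd.
have Cx : coincidence (psi x).
  by rewrite -(pt00 x v w); apply: line; rewrite normr0 ltW.
have key gh : gh \in P -> exists d b, germ (gh.1^-1 * gh.2)%g x v w d b /\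
    (d = 1 -> b = 0 -> forall s' t', range_ge0 e s' t' ->
       gh.1 (psi (pt x v w s' t')) = gh.2 (psi (pt x v w s' t'))).
  move=> ghP; have [[o1 [u1 [v1 g1]]] [o2 [u2 [v2 g2]]]] := aff gh ghP.
  have r00 : range_ge0 e 0 0 by split; rewrite ?normr0 ?lexx ltW.
  have [oE uE] : o1 = o2 /\ u1 = u2.
    have rs0 : range_ge0 e e 0 by split; [rewrite gtr0_norm|rewrite lexx ltW].
    have l0 : o1 = o2.
      have := congr1 phi (line 0 _ gh ghP); rewrite normr0 (ltW e0) => /(_ isT).
      by rewrite g1// g2// !scale0r !addr0.
    split => //; have := congr1 phi (line e _ gh ghP); rewrite gtr0_norm// lexx => /(_ isT).
    rewrite g1// g2// !scale0r !addr0 l0 => /addrI e1; apply: funE => j.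
    by have := congr1 (fun f => f j) e1; rewrite !vecE => /(mulfI (lt0r_neq0 e0)).
  rewrite -oE -uE in g2.
  have [dl d0 [de dU]] := reach sd oU Ux (coincidence_fix ghP Cx) cw.
  have rd : range_ge0 e 0 dl by split; [rewrite normr0 ltW|rewrite ltW].
  have [s' [t' [h1 h2 h3 aE]]] := stay gh dl ghP d0 de dU.
  have r' : range_ge0 e s' t' by split; rewrite ?h2 ltW.
  have t'0 : 0 < t'.
    (* the edge is fixed, so a point off the edge is not mapped to it *)
    rewrite lt_neqAle h2 andbT eq_sym; apply/eqP => t0'; rewrite t0' in aE.
    have r0' : range_ge0 e s' 0 by split; rewrite ?lexx ltW.
    have := coincidence_fix ghP (line s' (ltW h1)); rewrite -{1}aE.
    rewrite -aE => /(can_inj (@homeo_funK _ _)); rewrite aE.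
    by move=> /(side_inj md sd r0' rd)[_ d00]; rewrite -d00 ltxx in d0.
  have [d [b [gd db]]] := germ_of_affine sd g1 g2 d0 de r' t'0 aE.
  exists d, b; split => // d1 b0 s'' t'' r''.
  by apply: (phi_inj md); rewrite g1// g2// (db d1 b0).
move=> s' t' r' gh ghP; have [d [b [gd same]]] := key gh ghP.
have tr : germ (gh.1^-1 * gh.2)%g x v w 1 0.
  apply: (trivG sd); last by apply/mapP; exists gh.
  by move=> a /mapP[gh' gh'P ->]; have [d' [b' [? _]]] := key gh' gh'P; exists d', b'.
by have [d1 b0] := germ_uniq md sd gd tr; apply: same.
Qed.

(** Fixing one side forces [g^-1 h] to keep the other, so it has a germ there;
    trivial germs then let the coincidence spread across the edge. *)
Lemma cross_edge two x v w1 w2 e s t : sides two x v w1 w2 e ->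
  (forall gh, gh \in P -> [/\ side_affine gh.1 x v w1 e, side_affine gh.2 x v w1 e,
     side_affine gh.1 x v w2 e & side_affine gh.2 x v w2 e]) ->
  `|s| < e -> 0 <= t -> t < e -> coincidence° (psi (pt x v w1 s t)) ->
  coincidence° (psi x).
Proof.
move=> sd aff se t0 te Cst; have [s1 s2 c1 c2 o one sep] := sd.
have e0 := side_pos s1.
have r00 : range_ge0 e 0 0 by split; rewrite ?normr0 ?lexx ltW.
have Ux : (half_nbhd x v w1 e `|` half_nbhd x v w2 e) (psi x).
  by left; exists 0, 0; split; rewrite ?normr0// pt00.
have rst : range_ge0 e s t by split; [exact: ltW|rewrite t0 ltW].
have /nbhs_plane[n n0 nP] : \forall z \near (s, t),
    range_ge0 e z.1 z.2 -> coincidence (psi (pt x v w1 z.1 z.2)).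
  exact: (@within_near _ _ _ _ (s, t) coincidence c1 rst Cst).
have [k k0 [k1 k2 k3]] : exists2 k, 0 < k & [/\ k < n, k <= e - `|s| & k <= e - t].
  exists (Num.min (n / 2) (Num.min (e - `|s|) (e - t))).
    by rewrite !lt_min divr_gt0// !subr_gt0 se.
  split; [|by rewrite !ge_min lexx ?orbT|by rewrite !ge_min lexx ?orbT].
  by apply: (@le_lt_trans _ _ (n / 2)); [rewrite ge_min lexx|lra].
have rk1 : range_ge0 e (s + k) t.
  by split; [have := ler_normD s k; rewrite (gtr0_norm k0); lra|rewrite t0 ltW].
have rk2 : range_ge0 e s (t + k).
  by split; [exact: ltW|apply/andP; split; lra].
have C1 : coincidence (psi (pt x v w1 s t)).
  by apply: (nP (s, t)); rewrite //= subrr normr0.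
have C2 : coincidence (psi (pt x v w1 (s + k) t)).
  by apply: (nP (s + k, t)) => //=; rewrite ?subrr ?normr0// addrAC subrr add0r gtr0_norm.
have C3 : coincidence (psi (pt x v w1 s (t + k))).
  by apply: (nP (s, t + k)) => //=; rewrite ?subrr ?normr0// addrAC subrr add0r gtr0_norm.
have side1 s' t' : range_ge0 e s' t' -> coincidence (psi (pt x v w1 s' t')).
  move=> r' gh ghP; have [[o1 [u1 [v1 g1]]] [o2 [u2 [v2 g2]]] _ _] := aff gh ghP.
  have [oE uE vE] : [/\ o1 = o2, u1 = u2 & v1 = v2].
    apply: (affine_agree k0 (s := s) (t := t)).
    - by rewrite -g1// -g2// C1.
    - by rewrite -g1// -g2// C2.
    - by rewrite -g1// -g2// C3.
  by apply: (phi_inj md); rewrite g1// g2// oE uE vE.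
have hn1 m : half_nbhd x v w1 e m -> coincidence m.
  by move=> [s' [t' [h1 h2 h3 ->]]]; apply: side1; split; rewrite ?h2 ltW.
have done2 : (forall s' t', range_ge0 e s' t' -> coincidence (psi (pt x v w2 s' t'))) ->
    coincidence° (psi x).
  move=> h2; apply: filterS (open_nbhs_nbhs (conj o Ux)) => m [/hn1//|].
  by move=> [s' [t' [h3 h4 h5 ->]]]; apply: h2; split; rewrite ?h4 ltW.
case: two sd one sep => [sd _ sep|sd one _]; last first.
  by apply: done2; rewrite -one.
have line s' : `|s'| <= e -> coincidence (psi (pt x v w2 s' 0)).
  by move=> h; rewrite (pt_line x v w2 w1); apply: side1; split => //; rewrite lexx ltW.
apply: done2; apply: (coincidence_on_side s2 c2 o Ux) => //.
  by move=> gh /aff[].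
move=> gh dl ghP d0 de [] // [s' [t' [h1 h2 h3 aE]]].
have r' : range_ge0 e s' t' by split; rewrite ?h2 ltW.
have rd : range_ge0 e 0 dl by split; [rewrite normr0 ltW|rewrite ltW].
have po := @side_poly _ _ _ _ _ _ _ s2; have po1 := @side_poly _ _ _ _ _ _ _ s1.
have := coincidence_fix ghP (side1 _ _ r'); rewrite -aE.
move=> /(can_inj (@homeo_funK _ _)); rewrite aE.
move=> /(psi_inj md (po1 _ _ r') (po _ _ rd)).
by move=> /(sep isT _ _ _ _ r' rd)[_ d00]; rewrite d00 ltxx in d0.
Qed.

(** Near a boundary edge that is fixed pointwise there is only one side, which
    every [g^-1 h] has to keep. *)
Lemma start_edge x v w e : sides false x v w w e ->
  (forall gh, gh \in P -> side_affine gh.1 x v w e /\ side_affine gh.2 x v w e) ->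
  (forall s, `|s| <= e -> coincidence (psi (pt x v w s 0))) ->
  coincidence° (psi x).
Proof.
move=> sd aff line; have [s1 _ c1 _ o _ _] := sd.
rewrite setUid in o; have e0 := side_pos s1.
have Ux : half_nbhd x v w e (psi x).
  by exists 0, 0; split; rewrite ?normr0// pt00.
have Cs := coincidence_on_side s1 c1 o Ux aff line (fun _ _ _ _ _ => id).
apply: filterS (open_nbhs_nbhs (conj o Ux)) => _ [s [t [h1 h2 h3 ->]]].
by apply: Cs; split; rewrite ?h2 ltW.
Qed.

End Extension.

(** * Tame points of edges *)

Section Tame.
Variables (R : realType) (J : Type) (M : topologicalType).
Local Notation E := (J -> R).
Local Notation plane := (R * R)%type.
Local Notation line := (R * R * R)%type.
Implicit Types (p q r x : E) (m : M) (s t e c : R) (z v w : plane).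

Variables (K : set {fset E}) (phi : M -> E) (psi : E -> M).
Hypothesis md : model K phi psi.

Local Notation mt := (mtri psi).
Local Notation bary := (bary K phi).
Local Notation page := (page K).
Local Notation rho := (rho K phi).
Local Notation side := (side K).
Local Notation sides := (sides K psi).
Local Notation side_affine := (side_affine phi psi).
Local Notation half_nbhd := (half_nbhd psi).

Definition PL_homeo (h : homeo M) : Prop :=
  exists2 f : E -> E, PL_map K f & forall m, phi (h m) = f (phi m).

Definition dir p q r v : E := v.1 *: (q - p) + v.2 *: (r - p).

Lemma tri_hp p q r z v w s t :
  tri p q r (hp z v w s t) = pt (tri p q r z) (dir p q r v) (dir p q r w) s t.
Proof. by apply: funE => j; rewrite /tri /hp /pt /dir !vecE /=; ring. Qed.

Lemma simplex_indep p q r : K [fset p; q; r]%fset -> p != q -> p != r -> q != r ->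
  indep (q - p) (r - p).
Proof.
move=> Ks pq pr qr; have [/(_ _ Ks)[_ ai] _ _] := model_complex md.
by apply: (indep_simplex ai) => //; rewrite !in_fsetE eqxx ?orbT.
Qed.

Lemma vertex_hull (s : {fset E}) x : x \in s -> simplex_hull s x.
Proof.
move=> xs; exists (fun y => (y == x)%:R); split.
- by move=> y; exact: ler0n.
- transitivity (\sum_(y <- s) (y == x)%:R *: (1 : R^o)).
    by apply: eq_bigr => y _; rewrite /GRing.scale /= mulr1.
  by rewrite (sum_delta _ _ xs)//; exact: fset_uniq.
- by rewrite (sum_delta id _ xs)//; exact: fset_uniq.
Qed.

(** The lines carry the edges of the finitely many simplices that subdivide the
    triangle. *)
Lemma PL_lines (h : homeo M) p q r : PL_homeo h -> K [fset p; q; r]%fset ->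
  p != q -> p != r -> q != r ->
  exists ls : seq line, (forall l, l \in ls -> is_line l) /\
    forall z v w e, 0 < e -> (forall s t, range_ge0 e s t -> Delta (hp z v w s t)) ->
      misses ls z v w e ->
      side_affine h (tri p q r z) (dir p q r v) (dir p q r w) e.
Proof.
move=> [f [K' [cK' _ sub] lin] fh] Ks pq pr qr.
have ind := simplex_indep Ks pq pr qr.
have [L [/finite_seqP[Ls LE] LK hE]] := sub _ Ks.
have /choice[lf lfP] (s' : {fset E}) : exists ls : seq line, s' \in Ls ->
    (forall l, l \in ls -> is_line l) /\
    forall z v w e, 0 < e -> misses ls z v w e ->
      simplex_hull s' (tri p q r (hp z v w 0 e)) -> affine_on p q r f z v w e.
  have [s'L|_] := boolP (s' \in Ls); last by exists nil.
  have Ls' : L s' by rewrite LE.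
  have K's' := LK _ Ls'.
  have ai : affinely_independent s' by have [/(_ _ K's')[]] := cK'.
  have [lf _] := lin _ K's'.
  have [|ls [h1 h2]] := @simplex_lines _ _ p q r ind s' f ai lf.
    move=> x xs; have : simplex_hull [fset p; q; r]%fset x.
      by rewrite hE; exists s' => //; exact: vertex_hull.
    by rewrite hull_tri => -[z _ <-]; exists z.
  by exists ls.
exists (flatten [seq lf u | u <- Ls]); split.
  move=> l /flatten_mapP[s' s'L ll]; have [h1 _] := lfP s' s'L; exact: h1.
move=> z v w e e0 D ms.
have r0e : range_ge0 e 0 e by split; rewrite ?normr0 ?lexx ?andbT ltW.
have : simplex_hull [fset p; q; r]%fset (tri p q r (hp z v w 0 e)).
  by apply: tri_hull; exact: D.
rewrite hE LE => -[s' s'L hs'].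
have [_ hP] := lfP s' s'L.
have ms' : misses (lf s') z v w e.
  by move=> l s t ll; apply: ms; apply/flatten_mapP; exists s'.
have [o [u [u' aff]]] := hP z v w e e0 ms' hs'.
exists o, u, u' => s t rst; rewrite fh -tri_hp.
by rewrite (model_psiK md) ?aff//; apply: tri_poly => //; exact: D.
Qed.

Lemma PL_lines_seq (hs : seq (homeo M)) p q r : (forall h, h \in hs -> PL_homeo h) ->
  K [fset p; q; r]%fset -> p != q -> p != r -> q != r ->
  exists ls : seq line, [/\ forall l, l \in ls -> is_line l, (0, 1, 0) \in ls &
    forall h, h \in hs -> forall z v w e, 0 < e ->
      (forall s t, range_ge0 e s t -> Delta (hp z v w s t)) -> misses ls z v w e ->
      side_affine h (tri p q r z) (dir p q r v) (dir p q r w) e].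
Proof.
move=> + Ks pq pr qr; elim: hs => [_|h hs IH hPL].
  (* the line of the edge [p q], needed by [transverse_side] *)
  exists [:: (0, 1, 0)]; split; [|exact: mem_head|by []].
  by move=> l; rewrite inE => /eqP ->; right; rewrite /= oner_neq0.
have [|ls [isl el lsP]] := IH; first by move=> g gs; apply: hPL; rewrite inE gs orbT.
have [ls' [isl' ls'P]] := PL_lines (hPL h (mem_head _ _)) Ks pq pr qr.
exists (ls' ++ ls); split.
- by move=> l; rewrite mem_cat => /orP[/isl'|/isl].
- by rewrite mem_cat el orbT.
- move=> g; rewrite inE => /orP[/eqP ->|gs] z v w e e0 D ms.
    by apply: ls'P => // l s t ll; apply: ms; rewrite mem_cat ll.
  by apply: lsP => // l s t ll; apply: ms; rewrite mem_cat ll orbT.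
Qed.

Variable hs : seq (homeo M).
Hypothesis hsPL : forall h, h \in hs -> PL_homeo h.

Definition tame m : Prop := exists two (x v w1 w2 : E) e, [/\ sides two x v w1 w2 e,
  m = psi x & forall h, h \in hs -> side_affine h x v w1 e /\ side_affine h x v w2 e].

Lemma pt_edge p q r c s t : pt (tri p q r (c, 0)) (q - p) (r - p) s t =
  tri p q r (c + s, t).
Proof. by apply: funE => j; rewrite /pt /tri !vecE /=; ring. Qed.

Lemma tri_edge p q r r' c : tri p q r (c, 0) = tri p q r' (c, 0).
Proof. by rewrite /tri /= !scale0r. Qed.

Lemma small_range c e s t : small c e -> range_ge0 e s t -> Delta (c + s, t).
Proof.
move=> [e0 e1 e2] [+ /andP[t0 te]]; rewrite ler_norml => /andP[h1 h2].
by split => /=; lra.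
Qed.

(** The two triangles along an edge are the two sides at each of its inner points. *)
Lemma edge_sides p q r1 r2 (D : set plane) c e : p != q -> edge_type K p q r1 r2 D ->
  small c e ->
  sides (r1 != r2) (tri p q r1 (c, 0)) (q - p) (r1 - p) (r2 - p) e.
Proof.
move=> pq et sm; have [p1 p2 pall DE] := et; have [e0 _ _] := sm.
have sd r : page p q r -> side (tri p q r1 (c, 0)) (q - p) (r - p) e.
  move=> [rp rq Kr]; split => //.
    by apply: simplex_indep => //; rewrite eq_sym.
  move=> s t rst; rewrite (tri_edge p q r1 r) pt_edge.
  by apply: tri_poly => //; exact: small_range rst.
have ct r : page p q r -> {within [set z : plane | range_ge0 e z.1 z.2],
    continuous (fun z => psi (pt (tri p q r1 (c, 0)) (q - p) (r - p) z.1 z.2))}.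
  move=> [rp rq Kr].
  have -> : (fun z : plane => psi (pt (tri p q r1 (c, 0)) (q - p) (r - p) z.1 z.2)) =
      (fun z => mt p q r (c + z.1, z.2)).
    by apply/funext => z; rewrite (tri_edge p q r1 r) pt_edge.
  apply: within_comp (cont_mtri md Kr).
    by apply: cont_for => z; cont.
  by move=> z; exact: small_range.
split => //; try exact: sd; try exact: ct.
- have -> : half_nbhd (tri p q r1 (c, 0)) (q - p) (r1 - p) e `|`
      half_nbhd (tri p q r1 (c, 0)) (q - p) (r2 - p) e =
      glue psi p q r1 r2 c @` (open_square e `&` D).
    apply/seteqP; split => m.
      move=> [[s [t [h1 h2 h3 ->]]]|[s [t [h1 h2 h3 ->]]]].
        exists (s, t).
          split; first by split => //=; rewrite ger0_norm.
          by case: DE => [[_ ->]|[_ ->]].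
        by rewrite glue_up//= ger0_norm// pt_edge.
      case: DE => [[_ ->]|[r12 ->]].
        exists (s, - t); first by split => //; split => //=; rewrite normrN ger0_norm.
        by rewrite glue_down ?oppr_le0//= normrN ger0_norm// (tri_edge p q r1 r2) pt_edge.
      exists (s, t); first by split => //; split => //=; rewrite ger0_norm.
      by rewrite glue_up//= ger0_norm// -r12 pt_edge.
    move=> [z [[h1 h2] Dz] <-]; have [z2|z2] := leP 0 z.2.
      left; exists z.1, z.2; split => //; first by rewrite -(ger0_norm z2).
      by rewrite glue_up// ger0_norm// pt_edge.
    case: DE => [_|[_ DE]]; last by move: Dz; rewrite DE /half_plane /= leNgt z2.
    right; exists z.1, (- z.2); split => //; first by rewrite oppr_ge0 ltW.
      by rewrite -(ltr0_norm z2).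
    by rewrite glue_down ?(ltW z2)// ltr0_norm// (tri_edge p q r1 r2) pt_edge.
  exact: chart_open (edge_chart md pq et sm).
- by move/negPn/eqP => ->.
- move=> r12 s t s' t' rs rs'; rewrite {2}(tri_edge p q r1 r2) !pt_edge => h.
  have := congr1 (fun y => rho p q r1 c (psi y)) h.
  rewrite (rho_page md c pq p1 (small_range sm rs)).
  rewrite (rho_other md c pq p1 p2 r12 (small_range sm rs')) /= => -[_ tt'].
  have [_ /andP[t0 _]] := rs; have [_ /andP[t'0 _]] := rs'.
  by split; lra.
Qed.

Lemma edge_affine p q r c (ls : seq line) : page p q r -> 0 < c < 1 ->
  (forall l, l \in ls -> is_line l) -> (0, 1, 0) \in ls -> ~ crossing ls (c, 0) ->
  (forall h, h \in hs -> forall z v w e, 0 < e ->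
      (forall s t, range_ge0 e s t -> Delta (hp z v w s t)) -> misses ls z v w e ->
      side_affine h (tri p q r z) (dir p q r v) (dir p q r w) e) ->
  exists2 e, small c e & forall h e', h \in hs -> 0 < e' -> e' <= e ->
    side_affine h (tri p q r (c, 0)) (q - p) (r - p) e'.
Proof.
move=> pr c01 isl el nc lsP; have [e1 sm] := small_exists c01.
have [e2 e20 e2P] := transverse_avoid (transverse_side isl el nc).
have [e10 e11 e12] := sm.
exists (Num.min e1 e2).
  by split; [rewrite lt_min e10|rewrite ge_min e11|rewrite ge_min e12].
move=> g e' ghs e'0; rewrite le_min => /andP[ee1 ee2].
have := lsP g ghs (c, 0) (1, 0) (0, 1) e' e'0.
rewrite /dir /= !scale1r !scale0r addr0 add0r; apply.
  move=> s t rst; rewrite /hp /= !mulr1 !mulr0 !addr0 add0r.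
  by apply: (small_range sm); exact: range_ge0W ee1 rst.
move=> l s t ll [hs' /andP[t0 te]]; apply: e2P => //.
- exact: le_trans ee2.
- by rewrite gtr0_norm// (le_trans te).
- by rewrite gt_eqF.
Qed.

(** A point of an open edge is tame unless it is a crossing of lines in the
    coordinates of one of the two pages. *)
Lemma edge_tame_finite p q : surface R M -> p != q -> K [fset p; q; q]%fset ->
  finite_set [set m | (exists c, 0 < c < 1 /\ m = mt p q q (c, 0)) /\ ~ tame m].
Proof.
move=> sM pq Kpq; have [r1 [r2 [D et]]] := edge_typeP md sM pq Kpq.
have [p1 p2 _ _] := et; have [rp1 rq1 K1] := p1; have [rp2 rq2 K2] := p2.
have [||ls1 [isl1 el1 ls1P]] := PL_lines_seq hsPL K1 pq; rewrite 1?eq_sym//.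
have [||ls2 [isl2 el2 ls2P]] := PL_lines_seq hsPL K2 pq; rewrite 1?eq_sym//.
apply: (@sub_finite_set _ _ (mt p q q @` [set z | crossing ls1 z] `|`
                             mt p q q @` [set z | crossing ls2 z])); last first.
  by rewrite finite_setU; split; apply: finite_image; exact: finite_crossing.
move=> m [[c [c01 mE]] nt]; apply: contrapT => /not_orP[n1 n2]; apply: nt.
have nc1 : ~ crossing ls1 (c, 0) by move=> h; apply: n1; exists (c, 0).
have nc2 : ~ crossing ls2 (c, 0) by move=> h; apply: n2; exists (c, 0).
have [e1 sm1 e1P] := edge_affine p1 c01 isl1 el1 nc1 ls1P.
have [e2 sm2 e2P] := edge_affine p2 c01 isl2 el2 nc2 ls2P.
have [e10 e11 e12] := sm1; have [e20 _ _] := sm2.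
pose e := Num.min e1 e2; have e0 : 0 < e by rewrite lt_min e10.
have ee1 : e <= e1 by rewrite ge_min lexx.
have ee2 : e <= e2 by rewrite ge_min lexx orbT.
have sm : small c e by split => //; lra.
exists (r1 != r2), (tri p q r1 (c, 0)), (q - p), (r1 - p), (r2 - p), e; split.
- exact: edge_sides et sm.
- by rewrite mE; exact: mtri_edge.
- move=> h hhs; split; first exact: e1P.
  by rewrite (tri_edge p q r1 r2); exact: e2P.
Qed.

End Tame.

(** * Points of open triangles *)

Section TameInterior.
Variables (R : realType) (J : Type) (M : topologicalType).
Local Notation E := (J -> R).
Local Notation plane := (R * R)%type.
Implicit Types (p q r x : E) (m : M) (s t e c : R) (z v w : plane).

Variables (K : set {fset E}) (phi : M -> E) (psi : E -> M).
Hypothesis md : model K phi psi.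

Local Notation mt := (mtri psi).
Local Notation bary := (bary K phi).
Local Notation sides := (sides K psi).
Local Notation half_nbhd := (half_nbhd psi).

Definition Dint : set plane := [set z | [/\ 0 < z.1, 0 < z.2 & z.1 + z.2 < 1]].

Lemma DintW z : Dint z -> Delta z.
Proof. by move=> [h1 h2 h3]; split; exact: ltW. Qed.

Lemma open_Dint : open Dint.
Proof.
have -> : Dint = [set z | 0 < z.1] `&` ([set z | 0 < z.2] `&` [set z | 0 < 1 - (z.1 + z.2)]).
  by rewrite predeqE => z; split => [[h1 h2 h3]|[h1 [h2 h3]]]; rewrite /= subr_gt0 in h3 *.
by apply: openI; [|apply: openI]; apply: open_gt0; apply: cont_for => z; cont.
Qed.

Lemma bary_int p q r z : K [fset p; q; r]%fset -> p != q -> p != r -> q != r ->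
  Dint z -> [/\ bary p (mt p q r z) = 1 - z.1 - z.2, bary q (mt p q r z) = z.1 &
    bary r (mt p q r z) = z.2].
Proof.
move=> Ks pq pr qr /DintW Dz; rewrite !(bary_mtri md)//.
have qp : q != p by rewrite eq_sym.
have rp : r != p by rewrite eq_sym.
have rq : r != q by rewrite eq_sym.
by rewrite triW_p// triW_q// triW_r.
Qed.

(** The open triangle is where three barycentric coordinates are positive, and two
    of them are coordinates on it. *)
Lemma image_int p q r (O : set plane) : K [fset p; q; r]%fset ->
  p != q -> p != r -> q != r -> open O -> O `<=` Dint -> open (mt p q r @` O).
Proof.
move=> Ks pq pr qr oO OD.
have cb : continuous (fun m => (bary q m, bary r m) : plane).
  apply: cont_for => m; apply: cont_pair; exact: (cont_bary md).
have -> : mt p q r @` O = [set m | 0 < bary p m /\ 0 < bary q m] `&`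
    ([set m | 0 < bary r m /\ 0 < bary r m] `&` (fun m => (bary q m, bary r m)) @^-1` O).
  apply/seteqP; split => [_ [z Oz <-]|m [[bp bq] [[br _] Om]]].
    have [h1 h2 h3] := OD z Oz; have [e1 e2 e3] := bary_int Ks pq pr qr (OD z Oz).
    rewrite /setI /= e1 e2 e3 -surjective_pairing; split; last by [].
    by split; lra.
  by have [_ _ mE] := star_tri md pq pr qr bp bq br; exists (bary q m, bary r m).
apply: openI; first exact: (open_bary_gt0 md).
by apply: openI; [exact: (open_bary_gt0 md)|apply: open_comp].
Qed.

Lemma int_interior p q r z : K [fset p; q; r]%fset -> p != q -> p != r -> q != r ->
  Dint z -> surface_interior R M (mt p q r z).
Proof.
move=> Ks pq pr qr Dz.
have ch : chart Dint (fun m => (bary q m, bary r m)) (mt p q r).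
  split.
  - apply: cont_for => m; apply: cont_pair; exact: (cont_bary md).
  - by apply: continuous_subspaceW (cont_mtri md Ks) => y; exact: DintW.
  - move=> y Dy; have [_ -> ->] := bary_int Ks pq pr qr Dy.
    by rewrite -surjective_pairing.
  - by apply: image_int => //; exact: open_Dint.
exact: chart_interior ch open_Dint Dz.
Qed.

Lemma tri_hpN p q r z v w s t :
  pt (tri p q r z) (dir p q r v) (- dir p q r w) s t = tri p q r (hp z v w s (- t)).
Proof. by rewrite tri_hp; apply: funE => j; rewrite /pt !vecE; ring. Qed.

Lemma indep_dir p q r v w : indep (q - p) (r - p) -> cross v w != 0 ->
  indep (dir p q r v) (dir p q r w).
Proof.
move=> ind cr s t h; have [h1 h2] : s * v.1 + t * w.1 = 0 /\ s * v.2 + t * w.2 = 0.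
  by apply: ind; rewrite -h; apply: funE => j; rewrite /dir !vecE; ring.
split; apply: (mulIf cr); rewrite mul0r /cross.
  transitivity (w.2 * (s * v.1 + t * w.1) - w.1 * (s * v.2 + t * w.2)); first by ring.
  by rewrite h1 h2 !mulr0 subr0.
transitivity (v.1 * (s * v.2 + t * w.2) - v.2 * (s * v.1 + t * w.1)); first by ring.
by rewrite h1 h2 !mulr0 subr0.
Qed.

(** A segment through a point of an open triangle, along [v], has the two sides
    [w] and [- w]. *)
Lemma interior_sides p q r z v w e : K [fset p; q; r]%fset ->
  p != q -> p != r -> q != r -> cross v w != 0 -> 0 < e ->
  (forall s t, `|s| <= e -> `|t| <= e -> Dint (hp z v w s t)) ->
  sides true (tri p q r z) (dir p q r v) (dir p q r w) (- dir p q r w) e.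
Proof.
move=> Ks pq pr qr cr e0 D; have ind := simplex_indep md Ks pq pr qr.
have iN : indep (dir p q r v) (- dir p q r w).
  move=> s t h; have [s0 t0] : s = 0 /\ - t = 0.
    by apply: (indep_dir ind cr); rewrite -h scaleNr scalerN.
  by split => //; lra.
have rD s t : range_ge0 e s t -> Dint (hp z v w s t).
  by move=> [h1 /andP[h2 h3]]; apply: D => //; rewrite ger0_norm.
have rDN s t : range_ge0 e s t -> Dint (hp z v w s (- t)).
  by move=> [h1 /andP[h2 h3]]; apply: D => //; rewrite normrN ger0_norm.
have poly y : Dint y -> polyhedron K (tri p q r y) by move=> /DintW; exact: tri_poly.
have chp (g : R) : continuous (fun y : plane => hp z v w y.1 (g * y.2)).
  by apply: cont_for => y; rewrite /hp; cont.
split=> //.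
- split=> //; first exact: indep_dir.
  by move=> s t r'; rewrite -tri_hp; apply: poly; exact: rD.
- by split=> // s t r'; rewrite tri_hpN; apply: poly; exact: rDN.
- have -> : (fun y : plane => psi (pt (tri p q r z) (dir p q r v) (dir p q r w) y.1 y.2)) =
      (fun y => mt p q r (hp z v w y.1 (1 * y.2))).
    by apply/funext => y; rewrite -tri_hp mul1r.
  apply: within_comp (cont_mtri md Ks); first exact: chp.
  by move=> y /rD; rewrite mul1r; exact: DintW.
- have -> : (fun y : plane => psi (pt (tri p q r z) (dir p q r v) (- dir p q r w) y.1 y.2)) =
      (fun y => mt p q r (hp z v w y.1 (-1 * y.2))).
    by apply/funext => y; rewrite tri_hpN mulN1r.
  apply: within_comp (cont_mtri md Ks); first exact: chp.
  by move=> y /rDN; rewrite mulN1r; exact: DintW.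
- pose sc (y : plane) : R := cross (y.1 - z.1, y.2 - z.2) w / cross v w.
  pose tc (y : plane) : R := cross v (y.1 - z.1, y.2 - z.2) / cross v w.
  have hpE y : hp z v w (sc y) (tc y) = y.
    have cr' := cr; rewrite /cross in cr'.
    rewrite [RHS]surjective_pairing /hp /sc /tc /cross /=; congr pair;
      by field; exact: cr'.
  have scE s t : sc (hp z v w s t) = s.
    have cr' := cr; rewrite /cross in cr'.
    by rewrite /hp /sc /cross /=; field; exact: cr'.
  have tcE s t : tc (hp z v w s t) = t.
    have cr' := cr; rewrite /cross in cr'.
    by rewrite /hp /tc /cross /=; field; exact: cr'.
  have csc : continuous sc by apply: cont_for => y; rewrite /sc /cross /=; cont.
  have ctc : continuous tc by apply: cont_for => y; rewrite /tc /cross /=; cont.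
  pose O := [set y : plane | `|sc y| < e] `&` [set y : plane | `|tc y| < e].
  have -> : half_nbhd (tri p q r z) (dir p q r v) (dir p q r w) e `|`
      half_nbhd (tri p q r z) (dir p q r v) (- dir p q r w) e = mt p q r @` O.
    apply/seteqP; split => m.
      move=> [[s [t [h1 h2 h3 ->]]]|[s [t [h1 h2 h3 ->]]]].
        exists (hp z v w s t); last by rewrite -tri_hp.
        by split; rewrite /= ?scE ?tcE// ger0_norm.
      exists (hp z v w s (- t)); last by rewrite tri_hpN.
      by split; rewrite /= ?scE ?tcE// normrN ger0_norm.
    move=> [y [h1 h2] <-]; have [t0|t0] := leP 0 (tc y).
      left; exists (sc y), (tc y); split => //; first by rewrite -(ger0_norm t0).
      by rewrite -tri_hp hpE.
    right; exists (sc y), (- tc y); split => //; first by rewrite oppr_ge0 ltW.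
      by rewrite -(ltr0_norm t0).
    by rewrite tri_hpN opprK hpE.
  apply: image_int => //.
    by apply: openI; exact: open_norm_lt.
  by move=> y [h1 h2]; rewrite -(hpE y); apply: D; exact: ltW.
- move=> _ s t s' t' [_ /andP[t0 _]] [_ /andP[t'0 _]] h.
  have h' : pt (tri p q r z) (dir p q r v) (dir p q r w) s t =
      pt (tri p q r z) (dir p q r v) (dir p q r w) s' (- t').
    by rewrite h; apply: funE => j; rewrite /pt !vecE; ring.
  have [_ tt] := pt_inj (indep_dir ind cr) h'.
  by split; lra.
Qed.

Variable hs : seq (homeo M).
Hypothesis hsPL : forall h, h \in hs -> PL_homeo K phi h.
Local Notation tame := (tame K phi psi hs).
Hypothesis sM : surface R M.

(** Away from the crossings at most one direction of lines passes through the
    point; it is taken as the edge of the two sides. *)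
Lemma int_tame_finite p q r : K [fset p; q; r]%fset -> p != q -> p != r -> q != r ->
  finite_set [set m | (exists z, Dint z /\ m = mt p q r z) /\ ~ tame m].
Proof.
move=> Ks pq pr qr; have [ls [isl _ lsP]] := PL_lines_seq md hsPL Ks pq pr qr.
apply: (@sub_finite_set _ _ (mt p q r @` [set z | crossing ls z])); last first.
  by apply: finite_image; exact: finite_crossing.
move=> m [[z [Dz mE]] nt]; apply: contrapT => n1; apply: nt.
have nc : ~ crossing ls z by move=> h; apply: n1; exists z.
have [v [w [cr tr]]] := transverse_exists isl nc.
have [e1 e10 e1P] := transverse_avoid tr.
have [e2 e20 e2P] : exists2 d : R, 0 < d & forall y : plane, `|y.1 - 0| < d ->
    `|y.2 - 0| < d -> Dint (hp z v w y.1 y.2).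
  apply/(nbhs_plane (0, 0)); have chp : {for (0, 0), continuous (fun y : plane => hp z v w y.1 y.2)}.
    by rewrite /hp; cont.
  apply: chp; rewrite /hp /= !mul0r !addr0 -surjective_pairing.
  by apply: open_nbhs_nbhs; split => //; exact: open_Dint.
pose e := Num.min e1 (e2 / 2).
have e0 : 0 < e by rewrite lt_min e10 divr_gt0.
have ee1 : e <= e1 by rewrite ge_min lexx.
have ee2 : e < e2 by apply: (@le_lt_trans _ _ (e2 / 2)); [rewrite ge_min lexx orbT|lra].
have D s t : `|s| <= e -> `|t| <= e -> Dint (hp z v w s t).
  by move=> h1 h2; apply: (e2P (s, t)) => /=; rewrite subr0; apply: le_lt_trans ee2.
have rD s t : range_ge0 e s t -> Dint (hp z v w s t).
  by move=> [h1 /andP[h2 h3]]; apply: D => //; rewrite ger0_norm.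
exists true, (tri p q r z), (dir p q r v), (dir p q r w), (- dir p q r w), e; split.
- exact: interior_sides.
- exact: mE.
have wN : dir p q r (- w.1, - w.2) = - dir p q r w.
  by apply: funE => j; rewrite /dir !vecE /=; ring.
have hpN s t : hp z v (- w.1, - w.2) s t = hp z v w s (- t).
  by rewrite /hp /= !mulrN !mulNr.
move=> h hhs; split.
  apply: lsP => //; first by move=> s t /rD; exact: DintW.
  move=> l s t ll [h1 /andP[h2 h3]]; apply: e1P => //; first exact: le_trans ee1.
    by rewrite gtr0_norm// (le_trans h3).
  by rewrite gt_eqF.
rewrite -wN; apply: lsP => //.
  move=> s t [h1 /andP[h2 h3]]; rewrite hpN; apply/DintW/D => //.
  by rewrite normrN ger0_norm.
move=> l s t ll [h1 /andP[h2 h3]]; rewrite hpN; apply: e1P => //.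
- exact: le_trans ee1.
- by rewrite normrN gtr0_norm// (le_trans h3).
- by rewrite oppr_eq0 gt_eqF.
Qed.

Lemma segment_cases p q c : 0 <= c <= 1 ->
  [\/ mt p q q (c, 0) = psi p, mt p q q (c, 0) = psi q | 0 < c < 1].
Proof.
case/andP => c0 c1; have [c00|c00] := eqVneq c 0.
  constructor 1; rewrite /mtri; congr psi; apply: funE => j.
  by rewrite /tri c00 !vecE /=; ring.
have [c11|c11] := eqVneq c 1.
  constructor 2; rewrite /mtri; congr psi; apply: funE => j.
  by rewrite /tri c11 !vecE /=; ring.
by constructor 3; rewrite !lt_neqAle c0 c1 c11 eq_sym c00.
Qed.

Lemma triangle_cases p q r z : Delta z ->
  [\/ Dint z, exists2 c, 0 <= c <= 1 & mt p q r z = mt p q q (c, 0),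
      exists2 c, 0 <= c <= 1 & mt p q r z = mt p r r (c, 0) |
      exists2 c, 0 <= c <= 1 & mt p q r z = mt q r r (c, 0)].
Proof.
move=> [z1 z2 z12]; have [e1|e1] := eqVneq z.1 0.
  constructor 3; exists z.2; first by apply/andP; split; lra.
  by rewrite /mtri; congr psi; apply: funE => j; rewrite /tri !vecE /= e1; ring.
have [e2|e2] := eqVneq z.2 0.
  constructor 2; exists z.1; first by apply/andP; split; lra.
  by rewrite /mtri; congr psi; apply: funE => j; rewrite /tri !vecE /= e2; ring.
have [e3|e3] := eqVneq (z.1 + z.2) 1.
  constructor 4; exists z.2; first by apply/andP; split; lra.
  rewrite /mtri; congr psi; apply: funE => j; rewrite /tri !vecE /=.
  have -> : z.1 = 1 - z.2 by lra.
  by ring.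
by constructor 1; split; rewrite lt_neqAle ?z1 ?z2 ?z12 ?andbT // eq_sym.
Qed.

Lemma face2 p q r a b : K [fset p; q; r]%fset -> a \in [fset p; q; r]%fset ->
  b \in [fset p; q; r]%fset -> K [fset a; b; b]%fset.
Proof.
move=> Ks ain bin; apply: (face md Ks); first by apply/fset0Pn; exists a; rewrite !in_fsetE eqxx.
apply/fsubsetP => x xin; suff [->|->] : x = a \/ x = b by [].
by move: xin; rewrite !in_fsetE -orbA orbb => /orP[] /eqP ->; [left|right].
Qed.

Definition bad_edge p q : set M :=
  [set m | (exists c, 0 < c < 1 /\ m = mt p q q (c, 0)) /\ ~ tame m].

Lemma bad_segment p q m c : 0 <= c <= 1 -> m = mt p q q (c, 0) -> ~ tame m ->
  (bad_edge p q `|` [set psi p; psi q]) m.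
Proof.
move=> cI mE nt; have [e|e|cI'] := @segment_cases p q c cI.
- by right; left; rewrite mE e.
- by right; right; rewrite mE e.
- by left; split => //; exists c.
Qed.

Lemma not_tame_finite (s : {fset E}) : K s -> finite_set [set m | simplex_hull s (phi m) /\ ~ tame m].
Proof.
move=> Ks; have fe p q : p != q -> K [fset p; q; q]%fset ->
    finite_set (bad_edge p q `|` [set psi p; psi q]).
  move=> pq Kpq; rewrite finite_setU; split; last exact: finite_set2.
  exact: edge_tame_finite.
have inv p q r m : simplex_hull [fset p; q; r]%fset (phi m) ->
    exists2 z, Delta z & m = mt p q r z.
  by rewrite hull_tri => -[z Dz zE]; exists z => //; rewrite /mtri zE (model_phiK md).
have [[p sE]|[p [q [pq sE]]]|[p [q [r [pq pr qr sE]]]]] :=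
  simplex_cases (model_complex md) (model_dim md) Ks; rewrite sE in Ks *.
- apply: (@sub_finite_set _ _ [set psi p]); last exact: finite_set1.
  move=> m [/inv[z _ ->] _]; rewrite /mtri /=; congr psi.
  by apply: funE => j; rewrite /tri !vecE; ring.
- apply: (@sub_finite_set _ _ (bad_edge p q `|` [set psi p; psi q])); last exact: fe.
  move=> m [/inv[z [z1 z2 z12] mE] nt]; apply: (@bad_segment p q m (z.1 + z.2)) => //.
    by apply/andP; split; lra.
  rewrite mE /mtri; congr psi; apply: funE => j; rewrite /tri !vecE /=; ring.
pose bi := [set m | (exists z, Dint z /\ m = mt p q r z) /\ ~ tame m].
apply: (@sub_finite_set _ _ (bi `|` (bad_edge p q `|` [set psi p; psi q]) `|`
  (bad_edge p r `|` [set psi p; psi r]) `|` (bad_edge q r `|` [set psi q; psi r]))).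
  move=> m [/inv[z Dz mE] nt]; have [Di|[c cI cE]|[c cI cE]|[c cI cE]] := @triangle_cases p q r z Dz.
  + by left; left; left; split => //; exists z.
  + by left; left; right; apply: (bad_segment cI _ nt); rewrite mE.
  + by left; right; apply: (bad_segment cI _ nt); rewrite mE.
  + by right; apply: (bad_segment cI _ nt); rewrite mE.
have [ps qs rs] : [/\ p \in [fset p; q; r]%fset, q \in [fset p; q; r]%fset &
    r \in [fset p; q; r]%fset] by rewrite !in_fsetE !eqxx !orbT.
rewrite finite_setU; split; last by apply: fe => //; exact: face2 Ks qs rs.
rewrite finite_setU; split; last by apply: fe => //; exact: face2 Ks ps rs.
rewrite finite_setU; split; last by apply: fe => //; exact: face2 Ks ps qs.
exact: int_tame_finite.
Qed.

End TameInterior.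

(** * Spreading a coincidence over a connected surface *)

Section Discrete.
Variables (R : realType) (M : topologicalType).

(** The points of [A] are open and closed in it. *)
Lemma connected_discrete (A : set M) : connected A ->
  (forall S, S `<=` A -> closed S) -> is_subset1 A.
Proof.
move=> cA dA x y Ax Ay.
suff AE : [set x] = A by move: Ay; rewrite -AE => ->.
apply: cA; first by exists x.
- exists (~` (A `\ x)); first by apply: closed_openC; apply: dA => z [].
  apply/seteqP; split => [z ->|z [Az nz]]; first by split => // -[_]; exact.
  by apply: contrapT => zx; apply: nz.
- exists [set x]; first by apply: dA => z ->.
  by apply/seteqP; split => [z ->|z []].
Qed.

(** The closure of [W] is open: at a point [p] of the discrete set [T], the
    trace of [W] on a connected punctured neighbourhood is open and closed. *)
Lemma spread_over (W T : set M) : surface R M -> connected [set: M] ->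
  open W -> W !=set0 -> (forall S, S `<=` T -> closed S) ->
  (forall m, ~ T m -> closure W m -> W m) -> closure W = setT.
Proof.
move=> sM cM oW [m0 Wm0] dT WT.
apply: cM; first by exists m0; exact: subset_closure.
- exists (closure W); last by rewrite setTI.
  rewrite openE => p Yp; rewrite /interior.
  have [Wp|nWp] := pselect (W p).
    apply: filterS (open_nbhs_nbhs (conj oW Wp)); exact: subset_closure.
  have [Tp|nTp] := pselect (T p); last by case: (nWp (WT p nTp Yp)).
  have nN : nbhs p (~` (T `\ p)).
    apply: open_nbhs_nbhs; split; last by case=> _; exact.
    by apply: closed_openC; apply: dT => z [].
  have [N' [oN' N'N cN' _]] := no_local_cut sM nN.
  have QW : (N' `\ p) `&` W = N' `\ p.
    apply: cN'.
    - have [m [Wm N'm]] := Yp N' (open_nbhs_nbhs oN').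
      by exists m; split => //; split => // mp; apply: nWp; rewrite -mp.
    - by exists W.
    - exists (closure W); first exact: closed_closure.
      apply/seteqP; split => m [N'm Wm]; split => //; first exact: subset_closure.
      by have [h1 h2] := N'm; apply: WT Wm => Tm; case: (N'N m h1).
  apply: filterS (open_nbhs_nbhs oN') => m N'm.
  have [->//|mp] := pselect (m = p).
  by apply: subset_closure; have [] : ((N' `\ p) `&` W) m by rewrite QW.
- by exists (closure W); [exact: closed_closure|rewrite setTI].
Qed.

End Discrete.

Section Rigidity.
Variables (R : realType) (J : Type) (M : topologicalType).
Local Notation E := (J -> R).
Local Notation plane := (R * R)%type.
Implicit Types (p q r x : E) (m : M) (s t e c : R) (z v w : plane).

Variables (K : set {fset E}) (phi : M -> E) (psi : E -> M).
Hypothesis md : model K phi psi.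
Hypothesis sM : surface R M.

Local Notation mt := (mtri psi).
Local Notation sides := (sides K psi).
Local Notation half_nbhd := (half_nbhd psi).

(** Finite sets are closed in each simplex, and the topology is weak. Applied to
    all subsets of a set, this makes the set discrete. *)
Lemma closed_of_finite (S : set M) :
  (forall s' : {fset E}, K s' -> finite_set [set m | simplex_hull s' (phi m) /\ S m]) ->
  closed S.
Proof.
move=> fS; apply/(model_weak md) => s' Ks'.
have -> : phi @` S `&` simplex_hull s' = phi @` [set m | simplex_hull s' (phi m) /\ S m].
  apply/seteqP; split => [_ [[m Sm <-] hm]|_ [m [hm Sm] <-]]; first by exists m.
  by split => //; exists m.
apply: (iffLR accessible_finite_set_closed (hausdorff_accessible (@hausdorff_ptws R J))).
exact/finite_image/fS.
Qed.

Definition vertices : set M := [set m | exists p, K [fset p; p; p]%fset /\ m = psi p].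

Lemma closed_vertices (S : set M) : S `<=` vertices -> closed S.
Proof.
move=> SV; apply: closed_of_finite => s' Ks'.
apply: (@sub_finite_set _ _ (psi @` [set` s'])); last exact/finite_image/finite_fset.
move=> m [hm /SV[p [Kp mE]]]; exists p => //=.
have pE : p = tri p p p (0, 0) by apply: funE => j; rewrite /tri !vecE /=; ring.
have D0 : Delta (0 : R, 0 : R) by split => //=; lra.
have mE' : phi m = p.
  by rewrite mE {2}pE -(phi_mtri md Kp D0) /mtri -pE.
apply: (bc_gt0_in (model_complex md) Ks' hm).
rewrite mE' {1}pE (bc_tri (model_complex md) Kp D0) /triW eqxx /=; lra.
Qed.

Lemma vertexP (s' : {fset E}) p : K s' -> p \in s' -> vertices (psi p).
Proof.
move=> Ks' ps; exists p; split => //; apply: (face md Ks').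
  by apply/fset0Pn; exists p; rewrite !in_fsetE eqxx.
by apply/fsubsetP => x; rewrite [_ \in [fset p; p; p]%fset]in_fsetU in_fset2 orbb in_fset1 orbb => /eqP ->.
Qed.

(** Open triangles consist of interior points. *)
Lemma boundary_edge_point m : surface_boundary R M m -> ~ vertices m ->
  exists p q c, [/\ p != q, K [fset p; q; q]%fset, 0 < c < 1 & m = mt p q q (c, 0)].
Proof.
move=> bm nv; have [s' Ks' hm] := model_poly md m.
have inv p q r : simplex_hull [fset p; q; r]%fset (phi m) ->
    exists2 z, Delta z & m = mt p q r z.
  by rewrite hull_tri => -[z Dz zE]; exists z => //; rewrite /mtri zE (model_phiK md).
have edge p q c : p \in s' -> q \in s' -> p != q -> K [fset p; q; q]%fset ->
    0 <= c <= 1 -> m = mt p q q (c, 0) ->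
    exists p q c, [/\ p != q, K [fset p; q; q]%fset, 0 < c < 1 & m = mt p q q (c, 0)].
  move=> ps qs pq Kpq cI mE; have [h|h|cI'] := segment_cases psi p q cI.
  - by case: nv; rewrite mE h; exact: vertexP ps.
  - by case: nv; rewrite mE h; exact: vertexP qs.
  - by exists p, q, c.
have := simplex_cases (model_complex md) (model_dim md) Ks'.
case=> [[p sE]|[p [q [pq sE]]]|[p [q [r [pq pr qr sE]]]]]; have Ks := Ks';
  rewrite sE in Ks hm; have [z Dz mE] := inv _ _ _ hm.
- case: nv; exists p; split => //; rewrite mE /mtri; congr psi.
  by apply: funE => j; rewrite /tri !vecE; ring.
- have [z1 z2 z12] := Dz; apply: (edge p q (z.1 + z.2)); rewrite ?sE ?in_fsetE ?eqxx ?orbT//.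
    by apply/andP; split; lra.
  rewrite mE /mtri; congr psi; apply: funE => j; rewrite /tri !vecE /=; ring.
- have [ps qs rs] : [/\ p \in s', q \in s' & r \in s'].
    by rewrite sE !in_fsetE !eqxx !orbT.
  have := ps; have := qs; have := rs; rewrite sE => rs1 qs1 ps1.
  have [Di|[c cI cE]|[c cI cE]|[c cI cE]] := triangle_cases psi p q r Dz.
  + by case: bm; rewrite mE; exact: (int_interior md).
  + by apply: (edge p q c) => //; [exact: (face2 md Ks)|rewrite mE].
  + by apply: (edge p r c) => //; [exact: (face2 md Ks)|rewrite mE].
  + by apply: (edge q r c) => //; [exact: (face2 md Ks)|rewrite mE].
Qed.

(** The preimage of the boundary line under a half-plane chart; its points are
    boundary points by invariance of the boundary. *)
Lemma boundary_arc m : surface_boundary R M m -> exists A : set M,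
  [/\ A m, connected A, A `<=` surface_boundary R M & ~ is_subset1 A].
Proof.
move=> bm; have [_ _ /(_ m)[U [V [[oU Um] oV [f [g [cf cg fg gf]]]]]]] := sM.
have [[Vm Hm] gm] := fg m Um.
have fm2 : (f m).2 = 0.
  apply/eqP/negPn/negP => n0; apply: bm.
  have fm0 : 0 < (f m).2 by rewrite lt_neqAle eq_sym n0.
  pose V' := V `&` [set z : plane | 0 < z.2].
  have oV' : open V'.
    by apply: openI => //; apply: open_gt0; apply: cont_for => z; cont.
  have V'V z : V' z -> (V `&` half_plane R) z by move=> [h1 h2]; split => //; exact: ltW.
  exists (U `&` f @^-1` V'), V'; split => //.
    split; last by split => //; split.
    rewrite openE => u [Uu V'u]; apply: filterI; first by apply: open_nbhs_nbhs.
    by apply: (within_open oU cf Uu); exact: open_nbhs_nbhs.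
  exists f, g; split.
  - by apply: continuous_subspaceW cf => u [].
  - by apply: continuous_subspaceW cg => z /V'V.
  - by move=> u [Uu V'u]; split => //; have [] := fg u Uu.
  - by move=> z V'z; have [Ug fgz] := gf z (V'V z V'z); split => //; split => //=; rewrite fgz.
have /nbhs_plane[d d0 dP] : nbhs (f m) V by exact: open_nbhs_nbhs.
pose L := [set z : plane | `|z.1 - (f m).1| < d /\ z.2 = 0].
have LV : L `<=` V `&` half_plane R.
  move=> z [z1 z2]; split; last by rewrite /half_plane /= z2.
  by apply: dP => //; rewrite z2 fm2 subrr normr0.
have Lm : L (f m) by split => //; rewrite subrr normr0.
exists (g @` L); split.
- by exists (f m).
- apply: connected_continuous_connected; last exact: continuous_subspaceW cg.
  apply: convex_connected => z w t [z1 z2] [w1 w2] tI; split; last first.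
    by rewrite /segpt /= z2 w2; ring.
  move: z1 w1; rewrite /segpt /= !ltr_norml => /andP[h1 h2] /andP[h3 h4].
  by have := lt_seg tI h1 h3; have := gt_seg tI h2 h4; lra.
- move=> _ [z Lz <-] [U1 [V1 [pU1 oV1 h1]]]; have [Ug fgz] := gf z (LV z Lz).
  apply: (boundary_not_interior pU1 oV1 h1 (conj oU Ug) oV cf cg fg gf).
  by rewrite fgz; case: Lz.
- move=> sub; have L2 : L ((f m).1 + d / 2, 0).
    by split => //=; rewrite addrAC subrr add0r gtr0_norm; lra.
  have : g (f m) = g ((f m).1 + d / 2, 0).
    by apply: sub; [exists (f m)|exists ((f m).1 + d / 2, 0)].
  move/(congr1 f); have [_ ->] := gf _ (LV _ Lm); have [_ ->] := gf _ (LV _ L2).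
  by move/(congr1 fst) => /=; lra.
Qed.

Variable B : set M.
Hypothesis bB : exists2 I : set M, I `<=` surface_boundary R M &
  B = \bigcup_(x in I) connected_component (surface_boundary R M) x.
Hypothesis B0 : B !=set0.

Lemma boundary_subset : B `<=` surface_boundary R M.
Proof. by have [I _ ->] := bB => m [x _ /connected_component_sub]. Qed.

Lemma connected_in_B (A : set M) m : B m -> A m -> connected A ->
  A `<=` surface_boundary R M -> A `<=` B.
Proof.
have [I _ ->] := bB => -[x Ix xm] Am cA AB y Ay; exists x => //.
by rewrite (same_connected_component xm); exact: (connected_component_max Am AB cA).
Qed.

(** An arc of the boundary is not made of vertices, which are discrete, so it meets
    an open edge. This edge has one page, since the inner points of an edge with two
    pages are interior points, and then the whole open edge is in the boundary. *)
Lemma edge_in_B : exists p q r, [/\ p != q, edge_type K p q r r (half_plane R) &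
  forall c, 0 < c < 1 -> B (mt p q r (c, 0))].
Proof.
have [b Bb] := B0; have [A [Ab cA AB nA]] := boundary_arc (boundary_subset Bb).
have [y Ay nv] : exists2 y, A y & ~ vertices y.
  apply: contrapT => h; apply: nA; apply: connected_discrete => // S SA.
  apply: closed_vertices => y /SA Ay; apply: contrapT => ny.
  by apply: h; exists y.
have By : B y by exact: (connected_in_B Bb Ab cA AB).
have [p [q [c0 [pq Kpq c0I yE]]]] := boundary_edge_point (AB y Ay) nv.
have [r1 [r2 [D et]]] := edge_typeP md sM pq Kpq.
have gl0 c : glue psi p q r1 r2 c (0, 0) = mt p q r1 (c, 0).
  by rewrite glue_up//= addr0 normr0.
have sq0 c e : small c e -> open_square e (0, 0).
  by move=> [e0 _ _]; split; rewrite /= normr0.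
have [e sm] := small_exists c0I; have [p1 _ _ [[r12 DE]|[r12 DE]]] := et.
  have ch := edge_chart md pq et sm; rewrite DE setIT in ch.
  case: (AB y Ay); rewrite yE (mtri_edge psi p q q r1) -(gl0 c0).
  apply: (chart_interior ch); first exact: open_open_square.
  exact: sq0 sm.
have [rp rq K1] := p1.
have bd c : 0 < c < 1 -> surface_boundary R M (mt p q r1 (c, 0)).
  move=> cI; have [e' sm'] := small_exists cI.
  have ch := edge_chart md pq et sm'; rewrite DE in ch; rewrite -gl0.
  apply: (half_chart_boundary _ ch) => //; first exact: open_open_square.
  exact: sq0 sm'.
exists p, q, r1; split => //; first by rewrite {2}r12 -DE.
pose L := [set z : plane | 0 < z.1 < 1 /\ z.2 = 0].
move=> c cI; apply: (@connected_in_B (mt p q r1 @` L) y By).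
- by exists (c0, 0) => //; rewrite yE (mtri_edge psi p q q r1).
- apply: connected_continuous_connected; last first.
    apply: continuous_subspaceW (cont_mtri md K1) => z [/andP[z1 z1'] z2].
    by split; rewrite ?z2 ?lexx//; lra.
  apply: convex_connected => z w t [/andP[z1 z1'] z2] [/andP[w1 w1'] w2] tI; split.
    by rewrite /segpt /= lt_seg// gt_seg.
  by rewrite /segpt /= z2 w2; ring.
- move=> _ [z [zI z2] <-]; rewrite [z]surjective_pairing z2; exact: bd.
- by exists (c, 0).
Qed.

Variable P : seq (homeo M * homeo M).
Hypothesis PPL : forall gh, gh \in P -> PL_homeo K phi gh.1 /\ PL_homeo K phi gh.2.
Hypothesis PB : forall gh, gh \in P -> forall m, B m -> gh.1 m = gh.2 m.
Hypothesis trivG : trivial_germs K psi P.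

Let hs := map fst P ++ map snd P.

Lemma hs_PL h : h \in hs -> PL_homeo K phi h.
Proof. by rewrite mem_cat => /orP[] /mapP[gh /PPL[h1 h2] ->]. Qed.

Lemma hs_fst gh : gh \in P -> gh.1 \in hs /\ gh.2 \in hs.
Proof. by move=> ghP; rewrite !mem_cat !map_f ?orbT. Qed.

(** Finitely many crossings leave a point of the edge at which all maps are affine
    on the page. *)
Lemma start_somewhere : (coincidence P)° !=set0.
Proof.
have [p [q [r [pq et eB]]]] := edge_in_B; have [p1 _ _ _] := et.
have [rp rq K1] := p1.
have [pr qr] : p != r /\ q != r by rewrite ![_ == r]eq_sym.
have [ls [isl el lsP]] := PL_lines_seq md hs_PL K1 pq pr qr.
have [c cI nc] : exists2 c, 0 < c < 1 & ~ crossing ls (c, 0).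
  apply: contrapT => h; apply: infinite_nat.
  pose f (n : nat) : plane := (n.+2%:R^-1, 0).
  have -> : [set: nat] = f @^-1` [set z | crossing ls z].
    apply/seteqP; split => // n _; apply: contrapT => nf; apply: h.
    exists n.+2%:R^-1 => //; rewrite invr_gt0 ltr0Sn invf_lt1 ?ltr0Sn//.
    by rewrite ltr1n.
  apply: finite_preimage; last exact: finite_crossing.
  by move=> n n' _ _ [] /invr_inj /eqP; rewrite eqr_nat => /eqP[].
have [e sm eP] := edge_affine (phi := phi) (psi := psi) p1 cI isl el nc lsP.
have [e0 e1 e2] := sm.
exists (psi (tri p q r (c, 0))).
apply: (start_edge (v := q - p) (w := r - p) (e := e) md trivG).
- by have := edge_sides md pq et sm; rewrite eqxx.
- by move=> gh /hs_fst[h1 h2]; split; apply: eP.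
- move=> s se gh ghP; apply: PB => //; rewrite pt_edge; apply: eB.
  by move: se; rewrite ler_norml => /andP[h1 h2]; apply/andP; split; lra.
Qed.

(** [cross_edge], from whichever side meets the interior of the coincidence set. *)
Lemma spread_tame m : tame K phi psi hs m -> closure (coincidence P)° m ->
  (coincidence P)° m.
Proof.
move=> [two [x [v [w1 [w2 [e [sd -> aff]]]]]]] Wx.
have e0 := side_pos (sides1 sd).
have Ux : (half_nbhd x v w1 e `|` half_nbhd x v w2 e) (psi x).
  by left; exists 0, 0; split; rewrite ?normr0// pt00.
have [m' [Wm' []]] := Wx _ (open_nbhs_nbhs (conj (sides_open sd) Ux)).
- move=> [s [t [h1 h2 h3 mE]]]; rewrite mE in Wm'.
  apply: (cross_edge md trivG sd _ h1 h2 h3 Wm').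
  by move=> gh /hs_fst[/aff[? ?] /aff[? ?]].
- move=> [s [t [h1 h2 h3 mE]]]; rewrite mE in Wm'.
  apply: (cross_edge md trivG (sides_sym sd) _ h1 h2 h3 Wm').
  by move=> gh /hs_fst[/aff[? ?] /aff[? ?]].
Qed.

Hypothesis cM : connected [set: M].

Lemma coincidence_everywhere gh m : gh \in P -> gh.1 m = gh.2 m.
Proof.
move=> ghP; have clW : closure (coincidence P)° = setT.
  apply: (spread_over (T := [set m | ~ tame K phi psi hs m]) sM cM).
  - exact: open_interior.
  - exact: start_somewhere.
  - move=> S ST; apply: closed_of_finite => s' Ks'.
    apply: sub_finite_set (not_tame_finite md hs_PL sM Ks').
    by move=> u [hu /ST].
  - by move=> u /contrapT; exact: spread_tame.
have [hM _ _] := sM; apply: hM => A A' nA nA'.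
have nm : nbhs m (gh.1 @^-1` A `&` gh.2 @^-1` A').
  by apply: filterI; [exact: (homeo_fun_cont (h := gh.1))|exact: (homeo_fun_cont (h := gh.2))].
have cm : closure (coincidence P)° m by rewrite clW.
have [u [/interior_subset Wu [Au A'u]]] := cm _ nm.
by exists (gh.1 u); split => //; rewrite (Wu gh ghP).
Qed.

End Rigidity.

(** * The order *)

Lemma triangulation_model (R : realType) (J : Type) (M : topologicalType)
    (K : set {fset (J -> R)}) (phi : M -> (J -> R)) (m0 : M) :
  triangulation K phi -> exists psi, model K phi psi.
Proof.
move=> [cK dK [phiP phi_inj phi_surj] weak].
have /choice[psi psiP] (y : J -> R) : exists m, polyhedron K y -> phi m = y.
  have [/phi_surj[m _ mE]|n] := pselect (polyhedron K y); first by exists m.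
  by exists m0.
have poly m : polyhedron K (phi m) by exact: phiP.
exists psi; split => //.
by move=> m; apply: phi_inj; rewrite ?inE// psiP.
Qed.

Theorem theorem10 (R : realType) (M : topologicalType) (J : Type)
  (K : set {fset (J -> R)}) (phi : M -> (J -> R)) (B : set M) :
  surface R M ->
  connected [set: M] ->
  triangulation K phi ->
  surface_boundary R M !=set0 ->
  (exists2 I : set M, I `<=` surface_boundary R M &
     B = \bigcup_(x in I) connected_component (surface_boundary R M) x) ->
  B !=set0 ->
  left_orderable (Homeo_PL_rel K phi B).
Proof.
move=> sM cM tM _ bB B0; have [m0 _] := B0.
have [psi md] := triangulation_model m0 tM.
apply: left_orderable_of_signs => A AH [a0 a0A a0n].
have [P PA PH] : exists2 P : seq (homeo M * homeo M), A = quotients P &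
    forall gh, gh \in P -> Homeo_PL_rel K phi B gh.1 /\ Homeo_PL_rel K phi B gh.2.
  elim: A AH {a0A} => [_|a A IH AH]; first by exists nil.
  have [|P PA PH] := IH; first by move=> b bA; apply: AH; rewrite inE bA orbT.
  have [g [h [Hg Hh aE]]] := AH a (mem_head _ _).
  exists ((g, h) :: P); first by rewrite /quotients /= -aE PA.
  by move=> gh; rewrite inE => /orP[/eqP ->|/PH].
apply: contrapT => nsign.
have trivG : trivial_germs K psi P.
  move=> x v w e sd; rewrite -PA => germs a aA; apply: contrapT => na; apply: nsign.
  by apply: (germ_signs md sd germs); exists a.
have PPL gh : gh \in P -> PL_homeo K phi gh.1 /\ PL_homeo K phi gh.2.
  by move=> /PH[[_ h1] [_ h2]].
have PB gh : gh \in P -> forall m, B m -> gh.1 m = gh.2 m.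
  by move=> /PH[[h1 _] [h2 _]] m Bm; rewrite h1// h2.
have same m gh := coincidence_everywhere md sM bB B0 PPL PB trivG cM m (gh := gh).
move/negP: a0n; apply; apply/eqP; move: a0A; rewrite PA => /mapP[gh ghP ->].
apply: homeoP => m; change ((gh.1^-1)%g (gh.2 m) = m).
by rewrite -(same m gh ghP); exact: homeo_funK.
Qed.
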